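(* Let $\rho_1>0$, $\rho_2>1$, $s>0$ and $t>\rho_1+\rho_2$. Let $\psi\in(\mathcal{S}^{\rho_1}_{\rho_2})_0(\mathbb{R}^n)$ be a non-degenerate wavelet and let $\phi\in(\mathcal{S}^{\rho_1}_{\rho_2})_0(\mathbb{R}^n)$ be a reconstruction wavelet for it. Then the Calderón reproducing formula $$\mathrm{Id}=\frac{1}{c_{\psi,\phi}}\mathcal{M}_\phi\mathcal{W}_\psi$$ holds in $((\mathcal{S}^{s}_{t})_0(\mathbb{R}^n))'$.
   Context: Notation: $\mathbb{N}=\{0,1,2,\dots\}$, $\mathbb{R}_+=(0,\infty)$, $\mathbb{H}^{n+1}=\mathbb{R}^n\times\mathbb{R}_+$ with points $(b,a)$, $\mathbb{S}^{n-1}$ is the unit sphere of $\mathbb{R}^n$, $\langle x\rangle=(1+|x|^2)^{1/2}$, $\hat\varphi(\xi)=\int_{\mathbb{R}^n}\varphi(x)e^{-ix\cdot\xi}dx$; for $\beta\in\mathbb{N}^n$, $|\beta|=\beta_1+\dots+\beta_n$, $\beta!=\beta_1!\cdots\beta_n!$; $\beta!^{s}$ means $(\beta!)^s$. Primes denote (continuous) dual spaces, and $\langle\cdot,\cdot\rangle$ is the bilinear dual pairing. Gelfand-Shilov spaces: for $\rho_1,\rho_2>0$, $\mathcal{S}^{\rho_1}_{\rho_2}(\mathbb{R}^n)$ consists of all $\varphi$ in the Schwartz space $\mathcal{S}(\mathbb{R}^n)$ such that for some $h>0$ $$p_h^{\rho_1,\rho_2}(\varphi)=\sup_{x\in\mathbb{R}^n,\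 \alpha,\beta\in\mathbb{N}^n}\frac{h^{|\alpha+\beta|}}{\alpha!^{\rho_2}\beta!^{\rho_1}}|x^\alpha\varphi^{(\beta)}(x)|<\infty,$$ with the inductive limit topology (in $h>0$). Its closed subspace, with the relative topology, $(\mathcal{S}^{\rho_1}_{\rho_2})_0(\mathbb{R}^n)$ consists of those $\varphi\in\mathcal{S}^{\rho_1}_{\rho_2}(\mathbb{R}^n)$ with $\int_{\mathbb{R}^n}x^m\varphi(x)\,dx=0$ for all $m\in\mathbb{N}^n$. Similarly $\mathcal{S}_0(\mathbb{R}^n)$ is the subspace of $\mathcal{S}(\mathbb{R}^n)$ of functions all of whose moments vanish. Spaces on the upper half-space: for $s,t,\tau_1,\tau_2>0$, $\mathcal{S}^{s}_{t,\tau_1,\tau_2}(\mathbb{H}^{n+1})$ consists of all smooth functions $\Phi$ on $\mathbb{H}^{n+1}$ such that for every $\alpha\in\mathbb{N}$ there exists $h>0$ with $$p_{\alpha,h}^{s,t,\tau_1,\tau_2}(\Phi)=\sup\frac{h^{|\beta|+k+l_1+l_2}}{\beta!^{s}k!^{t}l_1!^{\tau_1}l_2!^{\tau_2}}\left(a^{l_1}+\frac{1}{a^{l_2}}\right)\langle b\rangle^k\left|\partial_a^\alpha\partial_b^\beta\Phi(b,a)\right|<\infty,$$ the supremum being over $(b,a)\in\mathbb{H}^{n+1}$, $(k,l_1,l_2)\in\mathbb{N}^3$, $\beta\in\mathbb{N}^n$; the topology is the inductive limit with respect to $h$ and projective limit with respect to $\alpha$. Non-degenerate and reconstruction wavelets: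 $\varphi\in\mathcal{S}(\mathbb{R}^n)$ is non-degenerate if for every $\omega\in\mathbb{S}^{n-1}$ the function $r\mapsto\hat\varphi(r\omega)$, $r\in[0,\infty)$, is not identically zero; it is a non-degenerate wavelet if in addition $\int\varphi\,dx=0$. A function $\phi\in\mathcal{S}_0(\mathbb{R}^n)$ is a reconstruction wavelet for $\psi\in\mathcal{S}_0(\mathbb{R}^n)$ if $$c_{\psi,\phi}(\omega)=\int_0^\infty\overline{\hat\psi}(r\omega)\hat\phi(r\omega)\frac{dr}{r},\qquad\omega\in\mathbb{S}^{n-1},$$ is finite, non-zero and independent of $\omega$; then $c_{\psi,\phi}:=c_{\psi,\phi}(\omega)$. Transforms of functions: $\mathcal{W}_\psi\varphi(b,a)=\frac{1}{a^n}\int_{\mathbb{R}^n}\varphi(x)\overline{\psi}\left(\frac{x-b}{a}\right)dx$ and $\mathcal{M}_\phi\Phi(x)=\int_0^\infty\left(\int_{\mathbb{R}^n}\Phi(b,a)\frac{1}{a^n}\phi\left(\frac{x-b}{a}\right)db\right)\frac{da}{a}$. Transforms of ultradistributions (with $\rho_1>0$, $\rho_2>1$, $s>0$, $t>\rho_1+\rho_2$, $\psi,\phi\in(\mathcal{S}^{\rho_1}_{\rho_2})_0(\mathbb{R}^n)$): for $f\in((\mathcal{S}^s_t)_0(\mathbb{R}^n))'$, $\mathcal{W}_\psi f\in(\mathcal{S}^s_{t,t-\rho_2,s+\rho_2-1}(\mathbb{H}^{n+1}))'$ is defined by $$\langle\mathcal{W}_\psi f,\Phi\rangle:=\langle f,\mathcal{M}_{\overline\psi}\Phi\rangle,\qquad\Phi\in\mathcal{S}^s_{t,t-\rho_2,s+\rho_2-1}(\mathbb{H}^{n+1}),$$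 where $\mathcal{M}_{\overline\psi}$ maps $\mathcal{S}^s_{t,t-\rho_2,s+\rho_2-1}(\mathbb{H}^{n+1})$ continuously into $(\mathcal{S}^s_t)_0(\mathbb{R}^n)$. For $F\in(\mathcal{S}^s_{t,t-\rho_2,s+\rho_2-1}(\mathbb{H}^{n+1}))'$, $\mathcal{M}_\phi F\in((\mathcal{S}^s_{t+1-\rho_1-\rho_2})_0(\mathbb{R}^n))'$ is defined by $$\langle\mathcal{M}_\phi F,\varphi\rangle:=\langle F,\mathcal{W}_{\overline\phi}\varphi\rangle,\qquad\varphi\in(\mathcal{S}^s_{t+1-\rho_1-\rho_2})_0(\mathbb{R}^n),$$ where $\mathcal{W}_{\overline\phi}$ maps $(\mathcal{S}^s_{t+1-\rho_1-\rho_2})_0(\mathbb{R}^n)$ continuously into $\mathcal{S}^s_{t,t-\rho_2,s+\rho_2-1}(\mathbb{H}^{n+1})$. Meaning of the formula: for $f\in((\mathcal{S}^s_t)_0(\mathbb{R}^n))'$, the functional $\mathcal{M}_\phi\mathcal{W}_\psi f$ is a priori defined on $(\mathcal{S}^s_{t+1-\rho_1-\rho_2})_0(\mathbb{R}^n)$, which is a dense subspace of $(\mathcal{S}^s_t)_0(\mathbb{R}^n)$, and an element of $((\mathcal{S}^s_t)_0(\mathbb{R}^n))'$ is identified with its restriction to that subspace; the formula says $\frac{1}{c_{\psi,\phi}}\mathcal{M}_\phi\mathcal{W}_\psi f=f$ for all $f\in((\mathcal{S}^s_t)_0(\mathbb{R}^n))'$. *)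

(* Defs.v *)
From HB Require Import structures.
From mathcomp Require Import all_boot all_order all_algebra.
From mathcomp Require Import all_classical all_reals all_analysis.
From mathcomp Require Import complex.

Set Implicit Arguments.
Unset Strict Implicit.
Unset Printing Implicit Defensive.

Import Order.TTheory GRing.Theory Num.Theory.
Import numFieldNormedType.Exports.

Local Open Scope classical_set_scope.
Local Open Scope complex_scope.
Local Open Scope ring_scope.

Notation cRe := complex.Re.
Notation cIm := complex.Im.
(* The modulus with values in [R]; the library's [`|z|] lives in [R[i]]. *)
Notation cmod := ComplexField.Normc.normc.

Section Euclidean.
Context {R : realType} {n : nat}.
Implicit Types (x y : 'rV[R]_n) (al : 'I_n -> nat).

Definition dotv x y : R := \sum_(i < n) x 0 i * y 0 i.

(* The library norm on ['rV_n] is the sup norm; this is the Euclidean one. *)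
Definition enorm x : R := Num.sqrt (dotv x x).

Definition japanese x : R := Num.sqrt (1 + enorm x ^+ 2).

Definition unit_sphere : set 'rV[R]_n := [set w | enorm w = 1].

Definition mabs al : nat := (\sum_(i < n) al i)%N.
Definition mfact al : nat := (\prod_(i < n) (al i)`!)%N.
Definition mpow x al : R := \prod_(i < n) x 0 i ^+ al i.

End Euclidean.

Section Integration.
Context {R : realType}.
Local Notation mR := (measurableTypeR R).

Definition tcons n (p : mR * n.-tuple mR) : n.+1.-tuple mR :=
  [tuple of p.1 :: p.2].

(* n-dimensional Lebesgue measure, as the image of the product of the
   one-dimensional and the (n-1)-dimensional ones under [tcons]. *)
Fixpoint lebesgue_tuple n : set (n.-tuple mR) -> \bar R :=
  if n is m.+1 then pushforward (lebesgue_measure \x^ @lebesgue_tuple m)%E (@tcons m)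
  else dirac [tuple].

Lemma measurable_tcons n : measurable_fun [set: mR * n.-tuple mR] (@tcons n).
Proof. exact: (measurable_cons measurable_fst measurable_snd). Qed.

Lemma lebesgue_tuple_measure n :
  exists m : {measure set (n.-tuple mR) -> \bar R}, @lebesgue_tuple n = m.
Proof.
elim: n => [|n [m IH]]; first by exists (dirac [tuple]).
exists (measure_function_pushforward__canonical__measure_function_Measure
  (lebesgue_measure \x^ m)%E (@measurable_tcons n)).
by rewrite /= IH.
Qed.

Section instance.
Variable n : nat.

Let lebesgue_tuple0 : @lebesgue_tuple n set0 = 0%E.
Proof. by have [m ->] := lebesgue_tuple_measure n; exact: measure0. Qed.

Let lebesgue_tuple_ge0 A : (0 <= @lebesgue_tuple n A)%E.
Proof. by have [m ->] := lebesgue_tuple_measure n; exact: measure_ge0. Qed.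

Let lebesgue_tuple_sigma_additive : semi_sigma_additive (@lebesgue_tuple n).
Proof.
by have [m ->] := lebesgue_tuple_measure n; exact: measure_semi_sigma_additive.
Qed.

HB.instance Definition _ := isMeasure.Build _ _ _ (@lebesgue_tuple n)
  lebesgue_tuple0 lebesgue_tuple_ge0 lebesgue_tuple_sigma_additive.

End instance.

Definition cintegral d (T : measurableType d)
    (mu : {measure set T -> \bar R}) (D : set T) (f : T -> R[i]) : R[i] :=
  (\int[mu]_(x in D) cRe (f x)) +i* (\int[mu]_(x in D) cIm (f x)).

Definition cintegrable d (T : measurableType d)
    (mu : {measure set T -> \bar R}) (D : set T) (f : T -> R[i]) : Prop :=
  mu.-integrable D (EFin \o (fun x => cRe (f x))) /\
  mu.-integrable D (EFin \o (fun x => cIm (f x))).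

Definition rvint n (f : 'rV[R]_n -> R[i]) : R[i] :=
  cintegral (@lebesgue_tuple n) setT (fun u => f (\row_i tnth u i)).

Definition posint (f : R -> R[i]) : R[i] :=
  cintegral lebesgue_measure `]0, +oo[ f.
Definition posintegrable (f : R -> R[i]) : Prop :=
  cintegrable lebesgue_measure `]0, +oo[ f.

End Integration.

Section Smooth.
Context {R : realType} {V : normedModType R}.

Definition pderiv (v : V) (f : V -> R[i]) : V -> R[i] := fun x =>
  ('D_v (fun y => cRe (f y)) x) +i* ('D_v (fun y => cIm (f y)) x).

(* Iterated partial derivatives along a family of coordinate directions [e]. *)
Definition iterD (I : Type) (e : I -> V) (l : seq I) (f : V -> R[i]) :=
  foldr (fun i => pderiv (e i)) f l.

(* When [e] is a basis and [U] is open, this is the class C^oo on U: all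
   iterated partial derivatives exist and are continuous at the points of U. *)
Definition smooth_on (I : Type) (e : I -> V) (U : set V) (f : V -> R[i]) :=
  forall (l : seq I) (x : V), U x ->
    [/\ {for x, continuous (fun y => cRe (iterD e l f y))},
        {for x, continuous (fun y => cIm (iterD e l f y))} &
        forall i, derivable (fun y => cRe (iterD e l f y)) x (e i) /\
                  derivable (fun y => cIm (iterD e l f y)) x (e i)].

End Smooth.

Section FunctionSpaces.
Context {R : realType} {n : nat}.
Local Notation rV := 'rV[R]_n.
Implicit Types (phi psi : rV -> R[i]) (al be : 'I_n -> nat).

Definition conjf (T : Type) (f : T -> R[i]) : T -> R[i] := fun x => (f x)^*.

Definition rvdir (i : 'I_n) : rV := delta_mx 0 i.

Definition mlist be : seq 'I_n := flatten [seq nseq (be i) i | i <- enum 'I_n].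

Definition mderiv be phi : rV -> R[i] := iterD rvdir (mlist be) phi.

Definition schwartz : set (rV -> R[i]) := [set phi |
  smooth_on rvdir setT phi /\
  forall al be, exists C : R, forall x,
    cmod ((mpow x al)%:C * mderiv be phi x) <= C].

Definition moments_vanish phi : Prop :=
  forall m : 'I_n -> nat, rvint (fun x => (mpow x m)%:C * phi x) = 0.

Definition schwartz0 : set (rV -> R[i]) :=
  schwartz `&` [set phi | moments_vanish phi].

Definition gs_norm (r1 r2 h : R) phi : \bar R :=
  ereal_sup [set y | exists x al be,
    y = (h ^+ mabs (fun i => al i + be i)%N
          / ((mfact al)%:R `^ r2 * (mfact be)%:R `^ r1)
          * cmod ((mpow x al)%:C * mderiv be phi x))%:E].

Definition gelfand_shilov (r1 r2 : R) : set (rV -> R[i]) := [set phi |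
  schwartz phi /\ exists2 h : R, 0 < h & (gs_norm r1 r2 h phi < +oo)%E].

Definition gelfand_shilov0 (r1 r2 : R) : set (rV -> R[i]) :=
  gelfand_shilov r1 r2 `&` [set phi | moments_vanish phi].

End FunctionSpaces.

Section Duals.
Context {R : realType} {T : Type}.
Local Notation F := (T -> R[i]).

Definition abs_convex (V : set F) : Prop :=
  forall (f g : F) (a b : R[i]), V f -> V g -> `|a| + `|b| <= 1 ->
    V (fun x => a * f x + b * g x).

(* Neighbourhoods of 0 for the locally convex inductive limit (h > 0) of the
   seminormed spaces { f in E | p h f < +oo }: the finest locally convex
   topology making all the inclusions continuous. *)
Definition indlim_nbhs0 (E : set F) (p : R -> F -> \bar R) : set (set F) :=
  [set U | exists V : set F, [/\ V `<=` U, abs_convex V &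
    forall h : R, 0 < h -> exists2 e : R, 0 < e &
      forall f, E f -> (p h f < e%:E)%E -> V f]].

(* Continuous linear functionals on the subspace E0, endowed with the topology
   induced by the vector topology with neighbourhoods of 0 [nb].  A functional
   is represented by a total map of which only the values on E0 matter. *)
Definition dual (E0 : set F) (nb : set (set F)) : set (F -> R[i]) :=
  [set f : F -> R[i] |
    (forall (a : R[i]) (u v : F), E0 u -> E0 v ->
       f (fun x => a * u x + v x) = a * f u + f v) /\
    (forall u, E0 u -> forall eps : R, 0 < eps -> exists2 U, nb U &
       forall v, E0 v -> U (fun x => v x - u x) -> cmod (f v - f u) < eps)].

(* [g] as a functional with domain [E], with value 0 outside its domain. *)
Definition functional_on (E : set F) (g : F -> R[i]) : F -> R[i] :=
  fun u => if `[< E u >] then g u else 0.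

End Duals.

Definition gelfand_shilov0_dual {R : realType} {n : nat} (r1 r2 : R) :
    set (('rV[R]_n -> R[i]) -> R[i]) :=
  dual (gelfand_shilov0 r1 r2) (indlim_nbhs0 schwartz (gs_norm r1 r2)).

Section HalfSpace.
Context {R : realType} {n : nat}.
Local Notation H := ('rV[R]_n * R)%type.

(* Functions on the upper half-space are represented by functions on the
   ambient space of which only the values at points (b, a) with a > 0 matter. *)
Definition half_space : set H := [set p | 0 < p.2].

(* [None] is the direction of a, [Some i] that of b_i. *)
Definition hdir (o : option 'I_n) : H :=
  if o is Some i then (rvdir i, 0) else (0, 1).

Definition hderiv (al : nat) (be : 'I_n -> nat) (Phi : H -> R[i]) : H -> R[i] :=
  iterD hdir (nseq al None ++ map Some (mlist be)) Phi.

Definition hs_norm (s t tau1 tau2 : R) (al : nat) (h : R) (Phi : H -> R[i]) :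
    \bar R :=
  ereal_sup [set y | exists (b : 'rV[R]_n) (a : R) (be : 'I_n -> nat)
      (k l1 l2 : nat), 0 < a /\
    y = (h ^+ (mabs be + k + l1 + l2)
          / ((mfact be)%:R `^ s * k`!%:R `^ t
             * l1`!%:R `^ tau1 * l2`!%:R `^ tau2)
          * (a ^+ l1 + (a ^+ l2)^-1) * japanese b ^+ k
          * cmod (hderiv al be Phi (b, a)))%:E].

Definition hs_space (s t tau1 tau2 : R) : set (H -> R[i]) := [set Phi |
  smooth_on hdir half_space Phi /\
  forall al : nat, exists2 h : R, 0 < h &
    (hs_norm s t tau1 tau2 al h Phi < +oo)%E].

End HalfSpace.

Section Wavelets.
Context {R : realType} {n : nat}.
Local Notation rV := 'rV[R]_n.
Implicit Types (phi psi : rV -> R[i]).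

Definition expi (theta : R) : R[i] := cos theta +i* sin theta.

Definition fourier phi (xi : rV) : R[i] :=
  rvint (fun x => phi x * expi (- dotv x xi)).

Definition nondegenerate phi : Prop :=
  schwartz phi /\
  forall w, unit_sphere w -> exists2 r : R, 0 <= r & fourier phi (r *: w) != 0.

Definition nondegenerate_wavelet phi : Prop :=
  nondegenerate phi /\ rvint phi = 0.

Definition calderon_integrand psi phi (w : rV) (r : R) : R[i] :=
  (fourier psi (r *: w))^* * fourier phi (r *: w) * (r^-1)%:C.

Definition calderon psi phi (w : rV) : R[i] :=
  posint (calderon_integrand psi phi w).

Definition reconstruction_wavelet psi phi : Prop :=
  [/\ schwartz0 psi, schwartz0 phi &
    exists2 c : R[i], c != 0 & forall w, unit_sphere w ->
      posintegrable (calderon_integrand psi phi w) /\ calderon psi phi w = c].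

(* The common value of [calderon psi phi] on the unit sphere. *)
Definition calderon_const psi phi : R[i] :=
  xget 0 [set c | forall w, unit_sphere w -> calderon psi phi w = c].

Definition wavelet_transform psi phi (p : rV * R) : R[i] :=
  let: (b, a) := p in
  ((a ^+ n)^-1)%:C * rvint (fun x => phi x * (psi (a^-1 *: (x - b)))^*).

Definition wavelet_synthesis phi (Phi : rV * R -> R[i]) (x : rV) : R[i] :=
  posint (fun a =>
    rvint (fun b => Phi (b, a) * ((a ^+ n)^-1)%:C * phi (a^-1 *: (x - b)))
    * (a^-1)%:C).

(* W_psi f as a functional on S^s_(t, t - rho2, s + rho2 - 1)(H^(n+1)). *)
Definition wavelet_transform_dual (rho2 s t : R) psi
    (f : (rV -> R[i]) -> R[i]) : (rV * R -> R[i]) -> R[i] :=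
  functional_on (hs_space s t (t - rho2) (s + rho2 - 1))
    (fun Phi => f (wavelet_synthesis (conjf psi) Phi)).

(* M_phi G as a functional on (S^s_(t + 1 - rho1 - rho2))_0(R^n). *)
Definition wavelet_synthesis_dual (rho1 rho2 s t : R) phi
    (G : (rV * R -> R[i]) -> R[i]) : (rV -> R[i]) -> R[i] :=
  functional_on (gelfand_shilov0 s (t + 1 - rho1 - rho2))
    (fun u => G (wavelet_transform (conjf phi) u)).

End Wavelets.

(* Main.v *)
Require Import Defs.
From HB Require Import structures.
From mathcomp Require Import all_boot all_order all_algebra.
From mathcomp Require Import all_classical all_reals all_analysis.
From mathcomp Require Import measurable_realfun complex.
From mathcomp Require Import ring lra.

Import Order.TTheory GRing.Theory Num.Theory.
Import numFieldNormedType.Exports.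

Set Implicit Arguments.
Unset Strict Implicit.
Unset Printing Implicit Defensive.

Local Open Scope classical_set_scope.
Local Open Scope complex_scope.
Local Open Scope ring_scope.

(** By the two duality definitions, the left-hand side is [c^-1] times the value
    of [f] at the function obtained from [u] by taking its wavelet transform [W u]
    with the wavelet [conjf phi] and resynthesizing it with [conjf psi]. The
    theorem thus rests on three facts: [W u] lies in the space on the half-space,
    where the transform of [f] is defined ([wavelet_transform_hs]); the synthesis
    of [W u] is [c u] ([calderon_formula]); and [f (c u) = c f u], where [u] is
    in the domain of [f] because the Gelfand-Shilov spaces grow with their
    exponents ([gelfand_shilov_le], [dual_scale]).

    Membership. After the substitution [x = b + a z] the transform is the average
    [wavI] of [v (b + a z)] against [g z], for the real and imaginary parts [v]
    of [u] and [g] of [phi]. When the scale [a] is small, Taylor's formula for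
    [v] at [b] gains a factor [a ^ m], because the polynomial part integrates to
    zero against [g]; this costs [m!] to the power [s + r - 1] if [v] and [g]
    have regularity [s] and decay [r] ([wavI_small]). When [a] is large the two
    functions exchange their roles: with [q] the decay of [v] and [rho] the
    regularity of [g] the cost is the power [q + rho - 1] ([wavI_large]). When
    [b] is large, either [v] or [g] is small at every point unless [a] is
    large too, in which case the decay in [a] is already enough; this costs the
    power [t = q + rho + r - 1] ([wavI_tail], [wavI_transE]). Sequences of
    bounds by [m!^r] and stretched exponentials are equivalent
    ([exp_decay_of_pow], [pow_exp_decay]), which is how such bounds are combined;
    decay in the scale and in the translation are joined by a square root
    ([split_decay], [wavI_decay]). Derivatives in [b] and [a] produce averages of
    the same kind, of derivatives of [v] against monomial multiples of [g]
    ([dRl_Wf]), and the constants are uniform over them ([Wf_bound]).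

    Reproducing formula. Fourier inversion ([fourier_inversion]) writes [u] as a
    superposition of plane waves. It is obtained from the Poisson kernel, that is,
    the Fourier transform of a product of functions [exp (- |x|)]. On the plane
    wave of frequency [xi] the wavelet transform followed by the inner integral
    of the synthesis is multiplication by the product of [fourier phi (- a xi)]
    and of the conjugate of [fourier psi (- a xi)] ([synthesis_fourier]).
    Integrating over the scales, in the variable [r = a |xi|], gives exactly the
    constant of the pair of wavelets. Exchanging the integrals is legitimate
    because [fourier phi] is Lipschitz, vanishes at the origin and decays at
    infinity, so that the integral over the scales is bounded in [xi]
    ([fourier_wavelet_decay]), and [fourier u] is integrable. *)

(** * Lebesgue measure on tuples *)

Section TupleMeasure.
Context {R : realType}.
Local Notation mR := (measurableTypeR R).
Local Notation mu := lebesgue_measure.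

Lemma measurable_tuncons n : measurable_fun [set: n.+1.-tuple mR]
  (fun t => (tnth t ord0, [tuple of behead t] : n.-tuple mR)).
Proof.
by apply: measurable_fun_pair; [exact: measurable_tnth|exact: measurable_behead].
Qed.

Lemma lebesgue_tuple_sigma_finite n : sigma_finite setT (@lebesgue_tuple R n).
Proof.
elim: n => [|n IH].
  exists (fun=> setT); first by rewrite bigcup_const.
  by move=> i; split => //=; rewrite diracT ltry.
have /sigma_finiteP[F [TF ndF Foo]] := sigma_finiteT (@lebesgue_measure R).
have /sigma_finiteP[G [TG ndG Goo]] := IH.
exists (fun k => (fun t => (tnth t ord0, [tuple of behead t] : n.-tuple mR))
  @^-1` (F k `*` G k)).
  rewrite -preimage_bigcup; apply/seteqP; split => // t _ /=.
  have [i _ Fi] : (\bigcup_i F i) (tnth t ord0) by rewrite -TF.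
  have [j _ Gj] : (\bigcup_i G i) [tuple of behead t] by rewrite -TG.
  exists (maxn i j) => //; split => /=.
  - by move: Fi; apply/subsetPset/ndF/leq_maxl.
  - by move: Gj; apply/subsetPset/ndG/leq_maxr.
move=> k; have [mF Fk] := Foo k; have [mG Gk] := Goo k; split.
  rewrite -[X in measurable X]setTI; apply: measurable_tuncons => //.
  exact: measurableX.
rewrite /= /pushforward.
rewrite [X in product_measure2 _ _ X](_ : _ = F k `*` G k); last first.
  apply/seteqP; split => -[x t] /= []; rewrite (tnth0 x t).
    by move=> ? H; split => //=; move: H; congr (G k _); exact/val_inj.
  by move=> ? H; split => //=; move: H; congr (G k _); exact/val_inj.
rewrite [ltLHS]product_measure2E//.
by apply: lte_mul_pinfty => //; rewrite ge0_fin_numE.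
Qed.

HB.instance Definition _ n := Measure_isSigmaFinite.Build _ _ _
  (@lebesgue_tuple R n) (lebesgue_tuple_sigma_finite n).

Lemma ge0_integral_tupleS n (f : n.+1.-tuple mR -> \bar R) :
  measurable_fun [set: n.+1.-tuple mR] f -> (forall t, 0 <= f t)%E ->
  (\int[@lebesgue_tuple R n.+1]_t f t =
   \int[mu]_x \int[@lebesgue_tuple R n]_t f (tcons (x, t)))%E.
Proof.
move=> mf f0.
have mg : measurable_fun setT (f \o @tcons R n).
  exact: measurableT_comp mf (@measurable_tcons R n).
transitivity (integral (pushforward (mu \x^ @lebesgue_tuple R n)%E (@tcons R n))
    setT f).
  by [].
rewrite ge0_integral_pushforward//=; last exact: measurable_tcons.
rewrite preimage_setT.
transitivity (\int[mu \x @lebesgue_tuple R n]_z (f \o @tcons R n) z)%E.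
  apply: eq_measure_integral => /= A mA _.
  apply: esym; apply: product_measure_unique => //= B C mB mC.
  exact: product_measure2E.
by rewrite fubini_tonelli1// => z; exact: f0.
Qed.

(** Both sides are measures in [A] that agree on intervals. *)
Lemma lebesgue_affine (c a : R) (A : set mR) : a != 0 -> measurable A ->
  (mu ((fun x => c + a * x)%R @^-1` A) = (`|a|^-1)%:E * mu A)%E.
Proof.
move=> a0 mA.
have mf : measurable_fun [set: mR] ((fun x => c + a * x) : mR -> mR).
  by apply: measurable_funD => //; exact: measurable_funM.
pose m := mscale (NngNum (normr_ge0 a))
  (measure_function_pushforward__canonical__measure_function_Measure mu mf).
have -> : mu A = m A.
  apply: lebesgue_measure_unique => // _ [[x y]] _ <- /=.
  rewrite /m /mscale/= /pushforward.
  have [ap|an|/eqP] := ltgtP 0 a; last by rewrite eq_sym (negbTE a0).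
    rewrite [X in (_ * mu X)%E](_ : _ = `](x - c) / a, (y - c) / a]%classic); last first.
      apply/seteqP; split => z /=; rewrite !in_itv/= ltr_pdivrMr// ler_pdivlMr//;
        by rewrite ltrBlDl lerBrDl (mulrC z a).
    rewrite !lebesgue_measure_itv/= !lte_fin ltr_pM2r ?invr_gt0//.
    rewrite ltrD2r gtr0_norm//; case: ifPn => xy; last by rewrite mule0.
    by rewrite -!EFinD -EFinM; congr (_%:E); field.
  rewrite [X in (_ * mu X)%E](_ : _ = `[(y - c) / a, (x - c) / a[%classic); last first.
    apply/seteqP; split => z /=; rewrite !in_itv/= ler_ndivrMr// ltr_ndivlMr//;
      by rewrite ltrBlDl lerBrDl (mulrC z a) andbC.
  rewrite !lebesgue_measure_itv/= !lte_fin ltr_nM2r ?invr_lt0//.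
  rewrite ltrD2r ltr0_norm//; case: ifPn => xy; last by rewrite mule0.
  by rewrite -!EFinD -EFinM; congr (_%:E); field.
rewrite /m /mscale/= /pushforward muleA -EFinM mulVf ?mul1e// normr_eq0//.
Qed.

Lemma ge0_integral_affine (c a : R) (f : R -> \bar R) : a != 0 ->
  measurable_fun [set: mR] f -> (forall x, 0 <= f x)%E ->
  (\int[mu]_x f (c + a * x)%R = (`|a|^-1)%:E * \int[mu]_x f x)%E.
Proof.
move=> a0 mf f0.
have mg : measurable_fun [set: mR] ((fun x => c + a * x) : mR -> mR).
  by apply: measurable_funD => //; exact: measurable_funM.
have a_ge0 : 0 <= `|a|^-1 by rewrite invr_ge0.
transitivity (\int[pushforward mu ((fun x => c + a * x)%R : mR -> mR)]_x f x)%E.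
  by rewrite ge0_integral_pushforward// preimage_setT.
transitivity (\int[mscale (NngNum a_ge0) mu]_x f x)%E.
  by apply: eq_measure_integral => A mA _; exact: lebesgue_affine.
by rewrite ge0_integral_mscale.
Qed.

(** The measures live on tuples, the functions on row vectors: [rowt] is the
    passage between the two, [afft] the affine maps read on tuples. *)
Definition rowt n (t : n.-tuple mR) : 'rV[R]_n := \row_i tnth t i.
Definition afft n (c : 'rV[R]_n) (a : R) (t : n.-tuple mR) : n.-tuple mR :=
  [tuple c 0 i + a * tnth t i | i < n].

Lemma rowt_afft n (c : 'rV[R]_n) a t : rowt (afft c a t) = c + a *: rowt t.
Proof. by apply/rowP => i; rewrite !mxE tnth_mktuple. Qed.

Lemma measurable_afft n (c : 'rV[R]_n) a : measurable_fun [set: n.-tuple mR] (afft c a).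
Proof.
apply/measurable_fun_tnthP => i.
rewrite [X in measurable_fun _ X](_ : _ = fun t => c 0 i + a * tnth t i); last first.
  by apply/funext => t /=; rewrite tnth_mktuple.
by apply: measurable_funD => //; apply: measurable_funM => //; exact: measurable_tnth.
Qed.

Lemma ge0_integral_afft n (c : 'rV[R]_n) (a : R) (f : n.-tuple mR -> \bar R) :
  a != 0 -> measurable_fun [set: n.-tuple mR] f -> (forall t, 0 <= f t)%E ->
  (\int[@lebesgue_tuple R n]_t f (afft c a t) =
   (`|a|^-1 ^+ n)%:E * \int[@lebesgue_tuple R n]_t f t)%E.
Proof.
move=> a0; elim: n c f => [|n IH] c f mf f0.
  rewrite expr0 mul1e; apply: eq_integral => t _.
  by congr f; apply/eq_from_tnth => -[].
have mfc : measurable_fun setT (f \o @tcons R n).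
  exact: measurableT_comp mf (@measurable_tcons R n).
rewrite !ge0_integral_tupleS//; last exact: measurableT_comp (measurable_afft _ _).
pose c' : 'rV[R]_n := \row_i c 0 (lift ord0 i).
have E x t : afft c a (tcons (x, t)) = tcons (c 0 ord0 + a * x, afft c' a t).
  apply/eq_from_tnth => i; rewrite tnth_mktuple.
  case: (unliftP ord0 i) => [j|] ->; last by rewrite !tnth0.
  by rewrite !tnthS tnth_mktuple mxE.
under eq_integral.
  move=> x _; under eq_integral do rewrite E.
  rewrite (IH c' (fun t => f (tcons (c 0 ord0 + a * x, t))))//; last first.
    exact: (measurableT_comp mfc (measurable_pair1 _)).
  over.
have mI : measurable_fun setT
    (fun x => \int[@lebesgue_tuple R n]_t f (tcons (x, t)))%E.
  by apply: (measurable_fun_fubini_tonelli_F (f \o @tcons R n)) => // z; exact: f0.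
have I0 x : (0 <= \int[@lebesgue_tuple R n]_t f (tcons (x, t)))%E.
  exact: integral_ge0.
rewrite ge0_integralZl//; last first.
  have mc : measurable_fun [set: mR] ((fun x => c 0 ord0 + a * x) : mR -> mR).
    by apply: measurable_funD => //; exact: measurable_funM.
  exact: (measurableT_comp mI mc).
rewrite (ge0_integral_affine (c 0 ord0) a0 mI)//.
by rewrite muleA -EFinM exprSr.
Qed.

Local Notation T n := (n.-tuple mR).

Lemma measurable_tnth_real n (i : 'I_n) : measurable_fun [set: T n] (fun t => tnth t i : R).
Proof. exact: measurable_tnth. Qed.

Lemma measurable_countable_fibres d (X : measurableType d) (I : countType)
    (k : X -> I) (g : I -> R) : (forall i, measurable (k @^-1` [set i])) ->
  measurable_fun [set: X] (g \o k).
Proof.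
move=> mk _ A mA; rewrite setTI.
rewrite [X in measurable X](_ : _ =
    \bigcup_i (if i \in [set i | A (g i)] then k @^-1` [set i] else set0)).
  by apply: countable_bigcupT_measurable => // i; case: ifPn.
apply/seteqP; split => x /=; first by move=> Ax; exists (k x) => //; rewrite mem_set.
by case=> i _; case: ifPn => // /set_mem /= Ai ->.
Qed.

Definition round_rV n k (x : 'rV[R]_n) : n.-tuple int :=
  [tuple Num.floor (k.+1%:R * x 0 i) | i < n].
Definition unround_rV n k (z : n.-tuple int) : 'rV[R]_n :=
  \row_i ((tnth z i)%:~R / k.+1%:R).

Lemma round_cvg n (x : 'rV[R]_n) :
  unround_rV k (round_rV k x) @[k --> \oo] --> x.
Proof.
apply/cvgrPdist_le => e e0.
near=> k.
rewrite /Num.norm/= mx_normrE; apply/bigmax_leP; split => [|[i j] _] /=; first exact: ltW.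
rewrite (ord1 i) !mxE tnth_mktuple.
have k0 : 0 < k.+1%:R :> R by [].
rewrite ger0_norm; last by rewrite subr_ge0 ler_pdivrMr// mulrC floor_le.
rewrite -(ler_pM2r k0) mulrBl divfK ?gt_eqF// (mulrC (x 0 j)).
have : 1 <= e * k.+1%:R.
  rewrite -ler_pdivrMl// mulr1.
  have : e^-1 <= k%:R by near: k; exact: nbhs_infty_ger.
  by move=> /le_trans; apply; rewrite ler_nat.
have := floorD1_gt (k.+1%:R * x 0 j); rewrite intrD mulr1z => H1 H2.
rewrite lerBlDl; apply: le_trans (ltW H1) _.
by rewrite lerD2l.
Unshelve. all: by end_near. Qed.

Lemma measurable_round n k (g : 'rV[R]_n -> R) :
  measurable_fun [set: T n] (fun t => g (unround_rV k (round_rV k (rowt t)))).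
Proof.
apply: (@measurable_countable_fibres _ _ (n.-tuple int)
  (fun t => round_rV k (rowt t)) (fun z => g (unround_rV k z))) => z.
rewrite [X in measurable X](_ : _ = \bigcap_(i in [set: 'I_n])
   ((fun t => tnth t i : R) @^-1` [set y | (tnth z i)%:~R <= k.+1%:R * y <
     (tnth z i + 1)%:~R])); last first.
  apply/seteqP; split => t /=.
    move=> <- i _ /=; rewrite tnth_mktuple mxE.
    by rewrite floor_le floorD1_gt.
  move=> H; apply/eq_from_tnth => i; rewrite tnth_mktuple mxE.
  by apply/eqP; rewrite floor_eq; exact: (H i I).
apply: fin_bigcap_measurable => // i _.
rewrite -[X in measurable X]setTI; apply: measurable_tnth_real => //.
rewrite [X in measurable X](_ : _ =
  `[(tnth z i)%:~R / k.+1%:R, (tnth z i + 1)%:~R / k.+1%:R[%classic)//.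
by apply/seteqP; split => y /=; rewrite in_itv/= ler_pdivrMr// ltr_pdivlMr// mulrC.
Qed.

(** A continuous function is the pointwise limit of the step functions obtained
    by rounding the coordinates down to multiples of [1 / k.+1]; the cells of
    the rounding are boxes, hence measurable for the product sigma-algebra. *)
Lemma continuous_measurable_rowt n (g : 'rV[R]_n -> R) : continuous g ->
  measurable_fun [set: T n] (fun t => g (rowt t)).
Proof.
move=> cg; apply: (@measurable_fun_cvg _ _ _ setT
  (fun k t => g (unround_rV k (round_rV k (rowt t))))) => [k|t _].
  exact: measurable_round.
by apply: continuous_cvg; [exact: cg|exact: round_cvg].
Qed.

End TupleMeasure.

(** * Integrals over R^n *)

Section RowIntegral.
Context {R : realType}.
Local Notation mR := (measurableTypeR R).
Local Notation mu := (@lebesgue_measure R).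
Local Notation T n := (n.-tuple mR).
Local Notation lt n := (@lebesgue_tuple R n).

Lemma ge0_integral_tuple_prod n (p : R -> R) : (forall x, 0 <= p x) ->
  measurable_fun [set: mR] p -> (\int[mu]_x (p x)%:E < +oo)%E ->
  (\int[lt n]_t (\prod_(i < n) p (tnth t i))%:E)%E =
  ((fine (\int[mu]_x (p x)%:E)) ^+ n)%:E.
Proof.
move=> p0 mp pfin.
have pfn : (\int[mu]_x (p x)%:E)%E \is a fin_num.
  by rewrite ge0_fin_numE//; apply: integral_ge0 => x _; rewrite lee_fin.
have mprod m : measurable_fun [set: T m] (fun t => \prod_(i < m) p (tnth t i)).
  apply: measurable_prod => i _.
  exact: (measurableT_comp (f := p) mp (measurable_tnth i)).
elim: n => [|n IH].
  under eq_integral do rewrite big_ord0.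
  by rewrite integral_cst//= diracT mule1.
rewrite ge0_integral_tupleS; last 2 first.
- apply/measurable_EFinP. exact: mprod.
- by move=> t; rewrite lee_fin; apply: prodr_ge0.
transitivity (\int[mu]_x ((p x)%:E * \int[lt n]_t (\prod_(i < n) p (tnth t i))%:E))%E.
  apply: eq_integral => x _; rewrite -ge0_integralZl//=; last 3 first.
  - by apply/measurable_EFinP; exact: mprod.
  - by move=> t _; rewrite lee_fin; apply: prodr_ge0.
  - by rewrite lee_fin.
  apply: eq_integral => t _; rewrite -EFinM big_ord_recl tnth0; congr (_ * _)%:E.
  by apply: eq_bigr => i _; rewrite tnthS.
under eq_integral do rewrite IH.
rewrite ge0_integralZr//=; last 3 first.
- by apply/measurable_EFinP; exact: mp.
- by move=> x _; rewrite lee_fin.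
- by rewrite lee_fin exprn_ge0// fine_ge0// integral_ge0// => x _; rewrite lee_fin.
by rewrite -[X in (X * _)%E]fineK// -EFinM exprS.
Qed.

Section fixed_dimension.
Variable n : nat.
Implicit Types (f g : 'rV[R]_n -> R) (x c : 'rV[R]_n).

Definition rmeas f := measurable_fun [set: T n] (fun t => f (rowt t)).
Definition rint f : R := \int[lt n]_t f (rowt t).
Definition rintegrable f := (lt n).-integrable setT (EFin \o (fun t => f (rowt t))).

Lemma continuous_rmeas f : continuous f -> rmeas f.
Proof. exact: continuous_measurable_rowt. Qed.

(** Integrands over R^n are dominated below by multiples of this function; as
    a product of functions of one variable it has an explicit integral. *)
Definition weight x : R := \prod_(i < n) (oneDsqr ((x : 'rV[R]_n) 0 i))^-1.

Lemma weight_gt0 x : 0 < weight x.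
Proof. by apply: prodr_gt0 => i _; rewrite invr_gt0 (lt_le_trans ltr01)// oneDsqr_ge1. Qed.
Lemma weight_ge0 x : 0 <= weight x. Proof. exact/ltW/weight_gt0. Qed.

Lemma measurable_oneDsqrV : measurable_fun [set: mR] (fun y : R => (oneDsqr y)^-1).
Proof. by apply: continuous_measurable_fun; exact: continuous_oneDsqrV. Qed.

Lemma integralT_oneDsqrV : (\int[mu]_y ((oneDsqr y)^-1)%:E)%E = pi%:E.
Proof.
rewrite (@ge0_symfun_integralT _ (fun y : R => (oneDsqr y)^-1)); first last.
- by move=> y /=; rewrite /oneDsqr sqrrN.
- exact: continuous_oneDsqrV.
- by move=> y; rewrite invr_ge0 (le_trans ler01)// oneDsqr_ge1.
rewrite -set_itvcy integral0y_oneDsqr -EFinM; congr _%:E.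
by rewrite mulrC divfK.
Qed.

Lemma rmeas_weight : rmeas weight.
Proof.
apply: measurable_prod => i _.
rewrite [X in measurable_fun _ X](_ : _ = (fun y : R => (oneDsqr y)^-1) \o (fun t => tnth t i : R)); last first.
  by apply/funext => t; rewrite /= mxE.
exact: (measurableT_comp measurable_oneDsqrV (measurable_tnth_real i)).
Qed.

Lemma integral_weight : (\int[lt n]_t (weight (rowt t))%:E)%E = (pi ^+ n)%:E.
Proof.
transitivity (\int[lt n]_t (\prod_(i < n) (oneDsqr (tnth t i : R))^-1)%:E)%E.
  by apply: eq_integral => t _; congr EFin; apply: eq_bigr => i _; rewrite mxE.
rewrite (@ge0_integral_tuple_prod n (fun y : R => (oneDsqr y)^-1)).
- by rewrite integralT_oneDsqrV.
- by move=> y; rewrite invr_ge0 (le_trans ler01)// oneDsqr_ge1.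
- exact: measurable_oneDsqrV.
- by rewrite integralT_oneDsqrV ltry.
Qed.

Lemma rintegrable_weight : rintegrable weight.
Proof.
apply/integrableP; split; first by apply/measurable_EFinP; exact: rmeas_weight.
under eq_integral do rewrite /= ger0_norm ?weight_ge0//.
by rewrite integral_weight ltry.
Qed.

Lemma rint_weight : rint weight = pi ^+ n.
Proof. by rewrite /rint /Rintegral integral_weight. Qed.

Lemma rintegrable_le f g : rmeas f -> rintegrable g -> (forall x, `|f x| <= g x) ->
  rintegrable f.
Proof.
move=> mf ig fg; apply: (le_integrable measurableT _ _ ig).
  by apply/measurable_EFinP; exact: mf.
by move=> t _ /=; rewrite lee_fin (le_trans (fg _))// ler_norm.
Qed.

Lemma rintegrableZ f C : rintegrable f -> rintegrable (fun x => C * f x).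
Proof.
move=> fi; rewrite /rintegrable.
rewrite [X in _.-integrable _ X](_ : _ = fun t => (C%:E * (f (rowt t))%:E)%E)//.
exact: integrableZl.
Qed.

Lemma rintegrableD f g : rintegrable f -> rintegrable g -> rintegrable (fun x => f x + g x).
Proof. by move=> fi gi; exact: (integrableD measurableT fi gi). Qed.

Lemma rintegrableB f g : rintegrable f -> rintegrable g -> rintegrable (fun x => f x - g x).
Proof. by move=> fi gi; exact: (integrableB measurableT fi gi). Qed.

Lemma wle_rintegrable f C : rmeas f -> (forall x, `|f x| <= C * weight x) -> rintegrable f.
Proof.
move=> mf fC; apply: (@rintegrable_le f (fun x => C * weight x)) => //.
exact/rintegrableZ/rintegrable_weight.
Qed.

Lemma rintZ f C : rintegrable f -> rint (fun x => C * f x) = C * rint f.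
Proof. by move=> fi; rewrite /rint RintegralZl. Qed.

Lemma rintD f g : rintegrable f -> rintegrable g ->
  rint (fun x => f x + g x) = rint f + rint g.
Proof. by move=> fi gi; rewrite /rint RintegralD. Qed.

Lemma rintB f g : rintegrable f -> rintegrable g ->
  rint (fun x => f x - g x) = rint f - rint g.
Proof. by move=> fi gi; rewrite /rint RintegralB. Qed.

Lemma rint0 : rint (fun=> 0) = 0.
Proof. by rewrite /rint Rintegral_cst// mul0r. Qed.

Lemma rintegrable0 : rintegrable (fun=> 0).
Proof. exact: integrable0. Qed.

Lemma rintegrable_sum (I : Type) (s : seq I) (F : I -> 'rV[R]_n -> R) :
  (forall i, rintegrable (F i)) -> rintegrable (fun x => \sum_(i <- s) F i x).
Proof.
move=> Fi; elim: s => [|i s IH].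
  by under eq_fun do rewrite big_nil; exact: rintegrable0.
by under eq_fun do rewrite big_cons; exact: rintegrableD.
Qed.

Lemma rint_sum (I : Type) (s : seq I) (F : I -> 'rV[R]_n -> R) :
  (forall i, rintegrable (F i)) ->
  rint (fun x => \sum_(i <- s) F i x) = \sum_(i <- s) rint (F i).
Proof.
move=> Fi; elim: s => [|i s IH].
  by under eq_fun do rewrite big_nil; rewrite rint0 big_nil.
under eq_fun do rewrite big_cons.
by rewrite rintD// ?IH ?big_cons//; exact: rintegrable_sum.
Qed.

Lemma rint_norm_le f g : rintegrable f -> rintegrable g -> (forall x, `|f x| <= g x) ->
  `|rint f| <= rint g.
Proof.
move=> fi gi fg; apply: le_trans (le_normr_Rintegral measurableT fi) _.
by apply: le_Rintegral => //; exact: integrable_norm.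
Qed.

Lemma rint_wle f C : rintegrable f -> (forall x, `|f x| <= C * weight x) ->
  `|rint f| <= C * pi ^+ n.
Proof.
move=> fi fC; rewrite -rint_weight -rintZ; last exact: rintegrable_weight.
by apply: rint_norm_le => //; exact/rintegrableZ/rintegrable_weight.
Qed.

Lemma rmeas_affine f c a : rmeas f -> rmeas (fun x => f (c + a *: x)).
Proof.
move=> mf; rewrite /rmeas; under eq_fun do rewrite -rowt_afft.
exact: (measurableT_comp mf (measurable_afft c a)).
Qed.

Lemma rintegrable_affine f c a : a != 0 -> rintegrable f ->
  rintegrable (fun x => f (c + a *: x)).
Proof.
move=> a0 /integrableP[/measurable_EFinP mf foo]; apply/integrableP; split.
  by apply/measurable_EFinP; exact: rmeas_affine.
under eq_integral do rewrite /= -rowt_afft.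
rewrite (ge0_integral_afft c (f := fun t => `|f (rowt t)|%:E))//.
  by apply: lte_mul_pinfty => //; rewrite lee_fin exprn_ge0// invr_ge0.
by apply/measurable_EFinP; exact: (measurableT_comp (@normr_measurable R setT) mf).
Qed.

Lemma rint_affine f c a : a != 0 -> rintegrable f ->
  rint (fun x => f (c + a *: x)) = (`|a|^-1) ^+ n * rint f.
Proof.
move=> a0 fi; have /integrableP[mf foo] := fi.
rewrite /rint /Rintegral.
under eq_integral do rewrite -rowt_afft.
set g := (fun t => (f (rowt t))%:E) : T n -> \bar R.
rewrite [X in fine X](_ : _ = ((`|a|^-1 ^+ n)%:E * \int[lt n]_t g t)%E); last first.
  rewrite integralE [in RHS]integralE.
  under eq_integral do rewrite (funepos_comp g (afft c a)).
  under [X in (_ - X)%E]eq_integral do rewrite (funeneg_comp g (afft c a)).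
  rewrite (ge0_integral_afft c (f := g^\+)%E)//; last exact: measurable_funepos.
  rewrite (ge0_integral_afft c (f := g^\-)%E)//; last exact: measurable_funeneg.
  rewrite [RHS]muleBr//.
  by apply: fin_num_adde_defl; rewrite fin_numN integrable_neg_fin_num.
by rewrite fineM// integrable_fin_num.
Qed.

End fixed_dimension.
End RowIntegral.

(** * Directional derivatives, Schwarz's theorem and Taylor's formula *)

Section LineDerivative.
Context {R : realType} {V : normedModType R}.
Implicit Types (f : V -> R) (p u v w : V).

Let line_quotient f p v (s : R) :
  (fun h : R => h^-1 *: ((fun s => f (p + s *: v)) (h *: 1 + s) - f (p + s *: v))) =
  (fun h : R => h^-1 *: (f (h *: v + (p + s *: v)) - f (p + s *: v))).
Proof.
apply/funext => h; rewrite scaler1 scalerDl; congr (_ *: (f _ - _)).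
by rewrite addrCA.
Qed.

Lemma is_derive_line f p v (s : R) : derivable f (p + s *: v) v ->
  is_derive s 1 (fun s => f (p + s *: v)) ('D_v f (p + s *: v)).
Proof.
move=> df; apply: DeriveDef; first by rewrite /derivable line_quotient.
by rewrite /derive line_quotient.
Qed.

Lemma line_is_derive f p v (d : R) :
  is_derive (0 : R) 1 (fun s => f (p + s *: v)) d -> is_derive p v f d.
Proof.
have E := line_quotient f p v 0; rewrite scale0r addr0 in E.
move=> [dg Eg]; move: dg Eg; rewrite /derivable /derive /= scale0r addr0 E => dg Eg.
by apply: DeriveDef.
Qed.

Lemma mean_value (F F' : R -> R) (a b : R) : (forall x : R, is_derive x (1 : R) F (F' x)) ->
  exists2 th, 0 <= th <= 1 & F b - F a = (b - a) * F' (a + th * (b - a)).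
Proof.
move=> dF.
have cF (x y : R) : {within `[x, y], continuous F}.
  by apply: derivable_within_continuous => z _; have [] := dF z.
have [ab|ba|->] := ltgtP a b; last by exists 0; rewrite ?lexx ?ler01// !subrr mul0r.
- have [c] := MVT ab (fun x _ => dF x) (cF a b).
  rewrite in_itv/= => /andP[ac cb] ->; exists ((c - a) / (b - a)).
    apply/andP; split; first by rewrite divr_ge0 ?subr_ge0 ?ltW.
    by rewrite ler_pdivrMr ?subr_gt0// mul1r lerD2r ltW.
  by rewrite mulrC divfK ?subrKC// subr_eq0 gt_eqF.
- have [c] := MVT ba (fun x _ => dF x) (cF b a).
  rewrite in_itv/= => /andP[bc ca] E; exists ((c - a) / (b - a)).
    rewrite (_ : _ / _ = (a - c) / (a - b)); last by rewrite -mulrNN -invrN !opprB.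
    apply/andP; split; first by rewrite divr_ge0 ?subr_ge0 ?ltW.
    by rewrite ler_pdivrMr ?subr_gt0// mul1r lerD2l lerN2 ltW.
  rewrite divfK ?subrKC ?subr_eq0 ?lt_eqF//.
  by rewrite -[LHS]opprB E mulrC -mulNr opprB.
Qed.

Lemma mean_value_line f p v (h : R) : (forall q, derivable f q v) ->
  exists2 th, 0 <= th <= 1 & f (p + h *: v) - f p = h * 'D_v f (p + (th * h) *: v).
Proof.
move=> df; have [th th01] := mean_value 0 h (fun s => is_derive_line (df (p + s *: v))).
by rewrite scale0r addr0 subr0 add0r => E; exists th.
Qed.

(** The increment along [u + w] is the increment along [w] followed by one
    along [u]; the mean value theorem turns the latter into a value of
    ['D_u f] near [p], which continuity brings to [p]. *)
Lemma is_deriveD_dir f p u w : (forall q, derivable f q u) ->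
  {for p, continuous ('D_u f)} -> derivable f p w ->
  is_derive p (u + w) f ('D_u f p + 'D_w f p).
Proof.
move=> du cu dw.
have dcvg : (fun h : R => h^-1 *: (f (h *: (u + w) + p) - f p)) @ 0^' -->
    'D_u f p + 'D_w f p.
  rewrite (_ : (fun h : R => _) = (fun h : R =>
      h^-1 *: (f (h *: (u + w) + p) - f (h *: w + p)) +
      h^-1 *: (f (h *: w + p) - f p))); last first.
    by apply/funext => h; rewrite -scalerDr addrA subrK.
  apply: cvgD; last exact: dw.
  apply/cvgrPdist_le => e e0.
  have /cvgrPdist_le/(_ _ e0)/nbhs_ballP[d /= d0 Hd] := cu.
  pose M := `|u| + `|w| + 1.
  have M0 : 0 < M by rewrite ltr_wpDl// addr_ge0.
  near=> h.
  have hd : `|h| * M < d.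
    rewrite -ltr_pdivlMr//; near: h.
    apply: nbhs_dnbhs; apply/nbhs_ballP; exists (d / M) => /=; first exact: divr_gt0.
    by move=> y; rewrite /ball/= sub0r normrN.
  have h0 : h != 0 by near: h; exact: nbhs_dnbhs_neq.
  have [th /andP[th0 th1]] := mean_value_line (h *: w + p) h du.
  rewrite (_ : h *: w + p + h *: u = h *: (u + w) + p); last first.
    by rewrite scalerDr [LHS]addrC addrA.
  move=> ->; rewrite scalerA mulVf// scale1r; apply: Hd.
  rewrite -ball_normE/= [_ + p + _]addrAC opprD addrCA subrr addr0.
  apply: le_lt_trans hd; rewrite normrN (le_trans (ler_normD _ _))//.
  rewrite !normrZ (ger0_norm th0) /M 2!mulrDr mulr1.
  rewrite (addrC _ (`|h| * `|w|)) -addrA lerD2l.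
  rewrite (@le_trans _ _ (`|h| * `|u|)) ?lerDl//.
  by rewrite -mulrA ler_piMl// mulr_ge0.
by apply: DeriveDef; [apply/cvg_ex; eexists; exact: dcvg|exact/cvg_lim].
Unshelve. all: by end_near. Qed.

(** The mean value theorem along [u] for the increment of [f] along [w], then
    along [w] for the derivative of [f] along [u]. *)
Lemma second_difference f Du A p u w (h : R) :
  (forall q, is_derive q u f (Du q)) -> (forall q, is_derive q w Du (A q)) ->
  exists q, `|q - p| <= `|h| * (`|u| + `|w|) /\
    f (p + h *: u + h *: w) - f (p + h *: u) - f (p + h *: w) + f p =
    h * (h * A q).
Proof.
move=> du dw.
have duE q : derivable f q u by have [] := du q.
have dwE q : derivable Du q w by have [] := dw q.
have duV q : 'D_u f q = Du q by have [] := du q.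
have dwV q : 'D_w Du q = A q by have [] := dw q.
have [th /andP[th0 th1]] := @mean_value
  (fun s => f ((p + h *: w) + s *: u) - f (p + s *: u)) _ 0 h
  (fun s => is_deriveB (is_derive_line (duE (p + h *: w + s *: u)))
     (is_derive_line (duE (p + s *: u)))).
rewrite subr0 scale0r !addr0 add0r !duV => E.
have [th' /andP[th'0 th'1]] := mean_value_line (p + (th * h) *: u) h dwE.
rewrite dwV => E'.
exists (p + (th * h) *: u + (th' * h) *: w); split.
  rewrite addrC !addrA addNr add0r (le_trans (ler_normD _ _))// !normrZ.
  by rewrite mulrDr (ger0_norm th0) (ger0_norm th'0) lerD// -mulrA ler_piMl// mulr_ge0.
rewrite -E' [p + (th * h) *: u + h *: w]addrAC -E (addrAC p (h *: w)).
by move: (f _) (f _) (f _) (f _) => x y z t; ring.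
Qed.

(** Schwarz: mixed derivatives commute when they exist and are continuous,
    because both are limits of the same second difference quotient. *)
Lemma mixed_derivativeC f Du Dw A B p u w :
  (forall q, is_derive q u f (Du q)) -> (forall q, is_derive q w Du (A q)) ->
  (forall q, is_derive q w f (Dw q)) -> (forall q, is_derive q u Dw (B q)) ->
  {for p, continuous A} -> {for p, continuous B} -> A p = B p.
Proof.
move=> du dwu dw duw cwu cuw.
apply/eqP; rewrite -subr_eq0 -normr_le0; apply/ler_addgt0Pr => e e0; rewrite add0r.
have e20 : 0 < e / 2 by rewrite divr_gt0.
have /cvgrPdist_le/(_ _ e20)/nbhs_ballP[d1 /= d10 H1] := cwu.
have /cvgrPdist_le/(_ _ e20)/nbhs_ballP[d2 /= d20 H2] := cuw.
pose M := `|u| + `|w| + 1.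
have M0 : 0 < M by rewrite ltr_wpDl// addr_ge0.
pose h := Num.min d1 d2 / (M + M).
have m0 : 0 < Num.min d1 d2 by rewrite lt_min d10.
have h0 : 0 < h by rewrite divr_gt0// (addr_gt0 M0 M0).
have hM : `|h| * M < Num.min d1 d2.
  rewrite gtr0_norm// /h mulrAC -mulrA gtr_pMr//.
  by rewrite ltr_pdivrMr ?(addr_gt0 M0 M0)// mul1r ltrDl.
have [q1 [q1p E1]] := second_difference p h du dwu.
have [q2 [q2p E2]] := second_difference p h dw duw.
have E : A q1 = B q2.
  have hn : h != 0 by rewrite gt_eqF.
  apply: (mulfI hn); apply: (mulfI hn).
  apply: etrans (esym E1) (etrans _ E2).
  have -> : p + h *: w + h *: u = p + h *: u + h *: w by rewrite addrAC.
  by congr (_ + _); exact: addrAC.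
have B1 : ball p d1 q1.
  rewrite -ball_normE/= distrC (le_lt_trans q1p)// (le_lt_trans _ (lt_le_trans hM _))//.
    by rewrite ler_wpM2l// /M lerDl.
  by rewrite ge_min lexx.
have B2 : ball p d2 q2.
  rewrite -ball_normE/= distrC (le_lt_trans q2p)// (le_lt_trans _ (lt_le_trans hM _))//.
    by rewrite ler_wpM2l// /M (addrC `|w|) lerDl.
  by rewrite ge_min lexx orbT.
have A1 := H1 _ B1; have A2 := H2 _ B2; rewrite -E in A2.
rewrite distrC in A2; rewrite (splitr e) -(subrKA (A q1)).
by rewrite (le_trans (ler_normD _ _))// lerD.
Qed.

End LineDerivative.

Section SmoothReal.
Context {R : realType} {n : nat}.
Local Notation rV := 'rV[R]_n.
Implicit Types (f g : rV -> R) (i j : 'I_n) (l : seq 'I_n) (p v x : rV).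

Definition pd i f : rV -> R := 'D_(@rvdir R n i) f.
Definition pds l f : rV -> R := foldr pd f l.

Definition smoothr f : Prop := forall l,
  continuous (pds l f) /\ forall i x, derivable (pds l f) x (@rvdir R n i).

Lemma pds_rcons l i f : pds (rcons l i) f = pds l (pd i f).
Proof. by rewrite /pds -cats1 foldr_cat. Qed.

Lemma pds_cat l l' f : pds (l ++ l') f = pds l (pds l' f).
Proof. by rewrite /pds foldr_cat. Qed.

Lemma smoothr_pds l f : smoothr f -> smoothr (pds l f).
Proof. by move=> sf l'; rewrite -pds_cat; exact: sf. Qed.

Lemma smoothr_pd i f : smoothr f -> smoothr (pd i f).
Proof. exact: (@smoothr_pds [:: i]). Qed.

Lemma smoothr_continuous f : smoothr f -> continuous f.
Proof. by move=> /(_ [::])[]. Qed.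

Lemma smoothr_is_derive f i p : smoothr f -> is_derive p (@rvdir R n i) f (pd i f p).
Proof. by move=> /(_ [::])[_ df]; apply: DeriveDef => //; exact: df. Qed.

Lemma pd_comm i j f : smoothr f -> pd i (pd j f) = pd j (pd i f).
Proof.
move=> sf; apply/funext => p.
apply: (@mixed_derivativeC _ _ f (pd j f) (pd i f) _ _ p (rvdir j) (rvdir i)).
- by move=> q; exact: smoothr_is_derive.
- by move=> q; exact/smoothr_is_derive/smoothr_pd.
- by move=> q; exact: smoothr_is_derive.
- by move=> q; exact/smoothr_is_derive/smoothr_pd.
- exact: (smoothr_continuous (smoothr_pd _ (smoothr_pd _ sf))).
- exact: (smoothr_continuous (smoothr_pd _ (smoothr_pd _ sf))).
Qed.

Lemma pds_perm l l' f : smoothr f -> perm_eq l l' -> pds l f = pds l' f.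
Proof.
move=> sf; have front i a b : pds (a ++ i :: b) f = pds (i :: a ++ b) f.
  elim: a => //= j a ->; apply: pd_comm; exact: smoothr_pds.
elim: l l' => [|i l IH] l'; first by rewrite perm_sym => /perm_nilP ->.
move=> H; have : i \in l' by rewrite -(perm_mem H) mem_head.
move=> /splitPr il'; case: il' H => a b H; rewrite front /=; congr (pd i _).
apply: IH; rewrite -(perm_cons i) (perm_trans H)//.
by rewrite perm_catC /= perm_cons perm_catC.
Qed.

Lemma continuous_sumr (I : Type) (s : seq I) (F : I -> rV -> R) :
  (forall k, continuous (F k)) -> continuous (fun x => \sum_(k <- s) F k x).
Proof.
move=> cF; elim: s => [|i s IH].
  by under eq_fun do rewrite big_nil; exact: cst_continuous.
under eq_fun do rewrite big_cons.
by move=> x; apply: continuousD; [exact: cF|exact: IH].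
Qed.

Lemma is_derive_scaled_dir f (c : R) i p : smoothr f ->
  is_derive p (c *: @rvdir R n i) f (c * pd i f p).
Proof.
move=> sf; apply: line_is_derive.
have sfi q : derivable f q (@rvdir R n i) by have [_ df] := sf [::]; exact: df.
rewrite (_ : (fun s => _) = (fun s : R => f (p + s *: @rvdir R n i)) \o (fun s : R => c * s)); last first.
  by apply/funext => s /=; rewrite scalerA mulrC.
rewrite mulrC.
have H : is_derive (c * 0) 1 (fun s : R => f (p + s *: @rvdir R n i)) (pd i f p).
  rewrite mulr0; have := is_derive_line (sfi (p + 0 *: @rvdir R n i)).
  by rewrite scale0r addr0.
apply: is_derive1_comp H _.
by apply: is_derive_eq; rewrite scaler1.
Qed.

(** [v] is the sum of its components along the axes, and the directional
    derivative is additive in the direction. *)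
Lemma is_derive_dir f v p : smoothr f ->
  is_derive p v f (\sum_i v 0 i * pd i f p).
Proof.
move=> sf; rewrite {1}[v]row_sum_delta.
elim: (index_enum _) => [|i s IH].
  by rewrite !big_nil; exact: is_derive0.
rewrite !big_cons.
have du q : is_derive q (v 0 i *: delta_mx 0 i) f (v 0 i * pd i f q).
  exact: is_derive_scaled_dir.
have E : 'D_(v 0 i *: delta_mx 0 i) f = (fun q => v 0 i * pd i f q).
  by apply/funext => q; have [] := du q.
have [dw <-] := IH.
have <- : 'D_(v 0 i *: delta_mx 0 i) f p = v 0 i * pd i f p by have [] := du p.
have du' q : derivable f q (v 0 i *: delta_mx 0 i) by have [] := du q.
have cu : {for p, continuous ('D_(v 0 i *: delta_mx 0 i) f)}.
  rewrite E; apply: continuousM; first exact: cst_continuous.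
  exact: (smoothr_continuous (smoothr_pd i sf)).
exact: (is_deriveD_dir du' cu dw).
Qed.

(** The iterated directional derivative [(v . grad)^m f]. *)
Fixpoint dirD v m f : rV -> R :=
  if m is m'.+1 then fun x => \sum_i v 0 i * dirD v m' (pd i f) x else f.

Lemma is_derive_dirD v m f p (s : R) : smoothr f ->
  is_derive s 1 (fun s => dirD v m f (p + s *: v)) (dirD v m.+1 f (p + s *: v)).
Proof.
elim: m f => [|m IH] f sf.
  have d q := is_derive_dir v q sf.
  have dE q : derivable f q v by have [] := d q.
  have := is_derive_line (dE (p + s *: v)).
  by have [_ ->] := d (p + s *: v).
rewrite (_ : (fun s => _) = \sum_i (v 0 i \*: (fun s : R => dirD v m (pd i f) (p + s *: v)))); last first.
  by apply/funext => s'; rewrite fct_sumE.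
apply: is_derive_sum => i; apply: is_deriveZ; apply: IH.
exact: smoothr_pd.
Qed.

Lemma normv_coord v i : `|v 0 i| <= `|v|.
Proof.
rewrite [leRHS]/Num.norm/= mx_normrE.
exact: (le_bigmax _ (fun ij : 'I_1 * 'I_n => `|v ij.1 ij.2|) (ord0, i)).
Qed.

(** [dirD v m] is a sum of [n ^ m] partial derivatives with coefficients
    bounded by [`|v| ^+ m]. *)
Lemma dirD_le v m f x (M : R) : (forall l, size l = m -> `|pds l f x| <= M) ->
  `|dirD v m f x| <= n%:R ^+ m * `|v| ^+ m * M.
Proof.
elim: m f => [|m IH] f H; first by rewrite !expr0 !mul1r; exact: (H [::]).
apply: le_trans (ler_norm_sum _ _ _) _.
have H' i : `|v 0 i * dirD v m (pd i f) x| <= `|v| * (n%:R ^+ m * `|v| ^+ m * M).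
  rewrite normrM ler_pM//; first exact: normv_coord.
  by apply: IH => l sl; rewrite -pds_rcons; apply: H; rewrite size_rcons sl.
apply: le_trans (ler_sum _ (fun i _ => H' i)) _.
by rewrite sumr_const card_ord -[leLHS]mulr_natl !exprS le_eqVlt; apply/orP; left; apply/eqP; ring.
Qed.

End SmoothReal.

Section Taylor.
Context {R : realType}.

Lemma is_derive_divided_power j (s : R) :
  is_derive s 1 (fun s : R => s ^+ j.+1 / (j.+1)`!%:R) (s ^+ j / j`!%:R).
Proof.
have -> : (fun s : R => s ^+ j.+1 / (j.+1)`!%:R) =
    ((j.+1)`!%:R^-1 \*: (fun s : R => s ^+ j.+1)).
  by apply/funext => x; rewrite /= mulrC.
have dX : is_derive s 1 (fun s : R => s ^+ j.+1) (j.+1%:R * s ^+ j).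
  apply: DeriveDef; first exact: exprn_derivable.
  by rewrite exp_derive /= /GRing.scale/= mulr1.
have -> : s ^+ j / j`!%:R = (j.+1)`!%:R^-1 *: (j.+1%:R * s ^+ j).
  rewrite /GRing.scale/= factS natrM invfM.
  by rewrite mulrACA mulVf ?pnatr_eq0// mul1r mulrC.
exact: is_deriveZ.
Qed.

(** [G j] stands for the j-th derivative of [G 0]. The remainder and its bound
    both vanish at 0, so it suffices to compare their derivatives; that is the
    statement for the shifted family. *)
Lemma taylor_bound m (G : nat -> R -> R) (M : R) :
  (forall j (s : R), is_derive s 1 (G j) (G j.+1 s)) ->
  (forall s, 0 <= s <= 1 -> `|G m s| <= M) ->
  forall s, 0 <= s <= 1 ->
  `|G 0%N s - \sum_(j < m) s ^+ j / j`!%:R * G j 0| <= M * (s ^+ m / m`!%:R).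
Proof.
elim: m G => [|m IH] G dG GM s s01.
  by rewrite big_ord0 subr0 expr0 fact0 invr1 !mulr1; exact: GM.
have {}IH := IH (fun j => G j.+1) (fun j => dG j.+1) GM.
pose H (s : R) := G 0%N s - \sum_(j < m.+1) s ^+ j / j`!%:R * G j 0.
pose H' (s : R) := G 1%N s - \sum_(j < m) s ^+ j / j`!%:R * G j.+1 0.
have dH (x : R) : is_derive x 1 H (H' x).
  rewrite /H; under eq_fun do rewrite big_ord_recl /=.
  rewrite /H' -[\sum_(j < m) _]add0r.
  apply: is_deriveB.
  apply: is_deriveD.
    under eq_fun do rewrite expr0; exact: is_derive_cst.
  rewrite (_ : (fun s => _) = \sum_(j < m) (G j.+1 0 \*: (fun s : R => s ^+ j.+1 / (j.+1)`!%:R))); last first.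
    by apply/funext => y; rewrite fct_sumE; apply: eq_bigr => j _ /=; rewrite mulrC.
  rewrite (_ : \sum_(j < m) _ = \sum_(j < m) G j.+1 0 *: (x ^+ j / j`!%:R)); last first.
    by apply: eq_bigr => j _; rewrite mulrC.
  by apply: is_derive_sum => j; apply: is_deriveZ; exact: is_derive_divided_power.
have H0 : H 0 = 0.
  rewrite /H big_ord_recl expr0 fact0 invr1 !mul1r big1 ?addr0 ?subrr// => j _.
  by rewrite expr0n/= mul0r mul0r.
have aux (e : R) : `|e| = 1 -> e * H s <= M * (s ^+ m.+1 / (m.+1)`!%:R).
  move=> e1.
  pose D (x : R) := M * (x ^+ m.+1 / (m.+1)`!%:R) - e * H x.
  have dD (x : R) : is_derive x 1 D (M * (x ^+ m / m`!%:R) - e * H' x).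
    exact: (is_deriveB (is_deriveZ M (is_derive_divided_power m x)) (is_deriveZ e (dH x))).
  have [th /andP[th0 th1]] := mean_value 0 s dD.
  move: s01 => /andP[s0 s1].
  rewrite subr0 add0r {2}/D H0 expr0n/= mul0r !mulr0 !subr0 => E.
  rewrite -subr_ge0 -/(D s) E mulr_ge0// subr_ge0.
  have ts : 0 <= th * s <= 1 by rewrite mulr_ge0//= mulr_ile1.
  apply: le_trans (IH _ ts).
  by rewrite (le_trans (ler_norm _))// normrM e1 mul1r.
rewrite -/(H s) ler_norml; apply/andP; split.
  by rewrite lerNl; have := aux (-1); rewrite normrN1 mulN1r; exact.
by have := aux 1; rewrite normr1 mul1r; exact.
Qed.

Lemma taylor_dir n (f : 'rV[R]_n -> R) (p v : 'rV[R]_n) m (M : R) : smoothr f ->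
  (forall l th, size l = m -> 0 <= th <= 1 -> `|pds l f (p + th *: v)| <= M) ->
  `|f (p + v) - \sum_(j < m) (j`!%:R)^-1 * dirD v j f p| <=
  n%:R ^+ m * `|v| ^+ m * M / m`!%:R.
Proof.
move=> sf fM.
have := @taylor_bound m (fun j s => dirD v j f (p + s *: v)) (n%:R ^+ m * `|v| ^+ m * M).
move=> /(_ (fun j s => is_derive_dirD v j p s sf)) /(_ _ 1).
rewrite scale1r /= ler01 lexx expr1n mul1r scale0r addr0 => H.
under eq_bigr => j _ do rewrite -[X in X * _]mul1r -[X in X / _](expr1n _ j).
apply: H => // s s01; apply: dirD_le => l sl; exact: fM.
Qed.

End Taylor.

(** * Powers of factorials and stretched exponentials *)

Lemma fact_mul_le (m p : nat) : (m`! * p`! <= (m + p)`!)%N.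
Proof.
rewrite -(bin_fact (leq_addr p m)) addKn mulnA.
by rewrite -mulnA leq_pmull// bin_gt0 leq_addr.
Qed.

Lemma fact_add_le (m p : nat) : ((m + p)`! <= 2 ^ (m + p) * (m`! * p`!))%N.
Proof.
rewrite -(bin_fact (leq_addr p m)) addKn leq_mul2r; apply/orP; right.
rewrite -[X in (X ^ _)%N](_ : 1 + 1 = 2)%N// expnDn.
rewrite (bigD1 (Ordinal (leq_addr p m : m < (m + p).+1)%N)) //=.
by rewrite !exp1n !muln1 leq_addr.
Qed.

Section MultiFactorial.
Context {n : nat}.
Implicit Types be : 'I_n -> nat.

Lemma mfact_le_mabs be : (mfact be <= (mabs be)`!)%N.
Proof.
rewrite /mfact /mabs; elim: (index_enum _) => [|i s IH].
  by rewrite !big_nil.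
by rewrite !big_cons (leq_trans _ (fact_mul_le _ _))// leq_mul2l IH orbT.
Qed.

Lemma mabs_le_mfact be : ((mabs be)`! <= 2 ^ (n * mabs be) * mfact be)%N.
Proof.
rewrite /mfact -{2}(size_enum_ord n) /mabs.
suff H (s : seq 'I_n) : ((\sum_(i <- s) be i)`! <=
    2 ^ (size s * \sum_(i <- s) be i) * \prod_(i <- s) (be i)`!)%N.
  by have := H (enum 'I_n); rewrite !big_enum.
elim: s => [|i s IH]; first by rewrite !big_nil.
rewrite !big_cons (leq_trans (fact_add_le _ _))//= mulSn (expnD 2 (be i + \sum_(j <- s) be j)) -mulnA leq_mul2l.
apply/orP; right. rewrite mulnCA leq_mul2l; apply/orP; right.
by rewrite (leq_trans IH)// leq_mul2r leq_pexp2l ?orbT// leq_mul2l leq_addl orbT.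
Qed.

End MultiFactorial.

Section FactorialPowers.
Context {R : realType}.

(** Every estimate on decay or regularity takes the form
    [_ <= K * A ^+ m * Fp m r], to be compared for varying [r]. *)
Definition Fp (m : nat) (r : R) : R := m`!%:R `^ r.

Lemma fact_ge1R m : 1 <= m`!%:R :> R.
Proof. by rewrite ler1n fact_gt0. Qed.

Lemma fact_gt0R m : 0 < m`!%:R :> R.
Proof. by rewrite ltr0n fact_gt0. Qed.

Lemma Fp_gt0 m r : 0 < Fp m r. Proof. by rewrite powR_gt0// fact_gt0R. Qed.
Lemma Fp_ge0 m r : 0 <= Fp m r. Proof. exact/ltW/Fp_gt0. Qed.

Lemma Fp_ge1 m r : 0 <= r -> 1 <= Fp m r.
Proof. by move=> r0; rewrite -(powRr0 m`!%:R) ler_powR// fact_ge1R. Qed.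

Lemma Fp0 r : Fp 0 r = 1. Proof. by rewrite /Fp fact0 powR1. Qed.

Lemma FpD m r q : Fp m (r + q) = Fp m r * Fp m q.
Proof.
by rewrite /Fp powRD//; apply/implyP => _; rewrite gt_eqF// fact_gt0R.
Qed.

Lemma FpB1 m r : Fp m (r - 1) = Fp m r / m`!%:R.
Proof. by rewrite FpD /Fp powRN powRr1// ler0n. Qed.

Lemma powR_exprn_comm (x r : R) k : 0 <= x -> (x ^+ k) `^ r = (x `^ r) ^+ k.
Proof.
move=> x0; rewrite -(powR_mulrn k x0) -(powR_mulrn k (powR_ge0 x r)).
by rewrite -!powRrM mulrC.
Qed.

Lemma Fp_add m p r : 0 <= r -> Fp (m + p) r <= (2 `^ r) ^+ (m + p) * (Fp m r * Fp p r).
Proof.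
move=> r0; rewrite -powR_exprn_comm//.
rewrite /Fp -!powRM ?mulr_ge0 ?exprn_ge0//.
apply: ge0_ler_powR => //; rewrite ?nnegrE ?ler0n ?mulr_ge0 ?exprn_ge0//.
by rewrite -natrX -!natrM ler_nat fact_add_le.
Qed.

Lemma two_powR_ge1 (r : R) : 0 <= r -> 1 <= 2 `^ r.
Proof. by move=> r0; rewrite -[leLHS](powRr0 2) ler_powR// ler1n. Qed.

Lemma expr_1D_le (y : R) k : 0 <= y -> (1 + y) ^+ k <= 2 ^+ k * (1 + y ^+ k).
Proof.
move=> y0; have [y1|/ltW y1] := leP y 1.
  apply: (@le_trans _ _ (2 ^+ k)); first by rewrite lerXn2r ?nnegrE//; lra.
  by rewrite ler_peMr ?exprn_ge0// lerDl exprn_ge0.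
apply: (@le_trans _ _ (2 ^+ k * y ^+ k)).
  by rewrite -exprMn lerXn2r ?nnegrE//; lra.
by rewrite ler_wpM2l ?exprn_ge0// lerDr.
Qed.

Lemma expR_ge_pow (z : R) m : 0 <= z -> z ^+ m / m`!%:R <= expR z.
Proof.
move=> z0.
case: m => [|m]; first by rewrite expr0 fact0 divr1 -expR0 ler_expR.
apply: le_trans (expR_ge1Dxn m z0). by rewrite lerDr.
Qed.

Lemma series_half (N : nat) : \sum_(0 <= m < N) (2^-1 : R) ^+ m <= 2.
Proof.
suff -> : \sum_(0 <= m < N) (2^-1 : R) ^+ m = 2 - 2 * 2^-1 ^+ N.
  by rewrite gerBl mulr_ge0// exprn_ge0// invr_ge0.
elim: N => [|N IH]; first by rewrite big_nil expr0; lra.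
by rewrite big_nat_recr//= IH exprS; set q := _ ^+ N; lra.
Qed.

(** Bounds [X^m y <= K A^m m!^tau] for all [m] amount to stretched
    exponential decay: dividing by [m!] and summing over [m] rebuilds the
    exponential series. *)
Lemma exp_decay_of_pow (y X K A tau : R) : 0 < tau -> 0 < A -> 0 <= X -> 0 <= y ->
  (forall m, X ^+ m * y <= K * A ^+ m * Fp m tau) ->
  y <= K * 2 `^ tau * expR (- (tau / 2 * (X / A) `^ tau^-1)).
Proof.
move=> tau0 A0 X0 y0 H.
have K0 : 0 <= K.
  by have := H 0%N; rewrite !expr0 Fp0 mul1r !mulr1; exact: le_trans.
have [Ke|Kn0] := eqVneq K 0.
  rewrite Ke !mul0r; have := H 0%N; rewrite !expr0 mul1r => /le_trans; apply.
  by rewrite Ke !mul0r.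
have Kp : 0 < K by rewrite lt_neqAle eq_sym Kn0.
set w := (X / A) `^ tau^-1.
have w0 : 0 <= w by exact: powR_ge0.
pose q := (y / K) `^ tau^-1.
have q0 : 0 <= q by exact: powR_ge0.
have yK0 : 0 <= y / K by rewrite divr_ge0.
have XA0 : 0 <= X / A by rewrite divr_ge0// ltW.
have qw m : q * w ^+ m <= m`!%:R.
  have -> : q * w ^+ m = ((X / A) ^+ m * (y / K)) `^ tau^-1.
    rewrite powRM ?exprn_ge0// mulrC; congr (_ * _).
    by rewrite powR_exprn_comm.
  have -> : m`!%:R = (Fp m tau) `^ tau^-1.
    by rewrite -powRrM mulfV ?gt_eqF// powRr1.
  apply: ge0_ler_powR; rewrite ?nnegrE ?invr_ge0 ?Fp_ge0 ?(ltW tau0)//.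
    by rewrite mulr_ge0// exprn_ge0.
  rewrite expr_div_n mulf_div ler_pdivrMr ?mulr_gt0 ?exprn_gt0//.
  by rewrite (le_trans (H m))// le_eqVlt; apply/orP; left; apply/eqP; ring.
have qe : q * expR (w / 2) <= 2.
  have [->|qn0] := eqVneq q 0; first by rewrite mul0r.
  have qp : 0 < q by rewrite lt_neqAle eq_sym qn0.
  rewrite -ler_pdivlMl//; apply: limr_le; first exact: is_cvg_series_exp_coeff.
  apply: nearW => N; rewrite ler_pdivlMl//.
  apply: le_trans (series_half N); rewrite /series/= mulr_sumr.
  apply: ler_sum => m _; rewrite /exp_coeff/= expr_div_n mulrA -exprVn mulrA.
  rewrite mulrAC ler_piMl ?exprn_ge0 ?invr_ge0//.
  by rewrite ler_pdivrMr ?fact_gt0R// mul1r.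
have q2 : q <= 2 * expR (- (w / 2)).
  by rewrite expRN ler_pdivlMr ?expR_gt0.
have yE : y = K * q `^ tau.
  rewrite -powRrM mulVf ?gt_eqF// powRr1//; field; exact: Kn0.
rewrite yE -mulrA ler_wpM2l//.
rewrite (_ : - (tau / 2 * w) = - (w / 2) * tau); last by field.
rewrite expRM -powRM ?expR_ge0//; apply: ge0_ler_powR => //.
- exact: ltW.
- by rewrite nnegrE mulr_ge0// expR_ge0.
Qed.

(** The converse direction, from [z ^ m / m! <= exp z] at
    [z = eps / tau * X ^ (1 / tau)]. *)
Lemma pow_exp_decay (X eps tau : R) m : 0 < tau -> 0 < eps -> 0 <= X ->
  X ^+ m * expR (- (eps * X `^ tau^-1)) <= ((tau / eps) `^ tau) ^+ m * Fp m tau.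
Proof.
move=> tau0 eps0 X0.
set z := eps / tau * X `^ tau^-1.
have z0 : 0 <= z by rewrite mulr_ge0 ?powR_ge0// divr_ge0// ltW.
have XE : X = (tau / eps) `^ tau * z `^ tau.
  rewrite -powRM ?divr_ge0 ?(ltW tau0) ?(ltW eps0)//.
  have -> : tau / eps * z = X `^ tau^-1 by rewrite /z; field; rewrite !gt_eqF.
  by rewrite -powRrM mulVf ?gt_eqF// powRr1.
have -> : eps * X `^ tau^-1 = tau * z by rewrite /z; field; rewrite gt_eqF.
rewrite {1}XE exprMn -mulrA ler_wpM2l ?exprn_ge0 ?powR_ge0//.
rewrite -powR_exprn_comm// (_ : - (tau * z) = - z * tau); last by ring.
rewrite expRM.
rewrite -powRM ?exprn_ge0 ?expR_ge0//.
apply: ge0_ler_powR; rewrite ?nnegrE ?mulr_ge0 ?exprn_ge0 ?expR_ge0 ?ler0n ?(ltW tau0)//.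
by rewrite expRN ler_pdivrMr ?expR_gt0// mulrC -ler_pdivrMr ?fact_gt0R// expR_ge_pow.
Qed.

End FactorialPowers.

(** * Vanishing moments at small and at large scales *)

Section Decay.
Context {R : realType} {n : nat}.
Local Notation rV := 'rV[R]_n.
Implicit Types (f g v : rV -> R) (l w : seq 'I_n) (x b : rV) (a : R).

(** A monomial is given by the word of its factors. *)
Definition xw w x : R := \prod_(i <- w) x 0 i.

Definition moment0 f := forall w, rint (fun x => xw w x * f x) = 0.

Definition decay f (K A r : R) := forall p x, `|x| ^+ p * `|f x| <= K * A ^+ p * Fp p r.

Definition regular f (K A r : R) :=
  forall l x, `|pds l f x| <= K * A ^+ size l * Fp (size l) r.

Lemma xw_le w x : `|xw w x| <= `|x| ^+ size w.
Proof.
rewrite /xw; elim: w => [|i w IH]; first by rewrite big_nil expr0 normr1.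
by rewrite big_cons normrM exprS ler_pM// normv_coord.
Qed.

Lemma xw_cons i w x : xw (i :: w) x = x 0 i * xw w x.
Proof. by rewrite /xw big_cons. Qed.

Lemma rmeasM f g : rmeas f -> rmeas g -> rmeas (fun x => f x * g x).
Proof. by move=> mf mg; exact: measurable_funM. Qed.

Lemma rmeas_cst (c : R) : rmeas (fun _ : rV => c).
Proof. exact: measurable_cst. Qed.

Lemma rmeas_coord (i : 'I_n) : rmeas (fun x : rV => x 0 i).
Proof.
rewrite /rmeas; under eq_fun do rewrite mxE.
exact: measurable_tnth_real.
Qed.

Lemma rmeas_xw w : rmeas (xw w).
Proof.
elim: w => [|i w IH].
  rewrite (_ : xw [::] = fun=> 1); first exact: (rmeas_cst 1).
  by apply/funext => x; rewrite /xw big_nil.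
rewrite (_ : xw (i :: w) = fun x => x 0 i * xw w x).
  exact: rmeasM (rmeas_coord i) IH.
by apply/funext => x; exact: xw_cons.
Qed.

Lemma weight_ge x : 1 <= weight x * (2 ^+ n * (1 + `|x| ^+ n.*2)).
Proof.
rewrite -ler_pdivrMl ?weight_gt0// mulr1 /weight -prodfV.
apply: (@le_trans _ _ ((1 + `|x| ^+ 2) ^+ n)).
  rewrite (_ : (1 + _) ^+ n = \prod_(i < n) (1 + `|x| ^+ 2)); last first.
    by rewrite prodr_const card_ord.
  apply: ler_prod => i _.
  rewrite invrK (le_trans ler01) ?oneDsqr_ge1//= /oneDsqr lerD2l.
  by rewrite -real_normK ?num_real// lerXn2r ?nnegrE// normv_coord.
by rewrite (le_trans (expr_1D_le _ _))// ?exprn_ge0// -exprM mul2n.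
Qed.

Definition cweight (A r : R) : R :=
  2 ^+ n * (1 + (2 `^ r * A) ^+ n.*2 * Fp n.*2 r).

Lemma cweight_ge1 A r : 0 <= r -> 1 <= A -> 1 <= cweight A r.
Proof.
move=> r0 A1; rewrite /cweight -[leLHS]mulr1 ler_pM//; first by rewrite exprn_ege1// ler1n.
rewrite lerDl mulr_ge0// ?Fp_ge0// exprn_ge0// mulr_ge0 ?powR_ge0//.
exact: le_trans A1.
Qed.

Lemma decay_weight f K A r p x : 0 <= K -> 1 <= A -> 0 <= r -> decay f K A r ->
  `|x| ^+ p * `|f x| <= K * cweight A r * (2 `^ r * A) ^+ p * Fp p r * weight x.
Proof.
move=> K0 A1 r0 df.
have A0 : 0 <= A by exact: le_trans A1.
have y0 : 0 <= `|x| ^+ p * `|f x| by rewrite mulr_ge0// exprn_ge0.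
have le1 : `|x| ^+ p * `|f x| <= K * (2 `^ r * A) ^+ p * Fp p r.
  apply: le_trans (df p x) _; rewrite ler_wpM2r ?Fp_ge0// ler_wpM2l//.
  rewrite lerXn2r ?nnegrE ?mulr_ge0 ?powR_ge0//.
  by rewrite ler_peMl// two_powR_ge1.
have le2 : `|x| ^+ (p + n.*2) * `|f x| <=
    K * (2 `^ r * A) ^+ p * Fp p r * ((2 `^ r * A) ^+ n.*2 * Fp n.*2 r).
  apply: le_trans (df _ x) _.
  apply: (@le_trans _ _ (K * A ^+ (p + n.*2) *
    ((2 `^ r) ^+ (p + n.*2) * (Fp p r * Fp n.*2 r)))).
    by rewrite ler_wpM2l ?Fp_add// mulr_ge0// exprn_ge0.
  by rewrite !exprMn !exprD le_eqVlt; apply/orP; left; apply/eqP; ring.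
apply: (@le_trans _ _ (`|x| ^+ p * `|f x| * (weight x * (2 ^+ n * (1 + `|x| ^+ n.*2))))).
  by rewrite ler_peMr// weight_ge.
rewrite [leLHS](_ : _ = weight x * 2 ^+ n *
  (`|x| ^+ p * `|f x| + `|x| ^+ (p + n.*2) * `|f x|)); last by rewrite exprD; ring.
apply: (@le_trans _ _ (weight x * 2 ^+ n * (K * (2 `^ r * A) ^+ p * Fp p r +
    K * (2 `^ r * A) ^+ p * Fp p r * ((2 `^ r * A) ^+ n.*2 * Fp n.*2 r)))).
  by rewrite ler_wpM2l ?lerD// mulr_ge0 ?weight_ge0 ?exprn_ge0.
by rewrite /cweight le_eqVlt; apply/orP; left; apply/eqP; ring.
Qed.

Lemma decay_bound f K A r x : decay f K A r -> `|f x| <= K.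
Proof. by move=> /(_ 0%N x); rewrite !expr0 Fp0 mul1r !mulr1. Qed.

Lemma decay_integrable f K A r w : 0 <= K -> 1 <= A -> 0 <= r -> decay f K A r ->
  rmeas f -> rintegrable (fun x => xw w x * f x).
Proof.
move=> K0 A1 r0 df mf.
apply: (@wle_rintegrable _ _ _ (K * cweight A r * (2 `^ r * A) ^+ size w * Fp (size w) r)).
  exact: rmeasM (rmeas_xw w) mf.
move=> x; rewrite normrM; apply: le_trans (decay_weight _ _ K0 A1 r0 df).
by rewrite ler_wpM2r// xw_le.
Qed.

(** The terms of a Taylor polynomial are polynomials in [x], so vanishing
    moments kill them; the monomial in front absorbs the factors that the
    induction on [j] extracts from [dirD]. *)
Lemma poly_vanish f g K A r (c : R) p j w : 0 <= K -> 1 <= A -> 0 <= r ->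
  decay f K A r -> rmeas f -> moment0 f ->
  rintegrable (fun x => xw w x * f x * dirD (c *: x) j g p) /\
  rint (fun x => xw w x * f x * dirD (c *: x) j g p) = 0.
Proof.
move=> K0 A1 r0 df mf f0; elim: j w g => [|j IH] w g /=.
  under eq_fun do rewrite mulrC; split.
    exact/rintegrableZ/(decay_integrable _ K0 A1 r0 df mf).
  by rewrite rintZ ?f0 ?mulr0//; exact: (decay_integrable _ K0 A1 r0 df mf).
have E : (fun x => xw w x * f x * \sum_i (c *: x) 0 i * dirD (c *: x) j (pd i g) p) =
    (fun x => \sum_i c * (xw (i :: w) x * f x * dirD (c *: x) j (pd i g) p)).
  apply/funext => x; rewrite mulr_sumr; apply: eq_bigr => i _.
  by rewrite mxE xw_cons; ring.
have H i : rintegrable (fun x => c * (xw (i :: w) x * f x * dirD (c *: x) j (pd i g) p)).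
  by apply: rintegrableZ; exact: (IH _ _).1.
rewrite E; split; first exact: rintegrable_sum.
rewrite rint_sum// big1// => i _; rewrite rintZ; last exact: (IH _ _).1.
by rewrite (IH _ _).2 mulr0.
Qed.

Lemma taylor_vanish f g K A r (c : R) p m : 0 <= K -> 1 <= A -> 0 <= r ->
  decay f K A r -> rmeas f -> moment0 f ->
  rintegrable (fun x => f x * \sum_(j < m) (j`!%:R)^-1 * dirD (c *: x) j g p) /\
  rint (fun x => f x * \sum_(j < m) (j`!%:R)^-1 * dirD (c *: x) j g p) = 0.
Proof.
move=> K0 A1 r0 df mf f0.
have E : (fun x => f x * \sum_(j < m) (j`!%:R)^-1 * dirD (c *: x) j g p) =
   (fun x => \sum_(j < m) (j`!%:R)^-1 * (xw [::] x * f x * dirD (c *: x) j g p)).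
  apply/funext => x; rewrite mulr_sumr; apply: eq_bigr => j _.
  by rewrite /xw big_nil; ring.
have P (j : 'I_m) := poly_vanish g c p j [::] K0 A1 r0 df mf f0.
rewrite E; split.
  by apply: rintegrable_sum => j; apply: rintegrableZ; exact: (P j).1.
rewrite rint_sum; last by move=> j; apply: rintegrableZ; exact: (P j).1.
by rewrite big1// => j _; rewrite rintZ ?(P j).2 ?mulr0//; exact: (P j).1.
Qed.

End Decay.

Section ScaleAverage.
Context {R : realType} {n : nat}.
Local Notation rV := 'rV[R]_n.
Implicit Types (f g v : rV -> R) (l w : seq 'I_n) (x b : rV) (a : R).

(** The wavelet transform of [v] with the wavelet [g] at [(b, a)], after the
    change of variable [x = b + a z]. *)
Definition wavI v g b a : R := rint (fun z => v (b + a *: z) * g z).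

Lemma wavI_integrable v g b a (K C A r : R) : 0 <= K -> 0 <= C -> 1 <= A -> 0 <= r ->
  rmeas v -> (forall x, `|v x| <= K) -> rmeas g -> decay g C A r ->
  rintegrable (fun z => v (b + a *: z) * g z).
Proof.
move=> K0 C0 A1 r0 mv vK mg dg.
apply: (@wle_rintegrable _ _ _ (K * (C * @cweight R n A r))).
  exact: rmeasM (rmeas_affine _ _ mv) mg.
move=> z; rewrite normrM -[leRHS]mulrA ler_pM//.
have := decay_weight 0 z C0 A1 r0 dg; rewrite !expr0 Fp0 mul1r !mulr1; apply.
Qed.

Lemma wavI_le v g b a (K C A r : R) : 0 <= K -> 0 <= C -> 1 <= A -> 0 <= r ->
  rmeas v -> (forall x, `|v x| <= K) -> rmeas g -> decay g C A r ->
  `|wavI v g b a| <= K * (C * @cweight R n A r * pi ^+ n).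
Proof.
move=> K0 C0 A1 r0 mv vK mg dg; rewrite mulrA.
apply: rint_wle; first exact: (wavI_integrable _ _ K0 C0 A1 r0 mv vK mg dg).
move=> z; rewrite normrM -[leRHS]mulrA ler_pM//.
have := decay_weight 0 z C0 A1 r0 dg; rewrite !expr0 Fp0 mul1r !mulr1; apply.
Qed.

(** Small scales: Taylor expansion of [v] at [b], whose polynomial part is
    killed by the vanishing moments of the wavelet. *)
Lemma wavI_small v g b a (K C A r s : R) m : 0 <= K -> 0 <= C -> 1 <= A -> 0 <= r -> 0 <= s ->
  0 < a -> smoothr v -> regular v K A s ->
  continuous g -> decay g C A r -> moment0 g ->
  a ^- m * `|wavI v g b a| <=
  K * (C * @cweight R n A r * pi ^+ n) * (n%:R * A * (2 `^ r * A)) ^+ m * Fp m (s + r - 1).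
Proof.
move=> K0 C0 A1 r0 s0 a0 sv rv cg dg g0.
have mg := continuous_rmeas cg.
have mv := continuous_rmeas (smoothr_continuous sv).
have vK x : `|v x| <= K by have := rv [::] x; rewrite expr0 Fp0 !mulr1.
have A0 : 0 <= A by exact: le_trans A1.
pose P z := \sum_(j < m) (j`!%:R)^-1 * dirD (a *: z) j v b.
have [iP rP] := taylor_vanish v a b m C0 A1 r0 dg mg g0.
have iI := wavI_integrable b a K0 C0 A1 r0 mv vK mg dg.
have -> : wavI v g b a = rint (fun z => v (b + a *: z) * g z - g z * P z).
  by rewrite rintB// rP subr0.
rewrite ler_pdivrMl ?exprn_gt0//.
apply: le_trans (rint_wle (C := a ^+ m * (K * (C * @cweight R n A r) *
  (n%:R * A * (2 `^ r * A)) ^+ m * Fp m (s + r - 1))) _ _) _.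
- exact: rintegrableB.
- move=> z; rewrite (mulrC (g z)) -mulrBl normrM.
  have T := @taylor_dir _ _ v b (a *: z) m (K * A ^+ m * Fp m s) sv _.
  apply: (@le_trans _ _ (n%:R ^+ m * `|a *: z| ^+ m * (K * A ^+ m * Fp m s) / m`!%:R * `|g z|)).
    by rewrite ler_wpM2r//; apply: T => l th <- _; exact: rv.
  rewrite normrZ exprMn (gtr0_norm a0).
  rewrite [leLHS](_ : _ = n%:R ^+ m * a ^+ m * (K * A ^+ m * (Fp m s / m`!%:R)) *
     (`|z| ^+ m * `|g z|)); last by ring.
  rewrite -FpB1.
  apply: le_trans (ler_wpM2l _ (decay_weight m z C0 A1 r0 dg)) _.
    by rewrite !mulr_ge0 ?exprn_ge0 ?Fp_ge0 ?ler0n// ltW.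
  rewrite (_ : s + r - 1 = s - 1 + r); last by ring.
  rewrite FpD [X in _ <= _ * (_ * X * _) * _]exprMn [(n%:R * A) ^+ m]exprMn.
  by rewrite le_eqVlt; apply/orP; left; apply/eqP; ring.
- by rewrite le_eqVlt; apply/orP; left; apply/eqP; ring.
Qed.

(** Large scales: Taylor expansion of the wavelet, whose polynomial part is
    killed by the vanishing moments of [v]. *)
Lemma wavI_large v g b a (K C A r q rho : R) m : 0 <= K -> 0 <= C -> 1 <= A -> 0 <= r -> 0 <= rho ->
  0 <= q -> 1 <= a -> continuous v -> decay v K A q -> moment0 v ->
  smoothr g -> regular g C A rho -> decay g C A r ->
  a ^+ m * `|wavI v g b a| <=
  K * (C * @cweight R n A q * pi ^+ n) * (n%:R * A * (2 `^ q * A)) ^+ m * Fp m (q + rho - 1).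
Proof.
move=> K0 C0 A1 r0 rho0 q0 a1 cv dv v0 sg rg dg.
have a0 : 0 < a by exact: lt_le_trans a1.
have mv := continuous_rmeas cv.
have mg := continuous_rmeas (smoothr_continuous sg).
have vK x := decay_bound x dv.
have A0 : 0 <= A by exact: le_trans A1.
have iI := wavI_integrable b a K0 C0 A1 r0 mv vK mg dg.
pose c := - (a^-1 *: b).
have an0 : a^-1 != 0 by rewrite invr_eq0 gt_eqF.
have Ef x : v (b + a *: (c + a^-1 *: x)) * g (c + a^-1 *: x) = v x * g (c + a^-1 *: x).
  rewrite /c scalerDr scalerN !scalerA mulfV ?gt_eqF// !scale1r addrA subrr add0r//.
have iI' := rintegrable_affine c an0 iI; rewrite /= in iI'.
have := rint_affine c an0 iI; rewrite /= -/(wavI v g b a) => IE.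
have {}IE : `|wavI v g b a| <= `|rint (fun x => v x * g (c + a^-1 *: x))|.
  have -> : (fun x => v x * g (c + a^-1 *: x)) =
    (fun x => v (b + a *: (c + a^-1 *: x)) * g (c + a^-1 *: x)).
    by apply/funext => x; rewrite Ef.
  rewrite IE normrM ler_peMl// normrX ger0_norm ?invr_ge0// normfV invrK exprn_ege1//.
  by rewrite gtr0_norm.
apply: le_trans (ler_wpM2l (exprn_ge0 m (ltW a0)) IE) _.
have {}iI' : rintegrable (fun x => v x * g (c + a^-1 *: x)).
  rewrite (_ : (fun x => _) =
    (fun x => v (b + a *: (c + a^-1 *: x)) * g (c + a^-1 *: x)))//.
  by apply/funext => x; rewrite Ef.
pose P x := \sum_(j < m) (j`!%:R)^-1 * dirD (a^-1 *: x) j g c.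
have [iP rP] := taylor_vanish g a^-1 c m K0 A1 q0 dv mv v0.
have -> : rint (fun x => v x * g (c + a^-1 *: x)) =
    rint (fun x => v x * g (c + a^-1 *: x) - v x * P x).
  by rewrite rintB// rP subr0.
rewrite mulrC -ler_pdivlMr ?exprn_gt0//.
apply: le_trans (rint_wle (C := a ^- m * (K * (C * @cweight R n A q) *
  (n%:R * A * (2 `^ q * A)) ^+ m * Fp m (q + rho - 1))) _ _) _.
- exact: rintegrableB.
- move=> x; rewrite -mulrBr normrM.
  have T := @taylor_dir _ _ g c (a^-1 *: x) m (C * A ^+ m * Fp m rho) sg _.
  apply: (@le_trans _ _ (`|v x| * (n%:R ^+ m * `|a^-1 *: x| ^+ m * (C * A ^+ m * Fp m rho) / m`!%:R))).
    by rewrite ler_wpM2l//; apply: T => l th <- _; exact: rg.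
  rewrite normrZ exprMn normfV (gtr0_norm a0).
  rewrite [leLHS](_ : _ = n%:R ^+ m * a^-1 ^+ m * (C * A ^+ m * (Fp m rho / m`!%:R)) *
     (`|x| ^+ m * `|v x|)); last by ring.
  rewrite -FpB1.
  apply: le_trans (ler_wpM2l _ (decay_weight m x K0 A1 q0 dv)) _.
    by rewrite !mulr_ge0 ?exprn_ge0 ?Fp_ge0 ?ler0n// invr_ge0 ltW.
  rewrite (_ : q + rho - 1 = rho - 1 + q); last by ring.
  rewrite FpD [X in _ <= _ * (_ * X * _) * _]exprMn [(n%:R * A) ^+ m]exprMn exprVn.
  by rewrite le_eqVlt; apply/orP; left; apply/eqP; ring.
- rewrite ler_pdivlMr ?exprn_gt0// le_eqVlt; apply/orP; left; apply/eqP.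
  by field; rewrite expf_neq0 // gt_eqF.
Qed.

End ScaleAverage.

(** * Real-valued Gelfand-Shilov functions *)

Lemma is_derive_sumr (R : realType) (V : normedModType R) (I : Type) (s : seq I)
    (F : I -> V -> R) (dF : I -> R) x u :
  (forall k, is_derive x u (F k) (dF k)) ->
  is_derive x u (fun y => \sum_(k <- s) F k y) (\sum_(k <- s) dF k).
Proof.
move=> dFk; elim: s => [|k s IH].
  under eq_fun do rewrite big_nil; rewrite big_nil; exact: is_derive_cst.
under eq_fun do rewrite big_cons; rewrite big_cons.
exact: is_deriveD.
Qed.

Section GelfandShilovReal.
Context {R : realType} {n : nat}.
Local Notation rV := 'rV[R]_n.
Implicit Types (f g v : rV -> R) (l w : seq 'I_n) (i j : 'I_n) (x b : rV) (a : R).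

Lemma Fp_mono (m p : nat) (r : R) : (m <= p)%N -> 0 <= r -> Fp m r <= Fp p r.
Proof.
move=> mp r0; apply: ge0_ler_powR; rewrite ?nnegrE ?ler0n// ler_nat.
exact: leq_fact.
Qed.

Lemma Fp1 (r : R) : Fp 1 r = 1. Proof. by rewrite /Fp (_ : 1`! = 1)%N// powR1. Qed.

(** Words of coordinate directions replace multi-indices, so that a further
    derivative acts by [cons]; Schwarz's theorem makes the two descriptions
    equivalent. *)
Definition gsbound f (C A r1 r2 : R) := forall l p x,
  `|x| ^+ p * `|pds l f x| <= C * A ^+ (p + size l) * (Fp p r2 * Fp (size l) r1).

Definition gsr (r1 r2 : R) f := smoothr f /\
  exists C A : R, [/\ 0 <= C, 1 <= A & gsbound f C A r1 r2].

Lemma gsr_pd r1 r2 f i : 0 <= r1 -> 0 <= r2 -> gsr r1 r2 f -> gsr r1 r2 (pd i f).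
Proof.
move=> r10 r20 [sf [C [A [C0 A1 bf]]]]; split; first exact: smoothr_pd.
have A0 : 0 <= A by exact: le_trans A1.
exists (C * A * 2 `^ r1), (A * 2 `^ r1); split.
- by rewrite !mulr_ge0// powR_ge0.
- by rewrite -[leLHS]mulr1 ler_pM// two_powR_ge1.
move=> l p x; rewrite -pds_rcons; apply: le_trans (bf _ _ _) _.
rewrite size_rcons -[(size l).+1]addn1.
apply: (@le_trans _ _ (C * A ^+ (p + (size l + 1)) * (Fp p r2 *
   ((2 `^ r1) ^+ (size l + 1) * (Fp (size l) r1 * Fp 1 r1))))).
  rewrite ler_wpM2l ?mulr_ge0 ?exprn_ge0// ler_wpM2l ?Fp_ge0//.
  exact: Fp_add.
apply: (@le_trans _ _ (C * A ^+ (p + (size l + 1)) * (Fp p r2 *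
   ((2 `^ r1) ^+ (p + (size l + 1)) * (Fp (size l) r1 * Fp 1 r1))))).
  rewrite ler_wpM2l ?mulr_ge0 ?exprn_ge0// ler_wpM2l ?Fp_ge0//.
  by rewrite ler_wpM2r ?mulr_ge0 ?Fp_ge0// ler_weXn2l ?two_powR_ge1// leq_addl.
rewrite Fp1 mulr1 addnA addn1 !exprS !exprMn.
by rewrite le_eqVlt; apply/orP; left; apply/eqP; ring.
Qed.

Lemma gsr_pds r1 r2 f l : 0 <= r1 -> 0 <= r2 -> gsr r1 r2 f -> gsr r1 r2 (pds l f).
Proof. by move=> r10 r20 gf; elim: l => //= i l; exact: gsr_pd. Qed.

Lemma is_derive_coord i j x :
  is_derive x (@rvdir R n j) (fun x : rV => x 0 i) (i == j)%:R.
Proof.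
apply: line_is_derive.
rewrite (_ : (fun s => _) = (fun s : R => x 0 i + (i == j)%:R * s)); last first.
  by apply/funext => s; rewrite !mxE eqxx /= mulrC.
have := is_deriveD (is_derive_cst (x 0 i) (0 : R) 1)
  (is_deriveZ (i == j)%:R (is_derive_id (0 : R) 1)).
by rewrite add0r /GRing.scale/= mulr1.
Qed.

Definition mulx i f : rV -> R := fun x => x 0 i * f x.

(** The words left when one occurrence of [i] in [l] is erased: these are the
    terms of Leibniz's formula in which a derivative hits the coordinate. *)
Fixpoint dropocc i l : seq (seq 'I_n) :=
  if l is j :: l' then
    (if i == j then [:: l'] else [::]) ++ [seq j :: m | m <- dropocc i l']
  else [::].

Lemma size_dropocc i l : (size (dropocc i l) <= size l)%N.
Proof.
elim: l => //= j l IH; rewrite size_cat size_map.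
by case: eqP => _; rewrite /= ?add0n ?add1n ?ltnS// (leq_trans IH).
Qed.

Lemma size_in_dropocc i l m : m \in dropocc i l -> (size m <= size l)%N.
Proof.
elim: l m => //= j l IH m; rewrite mem_cat => /orP[|/mapP[m' /IH ? ->]//].
by case: eqP => // _; rewrite inE => /eqP ->.
Qed.

Let leibniz i l f : rV -> R :=
  fun x => x 0 i * pds l f x + \sum_(m <- dropocc i l) pds m f x.

Let is_derive_leibniz i j l f x : smoothr f ->
  is_derive x (@rvdir R n j) (leibniz i l f) (leibniz i (j :: l) f x).
Proof.
move=> sf; rewrite {2}/leibniz /= big_cat/= big_map addrA.
have d1 := is_deriveM (is_derive_coord i j x) (smoothr_is_derive j x (smoothr_pds l sf)).
have d2 := is_derive_sumr (dropocc i l) (fun m => smoothr_is_derive j x (smoothr_pds m sf)).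
have := is_deriveD d1 d2; congr (is_derive _ _ _ (_ + _)).
rewrite /GRing.scale/=; congr (_ + _).
by case: (i == j); rewrite ?big_seq1 ?big_nil ?mulr1 ?mulr0.
Qed.

Lemma pds_mulx i l f : smoothr f ->
  pds l (mulx i f) = fun x => x 0 i * pds l f x + \sum_(m <- dropocc i l) pds m f x.
Proof.
move=> sf; elim: l => [|j l /= ->]; apply/funext => x; first by rewrite /= big_nil addr0.
by have [_ E] := is_derive_leibniz i j l x sf; exact: E.
Qed.

Lemma continuous_coord i : continuous (fun x : rV => x 0 i).
Proof. exact: coord_continuous. Qed.

Lemma smoothr_mulx i f : smoothr f -> smoothr (mulx i f).
Proof.
move=> sf l; rewrite pds_mulx//; split.
  have c1 : continuous (fun x => x 0 i * pds l f x).
    move=> x; apply: (@continuousM _ _ (fun x : rV => x 0 i) (pds l f)).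
      exact: continuous_coord.
    exact: (smoothr_continuous (smoothr_pds l sf)).
  have c2 : continuous (fun x => \sum_(m <- dropocc i l) pds m f x).
    by apply: continuous_sumr => m; exact: (smoothr_continuous (smoothr_pds m sf)).
  by move=> x; exact: (continuousD (c1 x) (c2 x)).
by move=> j x; have [] := is_derive_leibniz i j l x sf.
Qed.

Lemma gsbound_mulx r1 r2 f i (C A : R) : 0 <= r1 -> 0 <= r2 -> 0 <= C -> 1 <= A ->
  smoothr f -> gsbound f C A r1 r2 ->
  gsbound (mulx i f) (C * (A * 2 `^ r2 + 1)) (2 * (2 `^ r2 * A)) r1 r2.
Proof.
move=> r10 r20 C0 A1 sf bf.
have A0 : 0 <= A by exact: le_trans A1.
have q1 : 1 <= 2 `^ r2 :> R by exact: two_powR_ge1.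
move: q1; set q : R := 2 `^ r2 => q1.
have q0 : 0 <= q by exact: le_trans q1.
move=> l p x; rewrite pds_mulx//.
set N := (p + size l)%N.
have AN : A ^+ N <= (2 * (q * A)) ^+ N.
  by rewrite lerXn2r ?nnegrE ?mulr_ge0// mulrA ler_peMl// -[leLHS]mulr1 ler_pM ?ler1n.
set FF := Fp p r2 * Fp (size l) r1.
have FF0 : 0 <= FF by rewrite mulr_ge0 ?Fp_ge0.
have T1 : `|x| ^+ p * `|x 0 i * pds l f x| <= C * (A * q) * (2 * (q * A)) ^+ N * FF.
  apply: (@le_trans _ _ (`|x| ^+ p.+1 * `|pds l f x|)).
    by rewrite exprSr normrM -mulrA ler_wpM2l ?exprn_ge0// ler_wpM2r// normv_coord.
  apply: le_trans (bf l p.+1 x) _; rewrite addSn -/N.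
  apply: (@le_trans _ _ (C * A ^+ N.+1 * (q ^+ N.+1 * FF))).
    rewrite ler_wpM2l ?mulr_ge0 ?exprn_ge0// mulrA ler_wpM2r ?Fp_ge0//.
    rewrite -addn1; apply: le_trans (Fp_add p 1 r20) _.
    rewrite Fp1 mulr1 ler_wpM2r ?Fp_ge0// ler_weXn2l//.
    by rewrite addn1 ltnS leq_addr.
  rewrite [leLHS](_ : _ = C * (A * q) * (q * A) ^+ N * FF); last first.
    by rewrite exprMn !exprS; ring.
  rewrite ler_wpM2r// ler_wpM2l ?mulr_ge0// lerXn2r ?nnegrE ?mulr_ge0//.
  by rewrite ler_peMl ?mulr_ge0 ?ler1n.
have T2 : `|x| ^+ p * `|\sum_(m <- dropocc i l) pds m f x| <= C * (2 * (q * A)) ^+ N * FF.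
  apply: (@le_trans _ _ (\sum_(m <- dropocc i l) C * A ^+ N * FF)).
    apply: le_trans (ler_wpM2l (exprn_ge0 _ (normr_ge0 x)) (ler_norm_sum _ _ _)) _.
    rewrite mulr_sumr big_seq [leRHS]big_seq; apply: ler_sum => m md.
    have sm := size_in_dropocc md.
    apply: le_trans (bf m p x) _; rewrite ler_pM ?mulr_ge0 ?exprn_ge0 ?Fp_ge0//.
      by rewrite ler_wpM2l// ler_weXn2l// leq_add2l.
    by rewrite ler_wpM2l ?Fp_ge0// Fp_mono.
  rewrite big_const_seq count_predT iter_addr_0 -[leLHS]mulr_natr.
  apply: (@le_trans _ _ (C * A ^+ N * FF * 2 ^+ N)).
    have CAF0 : 0 <= C * A ^+ N * FF by rewrite mulr_ge0// mulr_ge0// exprn_ge0.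
    rewrite ler_wpM2l// -natrX ler_nat.
    rewrite (leq_trans (size_dropocc i l))// (leq_trans (ltnW (ltn_expl (size l) (ltnSn 1))))//.
    by rewrite leq_pexp2l// leq_addl.
  rewrite [leLHS](_ : _ = C * (2 * A) ^+ N * FF); last by rewrite exprMn; ring.
  rewrite ler_wpM2r// ler_wpM2l// lerXn2r ?nnegrE ?mulr_ge0// ler_wpM2l//.
  by rewrite ler_peMl.
apply: (@le_trans _ _ (`|x| ^+ p * (`|x 0 i * pds l f x| +
    `|\sum_(m <- dropocc i l) pds m f x|))).
  by rewrite ler_wpM2l ?exprn_ge0// ler_normD.
rewrite mulrDr; apply: le_trans (lerD T1 T2) _.
by rewrite le_eqVlt; apply/orP; left; apply/eqP; ring.
Qed.

Lemma gsr_mulx r1 r2 f i : 0 <= r1 -> 0 <= r2 -> gsr r1 r2 f -> gsr r1 r2 (mulx i f).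
Proof.
move=> r10 r20 [sf [C [A [C0 A1 bf]]]]; split; first exact: smoothr_mulx.
have A0 : 0 <= A by exact: le_trans A1.
have q1 : 1 <= 2 `^ r2 :> R by exact: two_powR_ge1.
exists (C * (A * 2 `^ r2 + 1)), (2 * (2 `^ r2 * A)); split.
- by rewrite mulr_ge0// addr_ge0// mulr_ge0 ?powR_ge0.
- by rewrite -[leLHS]mulr1 ler_pM ?ler1n// -[leLHS]mulr1 ler_pM.
exact: gsbound_mulx.
Qed.

Lemma gsr_xw r1 r2 f w : 0 <= r1 -> 0 <= r2 -> gsr r1 r2 f ->
  gsr r1 r2 (fun x => xw w x * f x).
Proof.
move=> r10 r20 gf; elim: w => [|i w IH].
  by rewrite (_ : (fun x => _) = f)//; apply/funext => x; rewrite /xw big_nil mul1r.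
rewrite (_ : (fun x => _) = mulx i (fun x => xw w x * f x)); first exact: gsr_mulx.
by apply/funext => x; rewrite /mulx xw_cons mulrA.
Qed.

(** The derivatives of order [m] in the scale multiply the wavelet by
    monomials of degree [m], and all of them need common constants. *)
Lemma gsbound_xw r1 r2 f m : 0 <= r1 -> 0 <= r2 -> gsr r1 r2 f ->
  exists C A : R, [/\ 0 <= C, 1 <= A &
    forall w, size w = m -> gsbound (fun x => xw w x * f x) C A r1 r2].
Proof.
move=> r10 r20 gf; have [sf [C0 [A0 [C00 A01 bf]]]] := gf.
elim: m => [|m [C [A [Cp A1 H]]]].
  exists C0, A0; split => // w /size0nil ->.
  by rewrite (_ : (fun x => _) = f)//; apply/funext => x; rewrite /xw big_nil mul1r.
have q1 : 1 <= 2 `^ r2 :> R by exact: two_powR_ge1.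
exists (C * (A * 2 `^ r2 + 1)), (2 * (2 `^ r2 * A)); split.
- by rewrite mulr_ge0// addr_ge0// mulr_ge0 ?powR_ge0// (le_trans ler01).
- by rewrite -[leLHS]mulr1 ler_pM ?ler1n// -[leLHS]mulr1 ler_pM.
case=> // i w [sw].
rewrite (_ : (fun x => _) = mulx i (fun x => xw w x * f x)); last first.
  by apply/funext => x; rewrite /mulx xw_cons mulrA.
apply: gsbound_mulx => //; last exact: H.
exact: (gsr_xw w r10 r20 gf).1.
Qed.

Lemma gsr_decay r1 r2 f : gsr r1 r2 f ->
  exists C A, [/\ 0 <= C, 1 <= A & decay f C A r2].
Proof.
move=> [_ [C [A [C0 A1 bf]]]]; exists C, A; split=> // p x.
by have := bf [::] p x; rewrite addn0 Fp0 mulr1.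
Qed.

Lemma gsr_smooth r1 r2 f : gsr r1 r2 f -> smoothr f. Proof. by case. Qed.

Lemma gsr_continuous r1 r2 f : gsr r1 r2 f -> continuous f.
Proof. by case=> sf _; exact: smoothr_continuous. Qed.

Lemma gsr_weight r1 r2 f : 0 <= r2 -> gsr r1 r2 f ->
  exists2 C, 0 <= C & forall x, `|f x| <= C * weight x.
Proof.
move=> r20 /gsr_decay[C [A [C0 A1 df]]]; exists (C * @cweight R n A r2).
  by rewrite mulr_ge0// (le_trans ler01)// cweight_ge1.
move=> x; have := decay_weight 0 x C0 A1 r20 df.
by rewrite !expr0 Fp0 mul1r !mulr1; apply.
Qed.

Lemma gsr_integrable r1 r2 f : 0 <= r2 -> gsr r1 r2 f -> rintegrable f.
Proof.
move=> r20 gf; have [C C0 fC] := gsr_weight r20 gf.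
exact: wle_rintegrable (continuous_rmeas (gsr_continuous gf)) fC.
Qed.

End GelfandShilovReal.

(** * Differentiation under the integral and integration by parts *)

Section Under.
Context {R : realType} {n : nat}.
Local Notation rV := 'rV[R]_n.
Implicit Types (f g v : rV -> R) (l w : seq 'I_n) (i j : 'I_n) (x b : rV) (a : R).

(** Translates of a given function are dominated only locally in the
    parameter, whence the domination on a unit ball around [s0]. *)
Lemma is_derive_rint (F F' : R -> rV -> R) (s0 : R) (G : rV -> R) :
  (forall s, rintegrable (F s)) ->
  (forall z (s : R), is_derive s 1 (fun s => F s z) (F' s z)) ->
  (forall s z, `|s - s0| < 1 -> `|F' s z| <= G z) -> rintegrable G ->
  is_derive s0 1 (fun s => rint (F s)) (rint (F' s0)).
Proof.
move=> iF dF FG iG.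
have I0 : `]s0 - 1, s0 + 1[%classic s0.
  by rewrite /= in_itv/= ltrBlDr ltrDl ltr01.
have G0 z : 0 <= G z by apply: le_trans (FG s0 z _); rewrite ?normr_ge0// subrr normr0.
pose f (s : R) (t : n.-tuple (measurableTypeR R)) := F s (rowt t).
have d1f s t : partial1of2 f s t = F' s (rowt t).
  by rewrite partial1of2E; have [_ <-] := dF (rowt t) s.
have intf s : `]s0 - 1, s0 + 1[%classic s ->
  (@lebesgue_tuple R n).-integrable setT (EFin \o f s) by move=> _; exact: iF.
have derf s t : `]s0 - 1, s0 + 1[%classic s -> [set: n.-tuple (measurableTypeR R)] t -> derivable (f ^~ t) s 1.
  by move=> _ _; have [] := dF (rowt t) s.
have Gub s t : `]s0 - 1, s0 + 1[%classic s -> [set: n.-tuple (measurableTypeR R)] t ->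
    `|partial1of2 f s t| <= G (rowt t).
  rewrite /= in_itv/= d1f => /andP[s1 s2] _; apply: FG.
  by rewrite ltr_distl s1 s2.
have Gt0 (t : n.-tuple (measurableTypeR R)) : 0 <= G (rowt t) by exact: G0.
have dd := derivable_under_integral measurableT I0 intf derf Gt0 iG Gub.
have dv := differentiation_under_integral measurableT I0 intf derf Gt0 iG Gub.
apply: DeriveDef; first exact: dd.
rewrite -derive1E; apply: (etrans dv).
by apply: eq_Rintegral => t _; exact: d1f.
Qed.

(** Provides the domination in [rint_derive]. *)
Lemma weight_translate i (s : R) x : `|s| <= 1 ->
  weight (x + s *: @rvdir R n i) <= 3 ^+ n * weight x.
Proof.
move=> s1; rewrite /weight (_ : 3 ^+ n = \prod_(k < n) (3 : R)); last first.
  by rewrite prodr_const card_ord.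
rewrite -big_split/=; apply: ler_prod => k _.
have o0 (y : R) : 0 < oneDsqr y by rewrite (lt_le_trans ltr01)// oneDsqr_ge1.
rewrite invr_ge0 ltW ?o0//= ler_pdivlMr// mulrC ler_pdivrMr//.
rewrite !mxE eqxx /= /oneDsqr.
have : (s * (k == i)%:R) ^+ 2 <= 1.
  case: (k == i); rewrite ?mulr1 ?mulr0 ?expr0n// ?ler01//.
  by rewrite -real_normK ?num_real// expr_le1.
set y := x 0 k; set d := s * _ => d1.
rewrite -subr_ge0 (_ : _ - _ = (2 * d + y) ^+ 2 + (y + d) ^+ 2 + 2 * (1 - d ^+ 2) + 0 * y); last by ring.
by rewrite mul0r addr0 !addr_ge0 ?sqr_ge0// mulr_ge0// subr_ge0.
Qed.

(** Integration by parts: a derivative integrates to zero because the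
    integral is invariant under translations. *)
Lemma rint_derive f f' C i : rintegrable f -> 0 <= C ->
  (forall x, is_derive x (@rvdir R n i) f (f' x)) ->
  (forall x, `|f' x| <= C * weight x) -> rint f' = 0.
Proof.
move=> fi C0 df fC.
have iT s : rintegrable (fun x => f (x + s *: @rvdir R n i)).
  have := rintegrable_affine (s *: @rvdir R n i) (oner_neq0 R) fi.
  by under eq_fun do rewrite scale1r addrC.
have cst s : rint (fun x => f (x + s *: @rvdir R n i)) = rint f.
  have := rint_affine (s *: @rvdir R n i) (oner_neq0 R) fi.
  rewrite normr1 invr1 expr1n mul1r => <-; congr rint.
  by apply/funext => x; rewrite scale1r addrC.
have := @is_derive_rint (fun s x => f (x + s *: @rvdir R n i))
  (fun s x => f' (x + s *: @rvdir R n i)) 0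
  (fun x => C * 3 ^+ n * weight x) iT _ _ _.
rewrite (_ : (fun s => rint _) = fun=> rint f); last by apply/funext => s; exact: cst.
have E : (fun x => f' (x + 0 *: @rvdir R n i)) = f'.
  by apply/funext => x; rewrite scale0r addr0.
rewrite E => H; have {}H := H _ _ _.
have [|||_ <-] := H.
- by move=> z s; have [d <-] := df (z + s *: @rvdir R n i); exact: is_derive_line.
- move=> s z; rewrite subr0 => s1; apply: le_trans (fC _) _.
  by rewrite -mulrA ler_wpM2l// weight_translate// ltW.
- exact/rintegrableZ/rintegrable_weight.
by have [] := is_derive_cst (rint f) (0 : R) 1.
Qed.

Lemma rint_pd r1 r2 f i : 0 <= r1 -> 0 <= r2 -> gsr r1 r2 f -> rint (pd i f) = 0.
Proof.
move=> r10 r20 gf; have [C C0 fC] := gsr_weight r20 (gsr_pd i r10 r20 gf).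
apply: (rint_derive (gsr_integrable r20 gf) C0 _ fC) => x.
exact: smoothr_is_derive (gsr_smooth gf).
Qed.

(** It is enough that differentiation preserves the span of the monomials, on
    which all moments vanish. *)
Lemma pd_xw i w : exists ws : seq (seq 'I_n), forall x,
  is_derive x (@rvdir R n i) (xw w) (\sum_(m <- ws) xw m x).
Proof.
elim: w => [|j w [ws IH]].
  exists [::] => x; rewrite big_nil (_ : xw [::] = fun=> 1); first exact: is_derive_cst.
  by apply/funext => y; rewrite /xw big_nil.
exists ((if j == i then [:: w] else [::]) ++ [seq j :: m | m <- ws]) => x.
rewrite (_ : xw (j :: w) = (fun x : rV => x 0 j) * xw w); last first.
  by apply/funext => y; rewrite xw_cons.
have := is_deriveM (is_derive_coord j i x) (IH x); congr (is_derive _ _ _ _).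
rewrite big_cat big_map/= addrC; congr (_ + _).
  by rewrite /GRing.scale/= mulr_sumr; apply: eq_bigr => m _; rewrite xw_cons.
by rewrite /GRing.scale/=; case: (j == i); rewrite ?big_seq1 ?big_nil ?mulr1 ?mulr0.
Qed.

(** Integration by parts moves the derivative onto the monomial. *)
Lemma moment0_pd r1 r2 f i : 0 <= r1 -> 0 <= r2 -> gsr r1 r2 f -> moment0 f ->
  moment0 (pd i f).
Proof.
move=> r10 r20 gf f0 w.
have gw := gsr_xw w r10 r20 gf.
have [ws dws] := pd_xw i w.
have E : pd i (fun x => xw w x * f x) =
    fun x => xw w x * pd i f x + \sum_(m <- ws) xw m x * f x.
  apply/funext => x.
  have [_ dE] := is_deriveM (dws x) (smoothr_is_derive i x (gsr_smooth gf)).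
  apply: (etrans dE).
  by rewrite /GRing.scale/= mulr_sumr; congr (_ + _); apply: eq_bigr => m _; rewrite mulrC.
have := rint_pd i r10 r20 gw; rewrite E.
have im m : rintegrable (fun x => xw m x * f x).
  exact: gsr_integrable r20 (gsr_xw m r10 r20 gf).
rewrite rintD; last 2 first.
- exact: gsr_integrable r20 (gsr_xw w r10 r20 (gsr_pd i r10 r20 gf)).
- exact: rintegrable_sum.
by rewrite rint_sum// big1 ?addr0// => m _; exact: f0.
Qed.

Lemma moment0_pds r1 r2 f l : 0 <= r1 -> 0 <= r2 -> gsr r1 r2 f -> moment0 f ->
  moment0 (pds l f).
Proof.
move=> r10 r20 gf f0; elim: l => //= i l IH.
exact: moment0_pd r10 r20 (gsr_pds l r10 r20 gf) IH.
Qed.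

Lemma moment0_xw f w : moment0 f -> moment0 (fun x => xw w x * f x).
Proof.
move=> f0 w'; rewrite -(f0 (w' ++ w)); congr rint; apply/funext => x.
by rewrite /xw big_cat mulrA.
Qed.

End Under.

(** * Joint decay in scale and translation *)

Section ScaleAverageDecay.
Context {R : realType} {n : nat}.
Local Notation rV := 'rV[R]_n.
Implicit Types (f g v : rV -> R) (x b z : rV) (a : R).

Lemma stretched_ge (X Y c tau : R) : 0 < tau -> 0 <= c -> 0 <= Y -> c * Y <= X ->
  c `^ tau^-1 * Y `^ tau^-1 <= X `^ tau^-1.
Proof.
move=> tau0 c0 Y0 cYX; rewrite -powRM//; apply: ge0_ler_powR => //.
- by rewrite invr_ge0 ltW.
- by rewrite nnegrE mulr_ge0.
- by rewrite nnegrE (le_trans _ cYX)// mulr_ge0.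
Qed.

Lemma expRN_le (x y : R) : x <= y -> expR (- y) <= expR (- x).
Proof. by move=> xy; rewrite ler_expR lerN2. Qed.

(** Large translations at moderate scales: either [b + a z] has norm at least
    [`|b| / 2] and [v] is small there, or [z] has norm at least [`|b| / (2 a)],
    which is at least [`|b| `^ (r / t) / 2] below the threshold for [a], and
    [g] is of the order of [exp (- `|z| `^ (1 / r))] at such points. *)
Lemma wavI_tail (C A q r t : R) : 0 <= C -> 1 <= A -> 0 < q -> 0 < r -> q <= t -> r < t ->
  exists D eps : R, [/\ 0 <= D, 0 < eps &
  forall (K : R) v g b a, 0 <= K -> continuous v -> decay v K A q ->
    continuous g -> decay g C A r -> 0 < a -> 1 <= `|b| ->
    a <= `|b| `^ ((t - r) / t) ->
    `|wavI v g b a| <= K * D * expR (- (eps * `|b| `^ t^-1))].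
Proof.
move=> C0 A1 q0 r0 qt rt.
have A0 : 0 < A by exact: lt_le_trans A1.
have t0 : 0 < t by exact: lt_trans rt.
have [cw Ecw] : exists cw, @cweight R n A r = cw by eexists.
have cw0 : 0 <= cw by rewrite -Ecw (le_trans ler01)// cweight_ge1// ltW.
have [A' EA'] : exists A', 2 `^ r * A = A' by eexists.
have A'0 : 0 < A' by rewrite -EA' mulr_gt0// powR_gt0.
(* The rates that [exp_decay_of_pow] gives for [v] and for [g] at norms at
   least [`|b| / 2] and [`|b| `^ (r / t) / 2]. *)
pose e1 := q / 2 * (2 * A)^-1 `^ q^-1.
pose e2 := r / 2 * (2 * A')^-1 `^ r^-1.
have e10 : 0 < e1 by rewrite mulr_gt0 ?divr_gt0// powR_gt0// invr_gt0 mulr_gt0.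
have e20 : 0 < e2 by rewrite mulr_gt0 ?divr_gt0// powR_gt0// invr_gt0 mulr_gt0.
pose eps := Num.min e1 e2.
have eps0 : 0 < eps by rewrite lt_min e10.
pose D := C * cw * (2 `^ q * 2 `^ r).
have D0 : 0 <= D by rewrite !mulr_ge0 ?powR_ge0.
exists (D * pi ^+ n), eps; split.
- by rewrite mulr_ge0// exprn_ge0// pi_ge0.
- exact: eps0.
move=> K v g b a K0 cv dv cg dg a0 b1 ab.
have iI := wavI_integrable b a K0 C0 A1 (ltW r0) (continuous_rmeas cv)
  (fun x => decay_bound x dv) (continuous_rmeas cg) dg.
pose E := expR (- (eps * `|b| `^ t^-1)).
have E0 : 0 <= E by exact: expR_ge0.
rewrite [leRHS](_ : _ = K * D * E * pi ^+ n); last by rewrite /E; ring.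
apply: rint_wle => // z; rewrite normrM.
have bt0 : 0 <= `|b| `^ t^-1 by exact: powR_ge0.
have gz : `|g z| <= C * cw * weight z.
  by have := decay_weight 0 z C0 A1 (ltW r0) dg; rewrite Ecw !expr0 Fp0 mul1r !mulr1; apply.
have CC1 : C * cw <= C * cw * (2 `^ q * 2 `^ r).
  by rewrite ler_peMr ?mulr_ge0// -[leLHS]mulr1 ler_pM// two_powR_ge1// ltW.
have [big|small] := leP (`|b| / 2) `|b + a *: z|.
  have H1 := exp_decay_of_pow q0 A0 (normr_ge0 _) (normr_ge0 (v (b + a *: z)))
    (fun m => dv m (b + a *: z)).
  have H2 : `|v (b + a *: z)| <= K * 2 `^ q * E.
    apply: le_trans H1 _; rewrite ler_wpM2l ?mulr_ge0 ?powR_ge0//.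
    apply: expRN_le; apply: (@le_trans _ _ (e1 * `|b| `^ q^-1)).
      rewrite ler_pM ?(ltW eps0)//; first by rewrite /eps ge_min lexx.
      by rewrite ler_powR// lef_pV2// posrE.
    rewrite /e1 -mulrA ler_wpM2l//; first by rewrite divr_ge0// ltW.
    apply: stretched_ge => //; first by rewrite invr_ge0 mulr_ge0// ltW.
    by rewrite invfM mulrAC ler_wpM2r ?invr_ge0 ?(ltW A0)// mulrC.
  apply: le_trans (ler_pM _ _ H2 gz) _ => //.
  rewrite /D [leLHS](_ : _ = K * E * weight z * (C * cw * 2 `^ q)); last by ring.
  rewrite [leRHS](_ : _ = K * E * weight z * (C * cw * 2 `^ q * 2 `^ r)); last by ring.
  rewrite ler_wpM2l ?mulr_ge0 ?weight_ge0// ler_peMr ?mulr_ge0 ?powR_ge0//.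
  by rewrite two_powR_ge1// ltW.
have zb : `|b| / (2 * a) <= `|z|.
  rewrite ler_pdivrMr ?mulr_gt0//.
  have : `|b| <= `|b + a *: z| + a * `|z|.
    rewrite -[X in `|X| <= _](addrK (a *: z)) (le_trans (ler_normB _ _))//.
    by rewrite normrZ (gtr0_norm a0).
  move=> H; have : `|b| <= `|b| / 2 + a * `|z| by apply: le_trans H _; rewrite lerD2r ltW.
  by rewrite (mulrC _ (2 * a)) -mulrA; move: `|b| (a * `|z|) => y w; lra.
have b0 : 0 < `|b| by exact: lt_le_trans b1.
have zb' : 2^-1 * `|b| `^ (r / t) <= `|z|.
  apply: le_trans zb; rewrite invfM mulrCA ler_wpM2l//.
  rewrite ler_pdivlMr//; apply: le_trans (ler_wpM2l (powR_ge0 _ _) ab) _.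
  rewrite -powRD; last by apply/implyP => _; rewrite gt_eqF.
  by rewrite -mulrDl subrKC divff ?gt_eqF// powRr1.
have wz : 0 < weight z by exact: weight_gt0.
have H1 m : `|z| ^+ m * (`|g z| / weight z) <= C * cw * A' ^+ m * Fp m r.
  rewrite mulrA ler_pdivrMr//; have := decay_weight m z C0 A1 (ltW r0) dg; rewrite Ecw EA'; exact.
have y0 : 0 <= `|g z| / weight z by rewrite divr_ge0// weight_ge0.
have {}H1 := exp_decay_of_pow r0 A'0 (normr_ge0 z) y0 H1.
have H2 : `|g z| <= C * cw * 2 `^ r * E * weight z.
  rewrite -ler_pdivrMr//; apply: le_trans H1 _.
  rewrite ler_wpM2l ?mulr_ge0 ?powR_ge0//; apply: expRN_le.
  apply: (@le_trans _ _ (e2 * `|b| `^ t^-1)).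
    by rewrite ler_wpM2r// /eps ge_min lexx orbT.
  rewrite /e2 -mulrA ler_wpM2l//; first by rewrite divr_ge0// ltW.
  rewrite (_ : t^-1 = r / t * r^-1); last by field; rewrite !gt_eqF.
  rewrite [X in _ * X]powRrM; apply: stretched_ge => //.
    by rewrite invr_ge0 mulr_ge0// ltW.
  by rewrite invfM mulrAC ler_wpM2r ?invr_ge0 ?(ltW A'0).
apply: le_trans (ler_pM _ _ (decay_bound (b + a *: z) dv) H2) _ => //.
rewrite /D [leLHS](_ : _ = K * E * weight z * (C * cw * 2 `^ r)); last by ring.
rewrite [leRHS](_ : _ = K * E * weight z * (C * cw * 2 `^ r * 2 `^ q)); last by ring.
rewrite ler_wpM2l ?mulr_ge0 ?weight_ge0// ler_peMr ?mulr_ge0 ?powR_ge0//.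
by rewrite two_powR_ge1// ltW.
Qed.

(** The constants are explicit because the bounds below have to be uniform over
    all derivatives of a given function. *)
Definition admissible (v : rV -> R) (K A r1 r2 : R) : Prop :=
  [/\ smoothr v, decay v K A r2, regular v K A r1 & moment0 v].

Lemma geo_le (K K' E E' F : R) m : 0 <= K <= K' -> 0 <= E <= E' -> 0 <= F ->
  K * E ^+ m * F <= K' * E' ^+ m * F.
Proof.
move=> /andP[K0 KK] /andP[E0 EE] F0; rewrite ler_wpM2r// ler_pM ?exprn_ge0//.
by rewrite lerXn2r ?nnegrE// (le_trans E0).
Qed.

Section bounds.
Variables (C A q r rho s : R).
Hypotheses (n0 : (0 < n)%N) (C0 : 0 <= C) (A1 : 1 <= A) (q1 : 1 < q) (r1 : 1 < r)
  (rho0 : 0 < rho) (s0 : 0 < s).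
Let t := q + rho + r - 1.

Let A0 : 0 <= A. Proof. exact: le_trans A1. Qed.
Let q0 : 0 < q. Proof. exact: lt_trans q1. Qed.
Let r0 : 0 < r. Proof. exact: lt_trans r1. Qed.

Let scale_ge1 (p : R) : 0 < p -> 1 <= n%:R * A * (2 `^ p * A).
Proof.
move=> p0; rewrite -[leLHS]mulr1 ler_pM// -[leLHS]mulr1 ler_pM//.
  by rewrite ler1n.
exact/two_powR_ge1/ltW.
Qed.

Lemma wavI_smallE : exists D E : R, [/\ 0 <= D, 1 <= E &
  forall K v g b a m, 0 <= K -> admissible v K A s q -> admissible g C A rho r -> 0 < a ->
  a ^- m * `|wavI v g b a| <= K * D * E ^+ m * Fp m (s + r - 1)].
Proof.
exists (C * @cweight R n A r * pi ^+ n), (n%:R * A * (2 `^ r * A)); split.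
- by rewrite mulr_ge0 ?exprn_ge0 ?pi_ge0// mulr_ge0// (le_trans ler01)// cweight_ge1// ltW.
- exact: scale_ge1.
move=> K v g b a m K0 [sv dv rv v0] [sg dg rg g0] a0.
apply: wavI_small => //; [exact: ltW|exact: ltW|exact: smoothr_continuous].
Qed.

Lemma wavI_largeE : exists D E : R, [/\ 0 <= D, 1 <= E &
  forall K v g b a m, 0 <= K -> admissible v K A s q -> admissible g C A rho r -> 0 < a ->
  a ^+ m * `|wavI v g b a| <= K * D * E ^+ m * Fp m (t - r)].
Proof.
pose D1 := C * @cweight R n A r * pi ^+ n.
pose D2 := C * @cweight R n A q * pi ^+ n.
have D10 : 0 <= D1.
  by rewrite mulr_ge0 ?exprn_ge0 ?pi_ge0// mulr_ge0// (le_trans ler01)// cweight_ge1// ltW.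
have D20 : 0 <= D2.
  by rewrite mulr_ge0 ?exprn_ge0 ?pi_ge0// mulr_ge0// (le_trans ler01)// cweight_ge1// ltW.
have E1 := scale_ge1 q0; have E0 := le_trans ler01 E1.
have tr : t - r = q + rho - 1 by rewrite /t; ring.
have tr0 : 0 <= t - r by rewrite tr; move: q1 rho0; lra.
exists (D1 + D2), (n%:R * A * (2 `^ q * A)); split => //; first exact: addr_ge0.
move=> K v g b a m K0 [sv dv rv v0] [sg dg rg g0] a0.
have mv := continuous_rmeas (smoothr_continuous sv).
have [a1|/ltW a1] := leP 1 a.
  apply: le_trans (wavI_large b m K0 C0 A1 (ltW r0) (ltW rho0) (ltW q0) a1
    (smoothr_continuous sv) dv v0 sg rg dg) _.
  rewrite -tr -/D2.
  apply: geo_le; rewrite ?Fp_ge0 ?lexx ?andbT//.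
  by rewrite mulr_ge0//= ler_wpM2l// lerDr.
apply: (@le_trans _ _ (K * D1)).
  apply: le_trans (wavI_le b a K0 C0 A1 (ltW r0) mv (fun x => decay_bound x dv)
    (continuous_rmeas (smoothr_continuous sg)) dg).
  by rewrite ler_piMl// exprn_ile1// ltW.
apply: (@le_trans _ _ (K * (D1 + D2))); first by rewrite ler_wpM2l// lerDl.
rewrite -[leLHS]mulr1 -[leRHS]mulrA ler_wpM2l ?mulr_ge0 ?addr_ge0//.
by rewrite -[leLHS]mulr1 ler_pM// ?exprn_ege1// Fp_ge1.
Qed.

(** Below the threshold for the scale this is [wavI_tail]; above it, the decay
    in [a] of [wavI_largeE], which is exponential in [a `^ (1 / (t - r))], is
    already exponential in [`|b| `^ (1 / t)]. *)
Lemma wavI_transE : exists D E : R, [/\ 0 <= D, 1 <= E &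
  forall K v g b a m, 0 <= K -> admissible v K A s q -> admissible g C A rho r -> 0 < a ->
  `|b| ^+ m * `|wavI v g b a| <= K * D * E ^+ m * Fp m t].
Proof.
have qt : q <= t by rewrite /t; move: rho0 r1; lra.
have rt : r < t by rewrite /t; move: rho0 q1; lra.
have t0 : 0 < t by exact: lt_trans rt.
have tr0 : 0 < t - r by rewrite subr_gt0.
have [D1 [E1 [D10 E11 H1]]] := wavI_largeE.
have [D2 [eps2 [D20 eps20 H2]]] := wavI_tail C0 A1 q0 r0 qt rt.
have E10 : 0 < E1 by exact: lt_le_trans E11.
have [D3 ED3] : exists D3, D1 * 2 `^ (t - r) = D3 by eexists.
have D30 : 0 <= D3 by rewrite -ED3 mulr_ge0// powR_ge0.
have D13 : D1 <= D3 by rewrite -ED3 ler_peMr// two_powR_ge1// ltW.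
have [eps1 Ee1] : exists e, (t - r) / 2 * E1^-1 `^ (t - r)^-1 = e by eexists.
have eps10 : 0 < eps1 by rewrite -Ee1 mulr_gt0 ?divr_gt0// powR_gt0// invr_gt0.
pose X1 := (t / eps1) `^ t; pose X2 := (t / eps2) `^ t.
have X10 : 0 <= X1 by exact: powR_ge0.
have X20 : 0 <= X2 by exact: powR_ge0.
exists (D3 + D2), (1 + X1 + X2); split.
- exact: addr_ge0.
- by rewrite -addrA lerDl addr_ge0.
move=> K v g b a m K0 Hv Hg a0.
have D0 : 0 <= D3 + D2 by exact: addr_ge0.
have XX0 : 0 <= 1 + X1 + X2 by rewrite !addr_ge0.
have [b1|/ltW b1] := leP 1 `|b|; last first.
  apply: (@le_trans _ _ (K * D1)).
    have := H1 K v g b a 0%N K0 Hv Hg a0; rewrite !expr0 Fp0 mul1r !mulr1.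
    by apply: le_trans; rewrite ler_piMl// exprn_ile1.
  apply: (@le_trans _ _ (K * (D3 + D2))).
    by rewrite ler_wpM2l// (le_trans D13)// lerDl.
  rewrite -[leLHS]mulr1 -[leRHS]mulrA ler_wpM2l ?mulr_ge0//.
  rewrite -[leLHS]mulr1 ler_pM// ?exprn_ege1 ?Fp_ge1 ?(ltW t0)//.
  by rewrite -addrA lerDl addr_ge0.
have bm0 : 0 <= `|b| ^+ m by rewrite exprn_ge0.
(* The exponential bound [|I| <= K D exp (- eps |b|^(1/t))] in both regimes. *)
have fin D eps : 0 <= D <= D3 + D2 -> 0 < eps -> (t / eps) `^ t <= 1 + X1 + X2 ->
    `|wavI v g b a| <= K * D * expR (- (eps * `|b| `^ t^-1)) ->
    `|b| ^+ m * `|wavI v g b a| <= K * (D3 + D2) * (1 + X1 + X2) ^+ m * Fp m t.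
  move=> /andP[Dp DD] eps0 XX H; apply: le_trans (ler_wpM2l bm0 H) _.
  rewrite mulrCA; apply: le_trans (ler_wpM2l _ (pow_exp_decay m t0 eps0 (normr_ge0 b))) _.
    by rewrite mulr_ge0.
  rewrite mulrA; apply: geo_le; rewrite ?Fp_ge0 ?powR_ge0 ?XX// mulr_ge0//=.
  by rewrite ler_wpM2l.
have [ab|/ltW ab] := leP a (`|b| `^ ((t - r) / t)).
  have [sv dv _ _] := Hv; have [sg dg _ _] := Hg.
  apply: (fin D2 eps2) => //; rewrite ?D20 ?lerDr//.
    by rewrite ?lerDr addr_ge0.
  by apply: H2 => //; exact: smoothr_continuous.
apply: (fin D3 eps1) => //; rewrite ?D30 ?lerDl//.
  by rewrite -/X1 addrAC lerDr addr_ge0.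
have H := exp_decay_of_pow tr0 E10 (ltW a0) (normr_ge0 (wavI v g b a))
  (fun m => H1 K v g b a m K0 Hv Hg a0).
apply: le_trans H _; rewrite -ED3 mulrA; apply: ler_wpM2l.
  by rewrite !mulr_ge0 ?powR_ge0.
apply: expRN_le; rewrite -Ee1 -[leLHS]mulrA ler_wpM2l//; first by rewrite divr_ge0// ltW.
rewrite (_ : t^-1 = (t - r) / t * (t - r)^-1); last by field; rewrite !gt_eqF.
rewrite [X in _ * X]powRrM; apply: stretched_ge => //.
- by rewrite invr_ge0 ltW.
- by rewrite mulrC ler_wpM2r// invr_ge0 ltW.
Qed.

Lemma japanese_le b k : japanese b ^+ k <= (2 * n.+1%:R) ^+ k * (1 + `|b| ^+ k).
Proof.
have H : japanese b <= n.+1%:R * (1 + `|b|).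
  rewrite /japanese -[leRHS]ger0_norm ?mulr_ge0 ?addr_ge0// -sqrtr_sqr ler_wsqrtr//.
  rewrite /enorm sqr_sqrtr; last by apply: sumr_ge0 => i _; rewrite -expr2 sqr_ge0.
  have : dotv b b <= n%:R * `|b| ^+ 2.
    rewrite /dotv (le_trans (ler_sum _ (_ : forall i, _ -> _ <= `|b| ^+ 2)))//.
      move=> i _; rewrite -expr2 -real_normK ?num_real//.
      by rewrite lerXn2r ?nnegrE// normv_coord.
    by rewrite sumr_const card_ord mulr_natl.
  move=> /(lerD (lexx 1)) /le_trans; apply.
  have n1 : 1 <= n.+1%:R :> R by rewrite ler1n.
  have nn : n%:R <= n.+1%:R :> R by rewrite ler_nat.
  have := normr_ge0 b; move: `|b| (n.+1%:R : R) (n%:R : R) n1 nn => y N M N1 MN y0.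
  have : N <= N ^+ 2 by rewrite expr2 ler_peMl// (le_trans ler01).
  by move=> NN; rewrite exprMn; nra.
apply: (@le_trans _ _ ((n.+1%:R * (1 + `|b|)) ^+ k)).
  by rewrite lerXn2r ?nnegrE ?sqrtr_ge0// mulr_ge0 ?addr_ge0.
rewrite !exprMn (mulrC (2 ^+ k)) -mulrA ler_wpM2l ?exprn_ge0//.
exact: expr_1D_le.
Qed.

(** Decay in two quantities at once from decay in each of them: the square of
    the left-hand side is the product of those of the hypotheses. *)
Lemma split_decay (X Y y K F G E : R) (l k : nat) : 0 <= X -> 0 <= Y -> 0 <= y -> 0 <= K ->
  0 <= F -> 0 <= G -> 0 <= E ->
  X ^+ l.*2 * y <= K * E ^+ l.*2 * F ^+ 2 -> Y ^+ k.*2 * y <= K * E ^+ k.*2 * G ^+ 2 ->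
  X ^+ l * Y ^+ k * y <= K * E ^+ (l + k) * (F * G).
Proof.
move=> X0 Y0 y0 K0 F0 G0 E0 HX HY.
rewrite -ler_sqr ?nnegrE ?mulr_ge0 ?exprn_ge0//.
rewrite [leLHS](_ : _ = (X ^+ l.*2 * y) * (Y ^+ k.*2 * y)); last first.
  by rewrite !exprMn -!exprM !muln2; ring.
apply: le_trans (ler_pM _ _ HX HY) _; rewrite ?mulr_ge0 ?exprn_ge0//.
rewrite le_eqVlt; apply/orP; left; apply/eqP.
by rewrite !exprMn -exprM muln2 doubleD exprD; ring.
Qed.

Lemma Fp_double m (p : R) : 0 <= p -> Fp m.*2 p <= (2 `^ p) ^+ m.*2 * Fp m p ^+ 2.
Proof. by move=> p0; rewrite -addnn expr2; exact: Fp_add. Qed.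

(** The decay in the scale, small or large, is paired with the decay in the
    translation by [split_decay]; the values 0 and [k] of the exponent of [`|b|]
    give the two terms that bound [japanese b ^+ k]. *)
Lemma wavI_decay : exists D E : R, [/\ 0 <= D, 1 <= E &
  forall K v g b a k l1 l2, 0 <= K -> admissible v K A s q -> admissible g C A rho r -> 0 < a ->
  (a ^+ l1 + a ^- l2) * japanese b ^+ k * `|wavI v g b a| <=
  K * D * E ^+ (k + l1 + l2) * (Fp k t * Fp l1 (t - r) * Fp l2 (s + r - 1))].
Proof.
have [D1 [E1 [D10 E11 H1]]] := wavI_largeE.
have [D2 [E2 [D20 E21 H2]]] := wavI_smallE.
have [D3 [E3 [D30 E31 H3]]] := wavI_transE.
have E10 := le_trans ler01 E11; have E20 := le_trans ler01 E21; have E30 := le_trans ler01 E31.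
have tr0 : 0 <= t - r by rewrite /t; move: rho0 q1; lra.
have sr0 : 0 <= s + r - 1 by move: s0 r1; lra.
have t0 : 0 <= t by rewrite /t; move: rho0 q1 r1; lra.
pose P := 2 `^ t + 2 `^ (t - r) + 2 `^ (s + r - 1).
have P0 : 0 <= P by rewrite !addr_ge0 ?powR_ge0.
pose E := (E1 + E2 + E3) * P.
pose D := D1 + D2 + D3.
have E0 : 0 <= E by rewrite mulr_ge0// !addr_ge0.
have D0 : 0 <= D by rewrite !addr_ge0.
have EP e p : 0 <= e <= E1 + E2 + E3 -> 0 <= 2 `^ p <= P -> 0 <= e * 2 `^ p <= E.
  by move=> /andP[e0 ee] /andP[p0 pp]; rewrite mulr_ge0//= ler_pM.
have dbl (X y K d e p : R) m : 0 <= p -> 0 <= K -> 0 <= d <= D -> 0 <= e <= E1 + E2 + E3 ->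
    2 `^ p <= P -> X ^+ m.*2 * y <= K * d * e ^+ m.*2 * Fp m.*2 p ->
    X ^+ m.*2 * y <= K * D * E ^+ m.*2 * Fp m p ^+ 2.
  move=> p0 K0 /andP[d0 dD] ee pP /le_trans; apply.
  have e0 : 0 <= e by case/andP: ee.
  apply: (@le_trans _ _ (K * d * e ^+ m.*2 * ((2 `^ p) ^+ m.*2 * Fp m p ^+ 2))).
    by rewrite ler_wpM2l ?Fp_double// !mulr_ge0// exprn_ge0.
  rewrite mulrA -(mulrA (K * d)) -exprMn; apply: geo_le.
  - by rewrite mulr_ge0//= ler_wpM2l.
  - by apply: EP => //; rewrite powR_ge0.
  - exact: sqr_ge0.
pose J : R := 2 * n.+1%:R.
have J1 : 1 <= J by rewrite /J -natrM ler1n.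
have J0 := le_trans ler01 J1.
have T1 : 2 `^ t <= P by rewrite /P -addrA lerDl addr_ge0 ?powR_ge0.
have T2 : 2 `^ (t - r) <= P by rewrite /P (addrAC (2 `^ t)) lerDr addr_ge0 ?powR_ge0.
have T3 : 2 `^ (s + r - 1) <= P by rewrite /P lerDr addr_ge0 ?powR_ge0.
have S1 : 0 <= E1 <= E1 + E2 + E3 by rewrite E10 /= -addrA lerDl addr_ge0.
have S2 : 0 <= E2 <= E1 + E2 + E3 by rewrite E20 /= addrAC lerDr addr_ge0.
have S3 : 0 <= E3 <= E1 + E2 + E3 by rewrite E30 /= lerDr addr_ge0.
have U1 : 0 <= D1 <= D by rewrite D10 /= /D -addrA lerDl addr_ge0.
have U2 : 0 <= D2 <= D by rewrite D20 /= /D addrAC lerDr addr_ge0.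
have U3 : 0 <= D3 <= D by rewrite D30 /= /D lerDr addr_ge0.
have [Em EmE] : exists Em, 1 + E = Em by eexists.
have Em1 : 1 <= Em by rewrite -EmE lerDl.
have Em0 := le_trans ler01 Em1.
exists (4 * D), (J * Em); split.
- by rewrite mulr_ge0.
- by rewrite -[leLHS]mulr1 ler_pM.
move=> K v g b a k l1 l2 K0 Hv Hg a0.
have a0' := ltW a0.
set y := `|wavI v g b a|.
have y0 : 0 <= y by exact: normr_ge0.
have KD0 : 0 <= K * D by rewrite mulr_ge0.
(* bounds without the translation variable come with k = 0 *)
have Q (X : R) l p : 0 <= X -> 0 <= p ->
    X ^+ l.*2 * y <= K * D * E ^+ l.*2 * Fp l p ^+ 2 ->
    X ^+ l * (1 + `|b| ^+ k) * y <= 2 * (K * D) * Em ^+ (k + l) * (Fp k t * Fp l p).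
  move=> X0 p0 HX.
  have HB m : `|b| ^+ m.*2 * y <= K * D * E ^+ m.*2 * Fp m t ^+ 2.
    by apply: (dbl _ _ _ D3 E3) => //; exact: H3.
  have B m := split_decay X0 (normr_ge0 b) y0 KD0 (Fp_ge0 l p) (Fp_ge0 m t) E0 HX (HB m).
  have B0 := B 0%N; have Bk := B k.
  have EE m : (m <= k + l)%N -> E ^+ m <= Em ^+ (k + l).
    move=> mk; apply: (@le_trans _ _ (Em ^+ m)); last by rewrite ler_weXn2l.
    by rewrite lerXn2r ?nnegrE// -EmE lerDr.
  rewrite [leLHS](_ : _ = X ^+ l * y + X ^+ l * `|b| ^+ k * y); last by ring.
  rewrite [leRHS](_ : _ = K * D * Em ^+ (k + l) * (Fp k t * Fp l p) +
    K * D * Em ^+ (k + l) * (Fp k t * Fp l p)); last by ring.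
  apply: lerD.
    move: B0; rewrite expr0 mulr1 Fp0 mulr1 addn0 => /le_trans; apply.
    rewrite ler_pM ?mulr_ge0 ?exprn_ge0 ?Fp_ge0//.
      by rewrite ler_wpM2l// EE// leq_addl.
    by rewrite ler_peMl ?Fp_ge0// Fp_ge1.
  apply: le_trans Bk _; rewrite (mulrC (Fp l p)) ler_wpM2r ?mulr_ge0 ?Fp_ge0//.
  by rewrite ler_wpM2l// EE// addnC.
have Q1 := Q a l1 (t - r) a0' tr0 (dbl _ _ _ D1 E1 _ _ tr0 K0 U1 S1 T2 (H1 _ _ _ b _ _ K0 Hv Hg a0)).
have ai0 : 0 <= a^-1 by rewrite invr_ge0.
have H2' : a^-1 ^+ l2.*2 * y <= K * D2 * E2 ^+ l2.*2 * Fp l2.*2 (s + r - 1).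
  by rewrite exprVn; exact: H2.
have Q2 := Q a^-1 l2 (s + r - 1) ai0 sr0 (dbl _ _ _ D2 E2 _ _ sr0 K0 U2 S2 T3 H2').
apply: (@le_trans _ _ ((a ^+ l1 + a ^- l2) * (J ^+ k * (1 + `|b| ^+ k)) * y)).
  rewrite ler_wpM2r// ler_wpM2l ?japanese_le//.
  by rewrite addr_ge0 ?invr_ge0 ?exprn_ge0.
rewrite [leLHS](_ : _ = J ^+ k * (a ^+ l1 * (1 + `|b| ^+ k) * y + a^-1 ^+ l2 * (1 + `|b| ^+ k) * y)); last first.
  by rewrite exprVn; ring.
apply: le_trans (ler_wpM2l (exprn_ge0 k J0) (lerD Q1 Q2)) _.
set F0 := Fp k t; set F1 := Fp l1 _; set F2 := Fp l2 _.
have F00 : 0 <= F0 by exact: Fp_ge0.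
have F11 : 1 <= F1 by exact: Fp_ge1.
have F21 : 1 <= F2 by exact: Fp_ge1.
set N := (k + l1 + l2)%N.
have W1 : 2 * (K * D) * Em ^+ (k + l1) * (F0 * F1) <= 2 * (K * D) * Em ^+ N * (F0 * F1 * F2).
  rewrite ler_pM ?mulr_ge0 ?exprn_ge0 ?Fp_ge0//.
    by rewrite ler_wpM2l ?mulr_ge0// ler_weXn2l// leq_addr.
  by rewrite ler_peMr// mulr_ge0// (le_trans ler01).
have W2 : 2 * (K * D) * Em ^+ (k + l2) * (F0 * F2) <= 2 * (K * D) * Em ^+ N * (F0 * F1 * F2).
  rewrite ler_pM ?mulr_ge0 ?exprn_ge0 ?Fp_ge0//.
    by rewrite ler_wpM2l ?mulr_ge0// ler_weXn2l// /N addnAC leq_addr.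
  by rewrite mulrAC ler_peMr// mulr_ge0// (le_trans ler01).
apply: le_trans (ler_wpM2l (exprn_ge0 k J0) (lerD W1 W2)) _.
rewrite [leLHS](_ : _ = K * (4 * D) * (J ^+ k * Em ^+ N) * (F0 * F1 * F2)); last by ring.
rewrite ler_wpM2r ?mulr_ge0 ?(le_trans ler01 F11) ?(le_trans ler01 F21)//.
rewrite ler_wpM2l ?mulr_ge0// [leRHS]exprMn ler_wpM2r ?exprn_ge0// ler_weXn2l//.
by rewrite /N -addnA leq_addr.
Qed.

End bounds.

End ScaleAverageDecay.

(** * Real and imaginary parts *)

(* [iterD] is also the name of a lemma on iterated functions. *)
Local Notation iterD := Defs.iterD.

Section IteratedDerivatives.
Context {R : realType} {V : normedModType R} {I : Type}.
Variable e : I -> V.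
Implicit Types (l : seq I) (f g : V -> R) (Phi : V -> R[i]).

Definition dRl l f : V -> R := foldr (fun i g => 'D_(e i) g) f l.

Lemma cRe_iterD l Phi : (fun x => cRe (iterD e l Phi x)) = dRl l (fun x => cRe (Phi x)).
Proof. by elim: l => //= i l <-. Qed.

Lemma cIm_iterD l Phi : (fun x => cIm (iterD e l Phi x)) = dRl l (fun x => cIm (Phi x)).
Proof. by elim: l => //= i l <-. Qed.

Definition smoothV (U : set V) f := forall l x, U x ->
  {for x, continuous (dRl l f)} /\ forall i, derivable (dRl l f) x (e i).

Lemma smooth_onP (U : set V) Phi :
  smooth_on e U Phi <-> smoothV U (fun x => cRe (Phi x)) /\ smoothV U (fun x => cIm (Phi x)).
Proof.
split=> [H|[H1 H2] l x Ux].
  split=> l x Ux; have [c1 c2 d] := H l x Ux.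
    by rewrite -cRe_iterD; split=> // i; exact: (d i).1.
  by rewrite -cIm_iterD; split=> // i; exact: (d i).2.
have [c1 d1] := H1 l x Ux; have [c2 d2] := H2 l x Ux.
rewrite -cRe_iterD in c1 d1; rewrite -cIm_iterD in c2 d2.
by split.
Qed.

(** Only the values on the half-space matter for its function spaces, so the
    wavelet transform can be replaced by a formula valid there. *)
Lemma dRl_local (U : set V) l f g : open U -> (forall x, U x -> f x = g x) ->
  forall x, U x -> dRl l f x = dRl l g x.
Proof.
move=> oU fg; elim: l => //= i l IH x Ux.
apply: near_eq_derive; near=> y; apply: IH; near: y.
exact: open_nbhs_nbhs.
Unshelve. all: by end_near. Qed.

Lemma smoothV_local (U : set V) f g : open U -> (forall x, U x -> f x = g x) ->
  smoothV U g -> smoothV U f.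
Proof.
move=> oU fg sg l x Ux; have [cg dg] := sg l x Ux.
have E : \forall y \near x, dRl l g y = dRl l f y.
  near=> y; apply: (dRl_local _ oU) => [z Uz|]; first by rewrite fg.
  by near: y; exact: open_nbhs_nbhs.
split=> [|i].
  rewrite /prop_for /continuous_at (dRl_local l oU fg Ux).
  by apply: cvg_trans cg; exact: near_eq_cvg.
apply: near_eq_derivable (dg i); exact: E.
Unshelve. all: by end_near. Qed.

Lemma dRl_lincomb l f g (c : R) : smoothV setT f -> smoothV setT g ->
  dRl l (fun x => f x + c * g x) = fun x => dRl l f x + c * dRl l g x.
Proof.
move=> sf sg; elim: l => //= i l ->; apply/funext => x.
have df := derivableP ((sf l x Logic.I).2 i); have dg := derivableP ((sg l x Logic.I).2 i).
have [_ E] := is_deriveD df (is_deriveZ c dg); exact: E.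
Qed.

Lemma smoothV_lincomb f g (c : R) : smoothV setT f -> smoothV setT g ->
  smoothV setT (fun x => f x + c * g x).
Proof.
move=> sf sg l x _; rewrite dRl_lincomb//; split=> [|i].
  have c1 := (sf l x Logic.I).1; have c2 := (sg l x Logic.I).1.
  have c3 : {for x, continuous (fun x => c * dRl l g x)}.
    by apply: continuousM => //; exact: cst_continuous.
  exact: (continuousD c1 c3).
have df := derivableP ((sf l x Logic.I).2 i); have dg := derivableP ((sg l x Logic.I).2 i).
by have [] := is_deriveD df (is_deriveZ c dg).
Qed.

End IteratedDerivatives.

Section GelfandShilovParts.
Context {R : realType} {n : nat}.
Local Notation rV := 'rV[R]_n.
Implicit Types (phi : rV -> R[i]).

Lemma cRe_le (z : R[i]) : `|cRe z| <= cmod z.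
Proof.
case: z => x y /=; rewrite -sqrtr_sqr ler_wsqrtr// lerDl sqr_ge0 //.
Qed.

Lemma cIm_le (z : R[i]) : `|cIm z| <= cmod z.
Proof.
case: z => x y /=; rewrite -sqrtr_sqr ler_wsqrtr// lerDr sqr_ge0 //.
Qed.

Lemma cmod_le (z : R[i]) : cmod z <= `|cRe z| + `|cIm z|.
Proof.
case: z => x y /=; rewrite -[leRHS]ger0_norm ?addr_ge0// -sqrtr_sqr ler_wsqrtr//.
rewrite sqrrD !real_normK ?num_real// lerD2r lerDl mulrn_wge0// mulr_ge0//.
Qed.

Lemma norm_attained (x : rV) : (0 < n)%N -> exists i, `|x| = `|x 0 i|.
Proof.
move=> n0.
have [[i j] _ E] := @Order.TotalTheory.eq_bigmax _ R ('I_1 * 'I_n)%type 0 (ord0, Ordinal n0) predT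
  (fun ij => `|x ij.1 ij.2|) isT (fun ij _ => normr_ge0 _).
by exists j; rewrite [LHS]/Num.norm/= mx_normrE E (ord1 i).
Qed.

Lemma count_mlist (be : 'I_n -> nat) i : count_mem i (mlist be) = be i.
Proof.
rewrite /mlist count_flatten -map_comp sumnE big_map big_enum /=.
rewrite (bigD1 i)//= count_nseq /= eqxx mul1n big1 ?addn0// => j ji.
by rewrite count_nseq /= (negbTE ji) mul0n.
Qed.

Lemma perm_mlist (l : seq 'I_n) : perm_eq l (mlist (fun i => count_mem i l)).
Proof. by apply/allP => i _ /=; rewrite count_mlist. Qed.

Lemma mabs_count (l : seq 'I_n) : mabs (fun i => count_mem i l) = size l.
Proof.
rewrite /mabs; elim: l => [|j l IH]; first by rewrite big1.
by rewrite /= big_split/= IH (bigD1 j)//= eqxx big1 ?addn0 ?add1n// => i /negbTE; rewrite eq_sym => ->.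
Qed.

Lemma size_mlist (be : 'I_n -> nat) : size (mlist be) = mabs be.
Proof.
rewrite /mlist size_flatten /shape -map_comp sumnE big_map big_enum /mabs /=.
by apply: eq_bigr => i _; rewrite size_nseq.
Qed.

Lemma xw_mpow (w : seq 'I_n) (x : rV) : xw w x = mpow x (fun i => count_mem i w).
Proof.
rewrite /mpow /xw; elim: w => [|j w IH].
  by rewrite big_nil big1// => i _; rewrite expr0.
rewrite big_cons IH /=; under [RHS]eq_bigr do rewrite exprD.
rewrite big_split/=; congr (_ * _); rewrite (bigD1 j)//= eqxx expr1 big1 ?mulr1// => i.
by rewrite eq_sym => /negbTE ->; rewrite expr0.
Qed.

Lemma moments_vanish_parts phi : moments_vanish phi ->
  moment0 (fun x => cRe (phi x)) /\ moment0 (fun x => cIm (phi x)).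
Proof.
move=> H; split=> w; have := H (fun i => count_mem i w); rewrite /rvint /cintegral.
  move/(congr1 (@complex.Re R)) => /= <-; apply: eq_Rintegral => t _; rewrite -xw_mpow.
  by rewrite /rowt; case: (phi _) => a b /=; rewrite mul0r subr0.
move/(congr1 (@complex.Im R)) => /= <-; apply: eq_Rintegral => t _; rewrite -xw_mpow.
by rewrite /rowt; case: (phi _) => a b /=; rewrite mul0r addr0.
Qed.

Let gs_part r1 r2 phi (part : R[i] -> R) : (0 < n)%N -> 0 < r1 -> 0 < r2 ->
  (forall z, `|part z| <= cmod z) ->
  (forall l x, part (iterD (@rvdir R n) l phi x) = pds l (fun x => part (phi x)) x) ->
  smoothr (fun x => part (phi x)) ->
  (exists2 h : R, 0 < h & (gs_norm r1 r2 h phi < +oo)%E) ->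
  gsr r1 r2 (fun x => part (phi x)).
Proof.
move=> n0 r10 r20 partle partE sf [h h0 hoo]; split => //.
have [M M0 HM] : exists2 M : R, 0 <= M & forall x al be,
    h ^+ mabs (fun i => al i + be i)%N / ((mfact al)%:R `^ r2 * (mfact be)%:R `^ r1)
      * cmod ((mpow x al)%:C * mderiv be phi x) <= M.
  have H x al be : ((h ^+ mabs (fun i => al i + be i)%N
    / ((mfact al)%:R `^ r2 * (mfact be)%:R `^ r1)
      * cmod ((mpow x al)%:C * mderiv be phi x))%:E <= gs_norm r1 r2 h phi)%E.
    by apply: ereal_sup_ubound; exists x, al, be.
  have gn : gs_norm r1 r2 h phi \is a fin_num.
    rewrite fin_numE; apply/andP; split; last by rewrite lt_eqF.
    apply/eqP => gE.
    by have := H 0 (fun=> 0%N) (fun=> 0%N); rewrite gE leeNy_eq.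
  exists `|fine (gs_norm r1 r2 h phi)| => // x al be.
  by rewrite (le_trans _ (ler_norm _))// -lee_fin fineK.
exists M, (1 + h^-1); split => //; first by rewrite lerDl invr_ge0 ltW.
move=> l p x; have [i xi] := norm_attained x n0.
pose al j := if j == i then p else 0%N.
pose be j := count_mem j l.
have alE : mpow x al = x 0 i ^+ p.
  rewrite /mpow (bigD1 i)//= /al eqxx big1 ?mulr1// => j /negbTE ->; exact: expr0.
have malE : mfact al = p`!.
  by rewrite /mfact (bigD1 i)//= /al eqxx big1 ?muln1// => j /negbTE ->.
have abE : mabs (fun j => al j + be j)%N = (p + size l)%N.
  rewrite /mabs big_split/= -[X in (_ + X)%N]/(mabs be) mabs_count; congr (_ + _)%N.
  by rewrite (bigD1 i)//= /al eqxx big1 ?addn0// => j /negbTE ->.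
have := HM x al be; rewrite malE abE alE => H.
have FF0 : 0 < p`!%:R `^ r2 * (mfact be)%:R `^ r1 :> R.
  by rewrite mulr_gt0 ?powR_gt0 ?ltr0n ?fact_gt0// prodn_gt0// => j; rewrite fact_gt0.
have mE : mderiv be phi = iterD (@rvdir R n) (mlist be) phi by [].
have T : `|x| ^+ p * `|pds l (fun x => part (phi x)) x| <=
    cmod ((x 0 i ^+ p)%:C * mderiv be phi x).
  rewrite (pds_perm sf (perm_mlist l)) -partE ComplexField.Normc.normcM; apply: ler_pM => //.
    by rewrite xi -normrX; exact: (cRe_le (_%:C)).
apply: le_trans T _.
have hN : 0 < h ^+ (p + size l) by exact: exprn_gt0.
have {}H : cmod ((x 0 i ^+ p)%:C * mderiv be phi x) <=
   M * (h ^- (p + size l) * (p`!%:R `^ r2 * (mfact be)%:R `^ r1)).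
  move: FF0 hN H; set FF := _ `^ r2 * _; set hN := h ^+ _; set c := cmod _ => FF0 hN0 H.
  rewrite [leLHS](_ : _ = hN / FF * c * (hN^-1 * FF)); last first.
    by field; rewrite !gt_eqF.
  by rewrite ler_wpM2r// mulr_ge0 ?invr_ge0 ?(ltW hN0) ?(ltW FF0).
apply: le_trans H _; rewrite -mulrA ler_wpM2l// ler_pM ?invr_ge0 ?(ltW hN) ?(ltW FF0)//.
  by rewrite -exprVn lerXn2r ?nnegrE ?addr_ge0 ?invr_ge0 ?(ltW h0)// lerDr.
rewrite ler_wpM2l ?powR_ge0//; apply: ge0_ler_powR; rewrite ?nnegrE ?ler0n ?(ltW r10)//.
by rewrite ler_nat -(mabs_count l) mfact_le_mabs.
Qed.

Definition gsc (r1 r2 : R) phi :=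
  gsr r1 r2 (fun x => cRe (phi x)) /\ gsr r1 r2 (fun x => cIm (phi x)).

Lemma gelfand_shilov_gsc r1 r2 phi : (0 < n)%N -> 0 < r1 -> 0 < r2 ->
  gelfand_shilov r1 r2 phi -> gsc r1 r2 phi.
Proof.
move=> n0 r10 r20 [[/smooth_onP[s1 s2] _] h]; split; apply: gs_part => //.
- exact: cRe_le.
- by move=> l x; rewrite -[RHS]/(dRl _ _ _ _) -cRe_iterD.
- by move=> l; split=> [x|i x]; have [] := s1 l x I.
- exact: cIm_le.
- by move=> l x; rewrite -[RHS]/(dRl _ _ _ _) -cIm_iterD.
- by move=> l; split=> [x|i x]; have [] := s2 l x I.
Qed.

End GelfandShilovParts.

(** * Derivatives of the wavelet transform *)

Section WaveletHalfSpace.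
Context {R : realType} {n : nat}.
Local Notation rV := 'rV[R]_n.
Local Notation H := (rV * R)%type.
Implicit Types (f g v : rV -> R) (x b z : rV) (a : R) (p : H).

Definition Wf v g : H -> R := fun p => wavI v g p.1 p.2.

Section calculus.
Variables s q r1 r2 : R.
Hypotheses (s0 : 0 <= s) (q0 : 0 <= q) (r10 : 0 <= r1) (r20 : 0 <= r2).

Lemma gsr_bounded v : gsr s q v -> exists2 L, 0 <= L & forall x, `|v x| <= L.
Proof.
move=> /gsr_decay[C [A [C0 A1 dv]]]; exists C => // x; exact: decay_bound dv.
Qed.

Lemma gsr_pd_bounded v : gsr s q v ->
  exists2 L, 0 <= L & forall i x, `|pd i v x| <= L.
Proof.
move=> gv.
have /choice[L HL] : forall i, exists L, 0 <= L /\ forall x, `|pd i v x| <= L.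
  by move=> i; have [L ? ?] := gsr_bounded (gsr_pd i s0 q0 gv); exists L.
exists (\sum_i L i) => [|i x]; first by apply: sumr_ge0 => i _; exact: (HL i).1.
rewrite (bigD1 i)//= (le_trans ((HL i).2 x))// lerDl sumr_ge0// => j _.
exact: (HL j).1.
Qed.

Lemma Wf_integrable v g b a : gsr s q v -> gsr r1 r2 g ->
  rintegrable (fun z => v (b + a *: z) * g z).
Proof.
move=> gv gg; have [L L0 vL] := gsr_bounded gv; have [C C0 gC] := gsr_weight r20 gg.
apply: (@wle_rintegrable _ _ _ (L * C)).
  apply: rmeasM (rmeas_affine _ _ (continuous_rmeas (gsr_continuous gv))) _.
  exact: continuous_rmeas (gsr_continuous gg).
by move=> z; rewrite normrM -mulrA ler_pM.
Qed.

Lemma is_derive_Wf_b v g i p : gsr s q v -> gsr r1 r2 g ->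
  is_derive p (hdir (Some i)) (Wf v g) (Wf (pd i v) g p).
Proof.
move=> gv gg; apply: line_is_derive; case: p => b a.
have [L L0 vL] := gsr_pd_bounded gv; have [C C0 gC] := gsr_weight r20 gg.
have E (s' : R) (z : rV) : (b + s' *: @rvdir R n i) + a *: z = (b + a *: z) + s' *: @rvdir R n i.
  by rewrite addrAC.
rewrite (_ : (fun _ => _) = fun s' : R => rint (fun z => v ((b + a *: z) + s' *: @rvdir R n i) * g z)); last first.
  apply/funext => s'; rewrite /Wf /= scaler0 addr0 /wavI.
  by congr rint; apply/funext => z; rewrite E.
rewrite (_ : Wf _ _ _ = rint (fun z => pd i v ((b + a *: z) + 0 *: @rvdir R n i) * g z)); last first.
  by rewrite /Wf /wavI /=; congr rint; apply/funext => z; rewrite scale0r addr0.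
apply: (@is_derive_rint _ _ (fun s' z => v ((b + a *: z) + s' *: @rvdir R n i) * g z)
  (fun s' z => pd i v ((b + a *: z) + s' *: @rvdir R n i) * g z) 0
  (fun z => L * (C * weight z))).
- move=> s'; have := Wf_integrable (b + s' *: @rvdir R n i) a gv gg.
  by under eq_fun do rewrite E.
- move=> z s'; have d x : derivable v x (@rvdir R n i).
    by have [_ dv] := gsr_smooth gv [::]; exact: dv.
  have := is_deriveZ (g z) (is_derive_line (d (b + a *: z + s' *: @rvdir R n i))).
  rewrite (_ : g z \*: _ = fun s' : R => v (b + a *: z + s' *: @rvdir R n i) * g z); last first.
    by apply/funext => y; rewrite /= mulrC.
  by rewrite /GRing.scale/= mulrC.
- by move=> s' z _; rewrite normrM ler_pM.
- exact/rintegrableZ/rintegrableZ/rintegrable_weight.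
Qed.

Lemma is_derive_Wf_a v g p : gsr s q v -> gsr r1 r2 g ->
  is_derive p (hdir None) (Wf v g) (\sum_i Wf (pd i v) (mulx i g) p).
Proof.
move=> gv gg; apply: line_is_derive; case: p => b a.
have [L L0 vL] := gsr_pd_bounded gv.
have /choice[C HC] : forall i, exists C, 0 <= C /\ forall x, `|mulx i g x| <= C * weight x.
  by move=> i; have [C ? ?] := gsr_weight r20 (gsr_mulx i r10 r20 gg); exists C.
have E (s' : R) (z : rV) : b + (a + s') *: z = (b + a *: z) + s' *: z.
  by rewrite scalerDl addrA.
pose F' (s' : R) z := \sum_i pd i v ((b + a *: z) + s' *: z) * mulx i g z.
rewrite (_ : (fun _ => _) = fun s' : R => rint (fun z => v ((b + a *: z) + s' *: z) * g z)); last first.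
  apply/funext => s'; rewrite /Wf /= scaler0 addr0 /wavI /GRing.scale/= mulr1.
  by congr rint; apply/funext => z; rewrite E.
rewrite (_ : \sum_i _ = rint (F' 0)); last first.
  rewrite /F' rint_sum => [|i].
    by apply: eq_bigr => i _; rewrite /Wf /wavI /=; congr rint; apply/funext => z; rewrite scale0r addr0.
  have := Wf_integrable b a (gsr_pd i s0 q0 gv) (gsr_mulx i r10 r20 gg).
  rewrite (_ : (fun z => pd i v (b + a *: z) * _) =
    fun z => pd i v (b + a *: z + 0 *: z) * mulx i g z)//.
  by apply/funext => z; rewrite scale0r addr0.
apply: (@is_derive_rint _ _ (fun s' z => v ((b + a *: z) + s' *: z) * g z) F' 0
  (fun z => \sum_i L * (C i * weight z))).
- move=> s'; have := Wf_integrable b (a + s') gv gg.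
  by under eq_fun do rewrite E.
- move=> z s'; have d x := is_derive_dir z x (gsr_smooth gv).
  have d' x : derivable v x z by have [] := d x.
  have := is_deriveZ (g z) (is_derive_line (d' (b + a *: z + s' *: z))).
  rewrite (_ : g z \*: _ = fun s' : R => v (b + a *: z + s' *: z) * g z); last first.
    by apply/funext => y; rewrite /= mulrC.
  have [_ ->] := d (b + a *: z + s' *: z).
  rewrite (_ : _ *: _ = F' s' z)//; rewrite /GRing.scale/= /F' mulr_sumr.
  by apply: eq_bigr => i _; rewrite /mulx; ring.
- move=> s' z _; apply: le_trans (ler_norm_sum _ _ _) _; apply: ler_sum => i _.
  by rewrite normrM ler_pM// (HC i).2.
- apply: rintegrable_sum => i; exact/rintegrableZ/rintegrableZ/rintegrable_weight.
Qed.

Lemma gsr_lipschitz v : gsr s q v ->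
  exists2 L, 0 <= L & forall x y, `|v x - v y| <= L * `|x - y|.
Proof.
move=> gv; have [L L0 vL] := gsr_pd_bounded gv.
exists (n%:R * L) => [|x y]; first by rewrite mulr_ge0.
have d z := is_derive_dir (x - y) z (gsr_smooth gv).
have d' z : derivable v z (x - y) by have [] := d z.
have [th _] := mean_value_line y 1 d'.
rewrite scale1r subrKC mul1r => ->; have [_ ->] := d (y + (th * 1) *: (x - y)).
apply: le_trans (ler_norm_sum _ _ _) _.
apply: (@le_trans _ _ (\sum_(i < n) `|x - y| * L)).
  by apply: ler_sum => i _; rewrite normrM ler_pM// normv_coord.
by rewrite sumr_const card_ord -[leLHS]mulr_natl mulrA (mulrAC n%:R) .
Qed.

Lemma Wf_continuous v g : gsr s q v -> gsr r1 r2 g -> continuous (Wf v g).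
Proof.
move=> gv gg [b a].
have [L L0 vL] := gsr_lipschitz gv.
have [Cg [Ag [Cg0 Ag1 dg]]] := gsr_decay gg.
have D0 := decay_weight 0 _ Cg0 Ag1 r20 dg.
have D1 := decay_weight 1 _ Cg0 Ag1 r20 dg.
pose c0 := Cg * @cweight R n Ag r2 * (2 `^ r2 * Ag) ^+ 0 * Fp 0 r2.
pose c1 := Cg * @cweight R n Ag r2 * (2 `^ r2 * Ag) ^+ 1 * Fp 1 r2.
have cw0 : 0 <= @cweight R n Ag r2 by rewrite (le_trans ler01)// cweight_ge1.
have Ag0 : 0 <= Ag by exact: le_trans Ag1.
have B0 : 0 <= 2 `^ r2 * Ag by rewrite mulr_ge0// powR_ge0.
have c00 : 0 <= c0.
  exact: mulr_ge0 (mulr_ge0 (mulr_ge0 Cg0 cw0) (exprn_ge0 0 B0)) (Fp_ge0 0 r2).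
have c10 : 0 <= c1.
  exact: mulr_ge0 (mulr_ge0 (mulr_ge0 Cg0 cw0) (exprn_ge0 1 B0)) (Fp_ge0 1 r2).
pose M := L * (c0 + c1) * pi ^+ n.
have M0 : 0 <= M by rewrite !mulr_ge0 ?addr_ge0 ?exprn_ge0 ?pi_ge0.
have lip b' a' : `|Wf v g (b, a) - Wf v g (b', a')| <= M * (`|b - b'| + `|a - a'|).
  rewrite /Wf /= /wavI -rintB; [|exact: Wf_integrable|exact: Wf_integrable].
  rewrite /M mulrAC; apply: rint_wle.
    by apply: rintegrableB; exact: Wf_integrable.
  move=> z; rewrite -mulrBl normrM.
  apply: le_trans (ler_wpM2r (normr_ge0 _) (vL _ _)) _.
  have : `|b + a *: z - (b' + a' *: z)| <= (`|b - b'| + `|a - a'|) * (1 + `|z|).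
    rewrite opprD addrACA -scalerBl (le_trans (ler_normD _ _))// normrZ.
    rewrite mulrDr mulr1 mulrDl; apply: lerD; first by rewrite lerDl.
    by rewrite lerDr mulr_ge0.
  move=> /(ler_wpM2l L0) /(ler_wpM2r (normr_ge0 (g z))) /le_trans; apply.
  have := D0 z; have := D1 z; rewrite -/c0 -/c1 expr0 mul1r expr1 => {}D1 {}D0.
  rewrite [leLHS](_ : _ = L * (`|b - b'| + `|a - a'|) * (`|g z| + `|z| * `|g z|)); last by ring.
  rewrite [leRHS](_ : _ = L * (`|b - b'| + `|a - a'|) * (c0 * weight z + c1 * weight z)); last by ring.
  by rewrite ler_wpM2l ?lerD// mulr_ge0// addr_ge0.
apply/cvgrPdist_le => e e0.
have d0 : 0 < e / (2 * M + 1) by rewrite divr_gt0// ltr_wpDl// mulr_ge0.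
exists (ball b (e / (2 * M + 1)), ball a (e / (2 * M + 1))) => /=.
  by split; exact: nbhsx_ballx.
case=> b' a' [] /=; rewrite -ball_normE/= -ball_normE/= => h1 h2.
apply: le_trans (lip b' a') _.
apply: (@le_trans _ _ (M * (e / (2 * M + 1) + e / (2 * M + 1)))).
  by rewrite ler_wpM2l// lerD// ltW.
have M1 : 0 < 2 * M + 1 by rewrite ltr_wpDl// mulr_ge0.
rewrite -mulrDl mulrA ler_pdivrMr// -subr_ge0 (_ : _ - _ = e) ?(ltW e0)//.
by ring.
Qed.

(** A derivative in [b_i] lands on [v] as [pd i]; a derivative in the scale
    lands on [v] as some [pd i] and multiplies [g] by the coordinate [i]. Each
    element of the list records the derivatives of [v] and the monomial in
    front of [g] of one term of the iterated derivative. *)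
Fixpoint wwords (l : seq (option 'I_n)) : seq (seq 'I_n * seq 'I_n) :=
  if l is o :: l' then
    if o is Some i then [seq (i :: w.1, w.2) | w <- wwords l']
    else [seq (i :: w.1, i :: w.2) | i <- enum 'I_n, w <- wwords l']
  else [:: ([::], [::])].

Lemma size_wwords l w : w \in wwords l ->
  size w.1 = size l /\ size w.2 = count_mem None l.
Proof.
elim: l w => [|o l IH] w /=; first by rewrite inE => /eqP ->.
case: o => [i /mapP[w' /IH[<- <-] -> //]|/allpairsP[[i w'] /= [_ /IH[<- <-] ->]]//].
Qed.

Lemma card_wwords l : size (wwords l) = (n ^ count_mem None l)%N.
Proof.
elim: l => //= -[i|] l IH; first by rewrite size_map IH.
by rewrite size_allpairs size_enum_ord IH add1n expnS.
Qed.

Let Wterm v g (w : seq 'I_n * seq 'I_n) : H -> R :=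
  Wf (pds w.1 v) (fun z => xw w.2 z * g z).

Let gv' v (w : seq 'I_n) : gsr s q v -> gsr s q (pds w v). Proof. exact: gsr_pds. Qed.
Let gg' g (w : seq 'I_n) : gsr r1 r2 g -> gsr r1 r2 (fun z => xw w z * g z).
Proof. exact: gsr_xw. Qed.

Let is_derive_Wterms v g o l p : gsr s q v -> gsr r1 r2 g ->
  is_derive p (hdir o) (fun p => \sum_(w <- wwords l) Wterm v g w p)
    (\sum_(w <- wwords (o :: l)) Wterm v g w p).
Proof.
move=> gv gg; case: o => [i|] /=.
  rewrite big_map; apply: is_derive_sumr => w.
  exact: (is_derive_Wf_b i p (gv' w.1 gv) (gg' w.2 gg)).
rewrite big_allpairs_dep big_enum/= exchange_big /=; apply: is_derive_sumr => w.
have := is_derive_Wf_a p (gv' w.1 gv) (gg' w.2 gg).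
congr (is_derive _ _ _ _); apply: eq_bigr => i _.
by congr (Wf _ _ p); apply/funext => z; rewrite /mulx /= xw_cons mulrA.
Qed.

Lemma dRl_Wf v g l : gsr s q v -> gsr r1 r2 g ->
  dRl hdir l (Wf v g) =
  fun p => \sum_(w <- wwords l) Wf (pds w.1 v) (fun z => xw w.2 z * g z) p.
Proof.
move=> gv gg; elim: l => [|o l /= ->]; apply/funext => p /=.
  rewrite big_seq1 /=; congr (Wf _ _ p); apply/funext => z.
  by rewrite /xw big_nil mul1r.
by have [_ E] := is_derive_Wterms o l p gv gg; exact: E.
Qed.

Lemma smoothV_Wf v g : gsr s q v -> gsr r1 r2 g -> smoothV hdir setT (Wf v g).
Proof.
move=> gv gg l p _; rewrite dRl_Wf//; split=> [|o].
  suff : continuous (fun p => \sum_(w <- wwords l) Wterm v g w p) by exact.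
  elim: (wwords l) => [|w ws IH].
    by under eq_fun do rewrite big_nil; exact: cst_continuous.
  under eq_fun do rewrite big_cons.
  have c1 : continuous (Wterm v g w) by apply: Wf_continuous; [exact: gv'|exact: gg'].
  by move=> x; exact: (continuousD (c1 x) (IH x)).
by have [] := is_derive_Wterms o l p gv gg.
Qed.

End calculus.
End WaveletHalfSpace.

(** * Complex-valued integrals *)

Section ComplexArith.
Context {R : realType}.
Implicit Types (z w : R[i]) (a b : R).

Lemma cReM z w : cRe (z * w) = cRe z * cRe w - cIm z * cIm w.
Proof. by case: z; case: w. Qed.
Lemma cImM z w : cIm (z * w) = cRe z * cIm w + cIm z * cRe w.
Proof. by case: z => a b; case: w => c d /=; ring. Qed.
Lemma cRe_conj z : cRe z^* = cRe z. Proof. by case: z. Qed.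
Lemma cIm_conj z : cIm z^* = - cIm z. Proof. by case: z. Qed.

Lemma conjfK (T : Type) (f : T -> R[i]) x : (conjf f x)^* = f x.
Proof. exact: conjCK. Qed.

Lemma cmodM z w : cmod (z * w) = cmod z * cmod w.
Proof. exact: ComplexField.Normc.normcM. Qed.
Lemma cmod_conj z : cmod z^* = cmod z.
Proof. by case: z => a b /=; rewrite sqrrN. Qed.
Lemma cmod_real a : cmod a%:C = `|a|.
Proof. by rewrite /= expr0n /= addr0 sqrtr_sqr. Qed.
Lemma cmod_ge0 z : 0 <= cmod z.
Proof. by case: z => a b; exact: sqrtr_ge0. Qed.
Lemma cmod_expi a : cmod (expi a) = 1.
Proof. by rewrite /= cos2Dsin2 sqrtr1. Qed.

Lemma expiD a b : expi (a + b) = expi a * expi b.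
Proof. by rewrite /expi cosD sinD; apply/eqP; rewrite eq_complex /= eqxx /= addrC. Qed.
Lemma expi0 : expi 0 = 1 :> R[i].
Proof. by rewrite /expi cos0 sin0. Qed.
Lemma expi_conj a : (expi a)^* = expi (- a).
Proof. by rewrite /expi cosN sinN. Qed.

End ComplexArith.

Section ComplexIntegral.
Context d (T : measurableType d) {R : realType}.
Implicit Types (f g : T -> R[i]) (h : T -> R).

Definition cmeas f := measurable_fun [set: T] (fun x => cRe (f x)) /\
  measurable_fun [set: T] (fun x => cIm (f x)).

Lemma cmeasM f g : cmeas f -> cmeas g -> cmeas (fun x => f x * g x).
Proof.
move=> [f1 f2] [g1 g2]; split.
  by under eq_fun do rewrite cReM; apply: measurable_funB; exact: measurable_funM.
by under eq_fun do rewrite cImM; apply: measurable_funD; exact: measurable_funM.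
Qed.

Lemma cmeas_conj f : cmeas f -> cmeas (fun x => (f x)^*).
Proof.
move=> [f1 f2]; split; first by under eq_fun do rewrite cRe_conj.
by under eq_fun do rewrite cIm_conj; exact: measurable_funN.
Qed.

Lemma cmeas_real h : measurable_fun [set: T] h -> cmeas (fun x => (h x)%:C).
Proof. by move=> mh; split=> //=; exact: measurable_cst. Qed.

Lemma cmeas_cst (c : R[i]) : cmeas (fun=> c).
Proof. by split; exact: measurable_cst. Qed.

Lemma cmeas_expi h : measurable_fun [set: T] h -> cmeas (fun x => expi (h x)).
Proof.
move=> mh; split => /=.
  apply: (measurableT_comp _ mh); apply: continuous_measurable_fun; exact: continuous_cos.
apply: (measurableT_comp _ mh); apply: continuous_measurable_fun; exact: continuous_sin.
Qed.

Variable mu : {measure set T -> \bar R}.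

Lemma cintegrable_le f h : cmeas f -> mu.-integrable setT (EFin \o h) ->
  (forall x, cmod (f x) <= h x) -> cintegrable mu setT f.
Proof.
move=> [f1 f2] hi fh; split.
  apply: (le_integrable measurableT _ _ hi); first by apply/measurable_EFinP; exact: f1.
  move=> x _ /=; rewrite lee_fin (le_trans _ (ler_norm _))// (le_trans _ (fh x))//.
  by case: (f x) => a b; exact: cRe_le.
apply: (le_integrable measurableT _ _ hi); first by apply/measurable_EFinP; exact: f2.
move=> x _ /=; rewrite lee_fin (le_trans _ (ler_norm _))// (le_trans _ (fh x))//.
by case: (f x) => a b; exact: cIm_le.
Qed.

Lemma cintegralZl f (c : R[i]) : cintegrable mu setT f ->
  cintegral mu setT (fun x => c * f x) = c * cintegral mu setT f.
Proof.
move=> [f1 f2]; rewrite /cintegral.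
have iZ (k : R) (h : T -> R) : mu.-integrable setT (EFin \o h) ->
    mu.-integrable setT (EFin \o (fun x => k * h x)).
  move=> hi; rewrite (_ : _ \o _ = (fun x => k%:E * (h x)%:E)%E)//.
  exact: integrableZl.
apply/eqP; rewrite eq_complex; apply/andP; split; apply/eqP.
  rewrite cReM /=; under eq_Rintegral do rewrite cReM.
  by rewrite RintegralB ?RintegralZl//; exact: iZ.
rewrite cImM /=; under eq_Rintegral do rewrite cImM.
by rewrite RintegralD ?RintegralZl//; exact: iZ.
Qed.

Lemma cintegralZr f (c : R[i]) : cintegrable mu setT f ->
  cintegral mu setT (fun x => f x * c) = cintegral mu setT f * c.
Proof.
move=> fi; rewrite mulrC -cintegralZl//; congr cintegral.
by apply/funext => x; rewrite mulrC.
Qed.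

Lemma cintegral_conj f : cintegrable mu setT f ->
  cintegral mu setT (fun x => (f x)^*) = (cintegral mu setT f)^*.
Proof.
move=> [f1 f2]; apply/eqP; rewrite eq_complex cRe_conj cIm_conj; apply/andP; split; apply/eqP => /=.
  by apply: eq_Rintegral => x _; rewrite cRe_conj.
rewrite -mulN1r -RintegralZl//; apply: eq_Rintegral => x _.
by rewrite cIm_conj mulN1r.
Qed.

Lemma cmod_cintegral f h : cintegrable mu setT f -> mu.-integrable setT (EFin \o h) ->
  (forall x, cmod (f x) <= h x) ->
  cmod (cintegral mu setT f) <= 2 * \int[mu]_x h x.
Proof.
move=> [f1 f2] hi fh; apply: le_trans (cmod_le _) _ => /=.
rewrite mulr_natl mulr2n; apply: lerD.
  apply: le_trans (le_normr_Rintegral measurableT f1) _.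
  apply: le_Rintegral => //; first exact: integrable_norm.
  by move=> x _; rewrite (le_trans _ (fh x))// cRe_le.
apply: le_trans (le_normr_Rintegral measurableT f2) _.
apply: le_Rintegral => //; first exact: integrable_norm.
by move=> x _; rewrite (le_trans _ (fh x))// cIm_le.
Qed.

End ComplexIntegral.

Section ComplexFubini.
Context d1 d2 (T1 : measurableType d1) (T2 : measurableType d2) {R : realType}.
Variable m1 : {sigma_finite_measure set T1 -> \bar R}.
Variable m2 : {sigma_finite_measure set T2 -> \bar R}.

Lemma Rintegral_fine_integral d (T : measurableType d) (mu : {measure set T -> \bar R})
  (F : T -> \bar R) : mu.-integrable setT F ->
  \int[mu]_x fine (F x) = fine (\int[mu]_x F x)%E.
Proof.
move=> iF; rewrite /Rintegral; congr fine.
apply: ae_eq_integral => //.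
- apply/measurable_EFinP; apply: measurableT_comp; first exact: fine_measurable.
  exact: measurable_int iF.
- exact: measurable_int iF.
move/integrable_ae : iF => /(_ measurableT); apply: filterS => x /= h xT.
by rewrite fineK// h.
Qed.

Lemma Rintegral_prod (f : T1 * T2 -> R) : (m1 \x m2)%E.-integrable setT (EFin \o f) ->
  \int[(m1 \x m2)%E]_z f z = \int[m1]_x \int[m2]_y f (x, y).
Proof.
move=> fi; have iF := integrable_fubini_F fi.
rewrite {1}/Rintegral -(integral12_prod_meas1 fi).
by rewrite -(Rintegral_fine_integral iF).
Qed.

Lemma integrable_section2 (f : T1 * T2 -> \bar R) : (m1 \x m2)%E.-integrable setT f ->
  m2.-integrable setT (fun y => \int[m1]_x f (x, y))%E.
Proof.
move=> fi; have mf := measurable_int _ fi.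
apply/integrableP; split; first exact: (measurable_fubini_G fi).
apply: le_lt_trans ((integrable21ltyP _ _ mf).1 fi).
apply: ge0_le_integral => //.
- apply: measurableT_comp => //; exact: (measurable_fubini_G fi).
- apply: (measurable_fun_fubini_tonelli_G (abse \o f)) => //=.
  exact: measurableT_comp.
- move=> y _; apply: le_abse_integral => //.
  exact: (measurableT_comp mf (pair2_measurable y)).
Qed.

Lemma Rintegral_prod2 (f : T1 * T2 -> R) : (m1 \x m2)%E.-integrable setT (EFin \o f) ->
  \int[(m1 \x m2)%E]_z f z = \int[m2]_y \int[m1]_x f (x, y).
Proof.
move=> fi; have iF := integrable_section2 fi.
rewrite {1}/Rintegral -(integral21_prod_meas1 fi).
by rewrite -(Rintegral_fine_integral iF).
Qed.

Lemma cintegral_prod (f : T1 * T2 -> R[i]) : cintegrable (m1 \x m2)%E setT f ->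
  cintegral (m1 \x m2)%E setT f = cintegral m1 setT (fun x => cintegral m2 setT (fun y => f (x, y))).
Proof. by move=> [f1 f2]; rewrite /cintegral !Rintegral_prod. Qed.

Lemma cintegral_prod2 (f : T1 * T2 -> R[i]) : cintegrable (m1 \x m2)%E setT f ->
  cintegral (m1 \x m2)%E setT f = cintegral m2 setT (fun y => cintegral m1 setT (fun x => f (x, y))).
Proof. by move=> [f1 f2]; rewrite /cintegral !Rintegral_prod2. Qed.

Lemma cFubini (f : T1 * T2 -> R[i]) : cintegrable (m1 \x m2)%E setT f ->
  cintegral m1 setT (fun x => cintegral m2 setT (fun y => f (x, y))) =
  cintegral m2 setT (fun y => cintegral m1 setT (fun x => f (x, y))).
Proof. by move=> fi; rewrite -cintegral_prod// cintegral_prod2. Qed.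

Lemma cintegrable_prod (f : T1 * T2 -> R[i]) (h1 : T1 -> R) (h2 : T2 -> R) :
  cmeas f -> (forall x, 0 <= h1 x) -> (forall y, 0 <= h2 y) ->
  m1.-integrable setT (EFin \o h1) -> m2.-integrable setT (EFin \o h2) ->
  (forall x y, cmod (f (x, y)) <= h1 x * h2 y) ->
  cintegrable (m1 \x m2)%E setT f.
Proof.
move=> mf h10 h20 i1 i2 fh.
apply: (@cintegrable_le _ _ _ _ _ (fun z => h1 z.1 * h2 z.2)) => //; last by case.
have /measurable_EFinP mh1 := measurable_int _ i1.
have /measurable_EFinP mh2 := measurable_int _ i2.
have mh : measurable_fun setT (fun z : T1 * T2 => h1 z.1 * h2 z.2).
  apply: measurable_funM.
    exact: (measurableT_comp mh1 measurable_fst).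
  exact: (measurableT_comp mh2 measurable_snd).
apply/(integrable12ltyP _ _ _).2; first by apply/measurable_EFinP; exact: mh.
under eq_integral => x _.
  under eq_integral do rewrite /= ger0_norm ?mulr_ge0// EFinM.
  rewrite ge0_integralZl//; first over.
- by apply/measurable_EFinP; exact: mh2.
- by move=> y _; rewrite lee_fin.
- by rewrite lee_fin.
rewrite ge0_integralZr//.
- apply: lte_mul_pinfty.
  + by apply: integral_ge0 => x _; rewrite lee_fin.
  + by rewrite (integrable_fin_num measurableT i1).
  + by have := integrable_fin_num measurableT i2; rewrite ge0_fin_numE ?integral_ge0// => x _; rewrite lee_fin.
- by apply/measurable_EFinP; exact: mh1.
- by move=> x _; rewrite lee_fin.
- by apply: integral_ge0 => x _; rewrite lee_fin.
Qed.

End ComplexFubini.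

(** * The Fourier transform of exp (- |x|) *)

Section Laplace.
Context {R : realType}.
Local Notation mR := (measurableTypeR R).
Local Notation mu := (@lebesgue_measure R).
Implicit Types (v x : R).

Lemma continuous_laplace : continuous (fun x : R => expR (- `|x|)).
Proof.
move=> x; apply: (@continuous_comp _ _ _ (fun x : R => - `|x|) expR).
  by apply: continuousN; exact: norm_continuous.
exact: continuous_expR.
Qed.

Lemma continuous_scal v : continuous (fun x : R => v * x).
Proof. exact: mulrl_continuous. Qed.

Lemma continuous_cos_scal v : continuous (fun x : R => cos (v * x)).
Proof.
move=> x; apply: (@continuous_comp _ _ _ (fun x : R => v * x) cos).
  exact: continuous_scal.
exact: continuous_cos.
Qed.

Lemma continuous_sin_scal v : continuous (fun x : R => sin (v * x)).
Proof.
move=> x; apply: (@continuous_comp _ _ _ (fun x : R => v * x) sin).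
  exact: continuous_scal.
exact: continuous_sin.
Qed.

(** Adding 1 makes the integrand nonnegative, so that the fundamental theorem
    of calculus on a half-line applies to it. *)
Lemma integral_1Dcos_laplace v :
  (\int[mu]_x ((1 + cos (v * x)) * expR (- `|x|))%:E = (2 * (1 + (1 + v ^+ 2)^-1))%:E)%E.
Proof.
have d0 : 0 < 1 + v ^+ 2 by rewrite ltr_pwDl// sqr_ge0.
have c1 (y : R) : 0 <= 1 + cos y by rewrite -lerBlDl sub0r cos_geN1.
rewrite (@ge0_symfun_integralT _ (fun x => (1 + cos (v * x)) * expR (- `|x|))); last 3 first.
- by move=> x; rewrite mulr_ge0 ?c1// expR_ge0.
- move=> x; apply: (@continuousM R _ (fun x : R => 1 + cos (v * x)) (fun x => expR (- `|x|))); last exact: continuous_laplace.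
  by apply: continuousD; [exact: cst_continuous|exact: continuous_cos_scal].
- by move=> x /=; rewrite mulrN cosN normrN.
rewrite -set_itvcy EFinM; congr (_ * _)%E.
transitivity (\int[mu]_(x in `[0%R, +oo[) ((1 + cos (v * x)) * expR (- x))%:E)%E.
  apply: eq_integral => x; rewrite inE /= in_itv /= andbT => x0.
  by rewrite ger0_norm.
pose F (x : R) : R := ((v * sin (v * x) - cos (v * x)) / (1 + v ^+ 2) - 1) * expR (- x).
have dF (x : R) : is_derive x (1 : R) F ((1 + cos (v * x)) * expR (- x)).
  apply: is_derive_eq; rewrite /GRing.scale /=.
  by field; rewrite gt_eqF.
rewrite (@ge0_continuous_FTC2y _ _ F _ 0).
- rewrite /F mulr0 sin0 cos0 mulr0 oppr0 expR0 -EFinB; congr EFin.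
  by field; rewrite gt_eqF.
- by move=> x _; rewrite mulr_ge0 ?c1// expR_ge0.
- apply: continuous_subspaceT => x.
  apply: (@continuousM R _ (fun x : R => 1 + cos (v * x)) (fun x => expR (- x))).
    by apply: continuousD; [exact: cst_continuous|exact: continuous_cos_scal].
  apply: (@continuous_comp _ _ _ (fun x : R => - x) expR).
    exact: opp_continuous.
  exact: continuous_expR.
- pose K := (`|v| + 1) / (1 + v ^+ 2) + 1.
  apply: (@squeeze_cvgr _ _ _ _ (fun x => - (K * expR (- x))) (fun x => K * expR (- x))).
  + near=> x; rewrite -ler_norml /F normrM (ger0_norm (expR_ge0 _)) ler_wpM2r ?expR_ge0//.
    apply: le_trans (ler_normB _ _) _; rewrite normr1 lerD2r normrM normfV (gtr0_norm d0).
    rewrite ler_wpM2r ?invr_ge0 ?(ltW d0)//; apply: le_trans (ler_normB _ _) _.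
    apply: lerD; last by rewrite ler_norml cos_geN1 cos_le1.
    by rewrite normrM ler_piMr// ler_norml sin_geN1 sin_le1.
  + rewrite -oppr0 -(mulr0 K); apply: cvgN; apply: cvgM; first exact: cvg_cst.
    exact: cvgr_expR.
  + rewrite -(mulr0 K); apply: cvgM; first exact: cvg_cst.
    exact: cvgr_expR.
- by move=> x _; have [] := dF x.
- apply: cvg_at_right_filter; apply: differentiable_continuous; apply/derivable1_diffP.
  by have [] := dF 0.
- by move=> x _; rewrite derive1E; have [_] := dF x.
Unshelve. all: by end_near. Qed.

Lemma laplace_integrable : mu.-integrable setT (EFin \o (fun x : R => expR (- `|x|))).
Proof.
have mE : measurable_fun [set: mR] (fun x : R => expR (- `|x|)).
  by apply: continuous_measurable_fun; exact: continuous_laplace.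
apply/integrableP; split; first by apply/measurable_EFinP; exact: mE.
apply: (@le_lt_trans _ _ (\int[mu]_x ((1 + cos (0 * x)) * expR (- `|x|))%:E)%E).
  apply: ge0_le_integral => //.
  - by apply/measurable_EFinP; apply: measurableT_comp => //; exact: mE.
  - apply/measurable_EFinP; apply: measurable_funM => //.
    apply: continuous_measurable_fun => x.
    by apply: continuousD; [exact: cst_continuous|exact: continuous_cos_scal].
  - move=> x _; rewrite mul0r cos0 lee_fin (ger0_norm (expR_ge0 _)).
    by rewrite ler_peMl ?expR_ge0// lerDl.
by rewrite integral_1Dcos_laplace ltry.
Qed.

Lemma cmeas_laplace v : cmeas (fun x : mR => (expR (- `|x|))%:C * expi (v * x)).
Proof.
apply: cmeasM.
  by apply: cmeas_real; apply: continuous_measurable_fun; exact: continuous_laplace.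
by apply: cmeas_expi; apply: continuous_measurable_fun; exact: continuous_scal.
Qed.

Lemma cintegrable_laplace v :
  cintegrable mu setT (fun x : R => (expR (- `|x|))%:C * expi (v * x)).
Proof.
apply: (cintegrable_le (cmeas_laplace v) laplace_integrable) => x.
by rewrite cmodM cmod_real cmod_expi mulr1 ger0_norm ?expR_ge0.
Qed.

Lemma fourier_laplace v :
  cintegral mu setT (fun x : R => (expR (- `|x|))%:C * expi (v * x)) = (2 / (1 + v ^+ 2))%:C.
Proof.
have [i1 i2] := cintegrable_laplace v.
have e1 x : cRe ((expR (- `|x|))%:C * expi (v * x)) = cos (v * x) * expR (- `|x|).
  by rewrite cReM /= mul0r subr0 mulrC.
have e2 x : cIm ((expR (- `|x|))%:C * expi (v * x)) = sin (v * x) * expR (- `|x|).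
  by rewrite cImM /= mul0r addr0 mulrC.
suff : (\int[mu]_x cRe ((expR (- `|x|))%:C * expi (v * x)) = 2 / (1 + v ^+ 2)) /\
       (\int[mu]_x cIm ((expR (- `|x|))%:C * expi (v * x)) = 0).
  by rewrite /cintegral => -[-> ->].
split.
  have A w : \int[mu]_x expR (- `|x|) + \int[mu]_x (cos (w * x) * expR (- `|x|)) =
      2 * (1 + (1 + w ^+ 2)^-1).
    have [j1 _] := cintegrable_laplace w.
    rewrite -RintegralD//; first last.
    - rewrite (_ : _ \o _ = (EFin \o (fun x : R => cRe ((expR (- `|x|))%:C * expi (w * x)))))//.
      by apply/funext => x /=; rewrite mul0r subr0 mulrC.
    - exact: laplace_integrable.
    have -> : 2 * (1 + (1 + w ^+ 2)^-1) = fine (\int[mu]_x ((1 + cos (w * x)) * expR (- `|x|))%:E).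
      by rewrite integral_1Dcos_laplace.
    by apply: eq_Rintegral => x _; rewrite mulrDl mul1r.
  have := A 0; under [X in _ + X]eq_Rintegral do rewrite mul0r cos0 mul1r.
  rewrite expr0n addr0 invr1 => B; under eq_Rintegral do rewrite e1.
  have := A v; move: B; set x := Rintegral _ _ _; set y := Rintegral _ _ _.
  move=> B C; have -> : y = 2 * (1 + (1 + v ^+ 2)^-1) - x by rewrite -C; ring.
  by have -> : x = 2; [move: B; lra|]; ring.
under eq_Rintegral do rewrite e2.
have mE : measurable_fun [set: mR] (fun x : R => expR (- `|x|)).
  by apply: continuous_measurable_fun; exact: continuous_laplace.
have mS w : measurable_fun [set: mR] (fun x : R => (1 + sin (w * x)) * expR (- `|x|)).
  apply: measurable_funM => //; apply: continuous_measurable_fun => x.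
  by apply: continuousD; [exact: cst_continuous|exact: continuous_sin_scal].
have A : (\int[mu]_x ((1 + sin (v * x)) * expR (- `|x|))%:E =
   \int[mu]_x ((1 - sin (v * x)) * expR (- `|x|))%:E)%E.
  have := @ge0_integral_affine R 0 (-1) (fun x => ((1 + sin (v * x)) * expR (- `|x|))%:E).
  rewrite normrN1 invr1 mul1e => <-.
  - by apply: eq_integral => y _; rewrite add0r mulN1r mulrN sinN normrN.
  - by rewrite oppr_eq0 oner_eq0.
  - by apply/measurable_EFinP; exact: mS.
  - by move=> y; rewrite lee_fin mulr_ge0 ?expR_ge0// -lerBlDl sub0r sin_geN1.
have j2 : mu.-integrable setT (EFin \o (fun x => sin (v * x) * expR (- `|x|))).
  rewrite (_ : _ \o _ = (EFin \o (fun x : R => cIm ((expR (- `|x|))%:C * expi (v * x)))))//.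
  by apply/funext => x /=; rewrite mul0r addr0 mulrC.
have := congr1 fine A; rewrite -!/(Rintegral _ _ _).
rewrite (_ : Rintegral _ _ _ = \int[mu]_x expR (- `|x|) + \int[mu]_x (sin (v * x) * expR (- `|x|))); last first.
  rewrite -RintegralD//; last exact: laplace_integrable.
  by apply: eq_Rintegral => x _; rewrite mulrDl mul1r.
rewrite [RHS](_ : _ = \int[mu]_x expR (- `|x|) - \int[mu]_x (sin (v * x) * expR (- `|x|))); last first.
  rewrite -RintegralB//; last exact: laplace_integrable.
  by apply: eq_Rintegral => x _; rewrite mulrBl mul1r.
by set a := Rintegral _ _ _; set b := Rintegral _ _ _; lra.
Qed.

End Laplace.

(** * Products over the coordinates *)

Section TupleFubini.
Context {R : realType}.
Local Notation mR := (measurableTypeR R).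
Local Notation mu := (@lebesgue_measure R).
Local Notation T n := (n.-tuple mR).
Local Notation lt n := (@lebesgue_tuple R n).

Lemma integral_tupleS n (f : T n.+1 -> \bar R) : measurable_fun [set: T n.+1] f ->
  (\int[lt n.+1]_t f t = \int[(mu \x lt n)%E]_z f (tcons z))%E.
Proof.
have ge0 (g : T n.+1 -> \bar R) : measurable_fun [set: T n.+1] g -> (forall t, 0 <= g t)%E ->
    (\int[lt n.+1]_t g t = \int[(mu \x lt n)%E]_z g (tcons z))%E.
  move=> mg g0; rewrite ge0_integral_tupleS// (fubini_tonelli1 (g \o @tcons R n))//.
    exact: (measurableT_comp mg (@measurable_tcons R n)).
  by move=> z; exact: g0.
move=> mf; rewrite integralE [RHS]integralE.
rewrite (ge0 _ (measurable_funepos mf)); last by move=> t; exact: funepos_ge0.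
rewrite (ge0 _ (measurable_funeneg mf)); last by move=> t; exact: funeneg_ge0.
by congr (_ - _)%E; apply: eq_integral => z _; rewrite ?funeposE ?funenegE.
Qed.

Lemma cintegral_tupleS n (f : T n.+1 -> R[i]) : cmeas f ->
  cintegral (lt n.+1) setT f = cintegral (mu \x lt n)%E setT (fun z => f (tcons z)).
Proof.
by move=> [f1 f2]; rewrite /cintegral /Rintegral !integral_tupleS//;
  apply/measurable_EFinP; assumption.
Qed.

Lemma cmod_prod (I : Type) (s : seq I) (F : I -> R[i]) :
  cmod (\prod_(i <- s) F i) = \prod_(i <- s) cmod (F i).
Proof.
elim: s => [|i s IH]; last by rewrite !big_cons cmodM IH.
by rewrite !big_nil -[1]/(1%:C) cmod_real normr1.
Qed.

Lemma cmeas_prod d (X : measurableType d) (I : Type) (s : seq I) (F : I -> X -> R[i]) :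
  (forall i, cmeas (F i)) -> cmeas (fun x => \prod_(i <- s) F i x).
Proof.
move=> mF; elim: s => [|i s IH].
  by under eq_fun do rewrite big_nil; exact: cmeas_cst.
by under eq_fun do rewrite big_cons; exact: cmeasM.
Qed.

Lemma cmeas_comp d1 d2 (X : measurableType d1) (Y : measurableType d2)
    (f : Y -> R[i]) (h : X -> Y) :
  cmeas f -> measurable_fun [set: X] h -> cmeas (fun x => f (h x)).
Proof.
by move=> [f1 f2] mh; split; [exact: (measurableT_comp f1 mh)|exact: (measurableT_comp f2 mh)].
Qed.

Section Product.
Variable q : R -> R.
Hypotheses (q0 : forall x, 0 <= q x) (iq : mu.-integrable setT (EFin \o q)).

Lemma integrable_tuple_prod n :
  (lt n).-integrable setT (EFin \o (fun t => \prod_(i < n) q (tnth t i))).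
Proof.
have /measurable_EFinP mq := measurable_int _ iq.
apply/integrableP; split.
  apply/measurable_EFinP; apply: measurable_prod => i _.
  exact: (measurableT_comp (f := q) mq (measurable_tnth i)).
under eq_integral do rewrite /= ger0_norm ?prodr_ge0//.
rewrite ge0_integral_tuple_prod ?ltry//.
have /integrableP[_] := iq; apply: le_lt_trans.
by rewrite le_eqVlt; apply/orP; left; apply/eqP; apply: eq_integral => x _ /=; rewrite ger0_norm.
Qed.

Lemma cintegral_tuple_prod n (p : 'I_n -> R -> R[i]) :
  (forall i, cmeas (p i : mR -> R[i])) -> (forall i x, cmod (p i x) <= q x) ->
  cintegral (lt n) setT (fun t => \prod_(i < n) p i (tnth t i)) =
  \prod_(i < n) cintegral mu setT (p i).
Proof.
elim: n p => [|n IH] p mp pq.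
  rewrite big_ord0 /cintegral; under eq_Rintegral do rewrite big_ord0.
  under [X in _ +i* X]eq_Rintegral do rewrite big_ord0.
  have E (r : R) : \int[lt 0]_t r = r.
    have E : (\int[lt 0]_t r%:E = r%:E)%E by rewrite integral_cst//= diracT mule1.
    by rewrite /Rintegral E.
  by rewrite !E.
have mprod m (p' : 'I_m -> R -> R[i]) : (forall i, cmeas (p' i : mR -> R[i])) ->
    cmeas (fun t : T m => \prod_(i < m) p' i (tnth t i)).
  by move=> mp'; apply: cmeas_prod => i; exact: (cmeas_comp (mp' i) (measurable_tnth i)).
have mB : cmeas (fun t : T n => \prod_(i < n) p (lift ord0 i) (tnth t i)).
  by apply: (mprod n (fun i => p (lift ord0 i))) => i; exact: mp.
have boundB (t : T n) : cmod (\prod_(i < n) p (lift ord0 i) (tnth t i)) <=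
    \prod_(i < n) q (tnth t i).
  by rewrite cmod_prod; apply: ler_prod => i _; rewrite cmod_ge0 pq.
have Ef (z : mR * T n) : \prod_(i < n.+1) p i (tnth (tcons z) i) =
    p ord0 z.1 * \prod_(i < n) p (lift ord0 i) (tnth z.2 i).
  rewrite big_ord_recl tnth0; congr (_ * _).
  by apply: eq_bigr => i _; rewrite tnthS.
rewrite cintegral_tupleS; last exact: mprod.
under eq_fun do rewrite Ef.
rewrite cintegral_prod/=; last first.
  apply: (@cintegrable_prod _ _ mR (T n) R mu (lt n) _ q (fun t : T n => \prod_(i < n) q (tnth t i))) => //.
  - apply: cmeasM; first exact: (cmeas_comp (mp ord0) measurable_fst).
    exact: (cmeas_comp mB measurable_snd).
  - by move=> t; exact: prodr_ge0.
  - exact: integrable_tuple_prod.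
  - by move=> x t /=; rewrite cmodM ler_pM ?cmod_ge0 ?pq.
under eq_fun => x.
  rewrite cintegralZl; last by apply: (cintegrable_le mB (integrable_tuple_prod n)).
  rewrite (IH (fun i => p (lift ord0 i)))//.
  over.
rewrite cintegralZr; last exact: (cintegrable_le (mp ord0) iq).
by rewrite big_ord_recl.
Qed.

End Product.
End TupleFubini.

Section Poisson.
Context {R : realType} {n : nat}.
Local Notation mR := (measurableTypeR R).
Local Notation mu := (@lebesgue_measure R).
Local Notation T n := (n.-tuple mR).
Local Notation lt n := (@lebesgue_tuple R n).
Implicit Types (x y z xi : 'rV[R]_n).

Definition expnorm xi : R := \prod_(i < n) expR (- `|xi 0 i|).

Lemma expi_sum (I : Type) (s : seq I) (F : I -> R) :
  expi (\sum_(i <- s) F i) = \prod_(i <- s) expi (F i).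
Proof.
elim: s => [|i s IH]; first by rewrite !big_nil expi0.
by rewrite !big_cons expiD IH.
Qed.

Lemma realc_prod (I : Type) (s : seq I) (F : I -> R) :
  (\prod_(i <- s) F i)%:C = \prod_(i <- s) (F i)%:C.
Proof.
elim: s => [|i s IH]; first by rewrite !big_nil.
by rewrite !big_cons -IH; apply/eqP; rewrite eq_complex /= !mul0r !mulr0 subr0 addr0 !eqxx.
Qed.

(** The Poisson kernel: the integrand is a product over the coordinates, and
    [fourier_laplace] treats one coordinate. *)
Lemma fourier_expnorm z :
  rvint (fun xi => (expnorm xi)%:C * expi (dotv z xi)) = (2 ^+ n * weight z)%:C.
Proof.
rewrite /rvint.
pose p (i : 'I_n) (x : R) : R[i] := (expR (- `|x|))%:C * expi (z 0 i * x).
transitivity (cintegral (lt n) setT (fun t => \prod_(i < n) p i (tnth t i))).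
  congr cintegral; apply/funext => t; rewrite /expnorm /dotv realc_prod expi_sum -big_split/=.
  by apply: eq_bigr => i _; rewrite mxE.
rewrite (cintegral_tuple_prod (q := fun x : R => expR (- `|x|))); last 4 first.
- by move=> x; exact: expR_ge0.
- exact: laplace_integrable.
- by move=> i; exact: cmeas_laplace.
- by move=> i x; rewrite cmodM cmod_real cmod_expi mulr1 ger0_norm ?expR_ge0.
under eq_bigr do rewrite fourier_laplace.
rewrite -realc_prod; congr (_%:C); rewrite big_split /= prodr_const card_ord.
by congr (_ * _).
Qed.

Lemma expnorm_rintegrable : rintegrable expnorm.
Proof.
rewrite /rintegrable (_ : _ \o _ = EFin \o (fun t : T n => \prod_(i < n) expR (- `|tnth t i|))).
  apply: (integrable_tuple_prod (q := fun x : R => expR (- `|x|))); last exact: laplace_integrable.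
  by move=> x; exact: expR_ge0.
by apply/funext => t /=; congr EFin; apply: eq_bigr => i _; rewrite mxE.
Qed.

End Poisson.

(** * Integrals against waves *)

Section Oscillating.
Context {R : realType} {n : nat}.
Local Notation rV := 'rV[R]_n.
Implicit Types (f : rV -> R) (x y xi eta : rV) (i : 'I_n).

Lemma dotvC x y : dotv x y = dotv y x.
Proof. by apply: eq_bigr => i _; rewrite mulrC. Qed.

Lemma dotvDl x y xi : dotv (x + y) xi = dotv x xi + dotv y xi.
Proof. by rewrite /dotv -big_split; apply: eq_bigr => i _; rewrite mxE mulrDl. Qed.

Lemma dotvZl (a : R) x xi : dotv (a *: x) xi = a * dotv x xi.
Proof. by rewrite /dotv mulr_sumr; apply: eq_bigr => i _; rewrite mxE mulrA. Qed.

Lemma dotvDr x y xi : dotv xi (x + y) = dotv xi x + dotv xi y.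
Proof. by rewrite dotvC dotvDl !(dotvC xi). Qed.

Lemma dotvZr (a : R) x xi : dotv xi (a *: x) = a * dotv xi x.
Proof. by rewrite dotvC dotvZl (dotvC xi). Qed.

Lemma dotv_rvdir i xi : dotv (rvdir i) xi = xi 0 i.
Proof.
rewrite /dotv (bigD1 i)//= big1 ?addr0; first by rewrite mxE !eqxx mul1r.
by move=> j ji; rewrite mxE eqxx (negbTE ji) mul0r.
Qed.

Lemma dotv_le x xi : `|dotv x xi| <= (\sum_(i < n) `|x 0 i|) * `|xi|.
Proof.
rewrite mulr_suml; apply: le_trans (ler_norm_sum _ _ _) _; apply: ler_sum => i _.
by rewrite normrM ler_wpM2l// normv_coord.
Qed.

Lemma continuous_dotv xi : continuous (fun x => dotv x xi).
Proof.
apply: continuous_sumr => i x.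
by apply: (@continuousM _ _ (fun x : rV => x 0 i) (fun=> xi 0 i));
  [exact: continuous_coord|exact: cst_continuous].
Qed.

(** Cosine and sine are treated together; [k'] is the derivative of [k]. *)
Definition wave (k k' : R -> R) := [/\ forall th : R, is_derive th (1 : R) k (k' th),
  forall th, `|k th| <= 1 & forall th, `|k' th| <= 1].

Lemma wave_cos : wave cos (fun th => - sin th).
Proof.
split=> [th|th|th]; first exact: is_derive_cos.
- by rewrite ler_norml cos_geN1 cos_le1.
- by rewrite normrN ler_norml sin_geN1 sin_le1.
Qed.

Lemma wave_sin : wave sin cos.
Proof.
split=> [th|th|th]; first exact: is_derive_sin.
- by rewrite ler_norml sin_geN1 sin_le1.
- by rewrite ler_norml cos_geN1 cos_le1.
Qed.

Lemma waveN k k' : wave k k' -> wave (fun th => - k th) (fun th => - k' th).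
Proof.
move=> [dk k1 k'1]; split=> [th|th|th]; rewrite ?normrN//.
have dk' := dk th; exact: is_deriveN.
Qed.

Lemma wave_continuous k k' : wave k k' -> continuous k.
Proof.
move=> [dk _ _] th; apply: differentiable_continuous; apply/derivable1_diffP.
by have [] := dk th.
Qed.

Lemma wave_lip k k' (a b : R) : wave k k' -> `|k a - k b| <= `|a - b|.
Proof.
move=> [dk _ k'1]; have [th _ ->] := mean_value b a dk.
by rewrite normrM ler_piMr.
Qed.

Variables (r1 r2 : R).
Hypotheses (r10 : 0 <= r1) (r20 : 0 <= r2).

Definition osc (k : R -> R) f xi := rint (fun x => f x * k (dotv x xi)).

Lemma osc_integrable k k' f xi : wave k k' -> gsr r1 r2 f ->
  rintegrable (fun x => f x * k (dotv x xi)).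
Proof.
move=> wk gf; have [C C0 fC] := gsr_weight r20 gf.
apply: (wle_rintegrable (C := C)).
  apply: rmeasM; first exact: continuous_rmeas (gsr_continuous gf).
  apply: (@continuous_rmeas _ _ (fun x => k (dotv x xi))) => x.
  apply: (@continuous_comp _ _ _ (fun x => dotv x xi) k); first exact: continuous_dotv.
  exact: wave_continuous wk _.
have [_ k1 _] := wk.
by move=> x; rewrite normrM (le_trans _ (fC x))// ler_piMr.
Qed.

Lemma osc_bound k k' f : wave k k' -> gsr r1 r2 f ->
  exists2 K, 0 <= K & forall xi, `|osc k f xi| <= K.
Proof.
move=> wk gf; have [C C0 fC] := gsr_weight r20 gf.
exists (C * pi ^+ n) => [|xi]; first by rewrite mulr_ge0// exprn_ge0// pi_ge0.
apply: rint_wle; first exact: osc_integrable wk gf.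
have [_ k1 _] := wk.
by move=> x; rewrite normrM (le_trans _ (fC x))// ler_piMr.
Qed.

(** Integration by parts. *)
Lemma osc_pd k k' k'' f i xi : wave k k' -> wave k' k'' -> gsr r1 r2 f ->
  osc k (pd i f) xi = - (xi 0 i * osc k' f xi).
Proof.
move=> wk wk' gf; have gdf := gsr_pd i r10 r20 gf.
have [C C0 fC] := gsr_weight r20 gf; have [D D0 fD] := gsr_weight r20 gdf.
have [dk k1 k'1] := wk.
have i1 := osc_integrable xi wk gdf; have i2 := osc_integrable xi wk' gf.
apply/eqP; rewrite -subr_eq0 opprK -rintZ// -rintD//; last exact: rintegrableZ.
apply/eqP; apply: (@rint_derive _ _ (fun x => f x * k (dotv x xi)) _ (D + `|xi 0 i| * C) i).
- exact: osc_integrable wk gf.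
- by rewrite addr_ge0// mulr_ge0.
- move=> x; have df := smoothr_is_derive i x (gsr_smooth gf).
  have dg : is_derive x (rvdir i) (fun x => k (dotv x xi)) (k' (dotv x xi) * xi 0 i).
    apply: line_is_derive.
    have E : (fun s : R => k (dotv (x + s *: rvdir i) xi)) =
        k \o (fun s => dotv x xi + s * xi 0 i).
      by apply/funext => s; rewrite dotvDl dotvZl dotv_rvdir.
    rewrite E; have dl : is_derive (0 : R) (1 : R) (fun s : R => dotv x xi + s * xi 0 i) (xi 0 i).
      by apply: is_derive_eq; rewrite /GRing.scale /= add0r mulr1 ?mul1r ?mulr0 ?add0r ?addr0.
    have := @is_derive1_comp _ k (fun s => dotv x xi + s * xi 0 i) 0 _ _ _ dl.
    rewrite mul0r addr0; apply; exact: dk.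
  have := is_deriveM df dg; congr (is_derive _ _ _ _).
  by rewrite /GRing.scale /=; ring.
- move=> x; apply: le_trans (ler_normD _ _) _; rewrite mulrDl lerD//.
    by rewrite normrM (le_trans _ (fD x))// ler_piMr.
  rewrite !normrM -mulrA ler_wpM2l//.
  by rewrite (le_trans _ (fC x))// ler_piMr.
Qed.

Lemma osc_pd2 k k' f i xi : wave k k' -> wave k' (fun th => - k th) -> gsr r1 r2 f ->
  osc k (pd i (pd i f)) xi = - (xi 0 i ^+ 2 * osc k f xi).
Proof.
move=> wk wk' gf; have gdf := gsr_pd i r10 r20 gf.
rewrite (osc_pd _ _ wk wk' gdf) (osc_pd _ _ wk' (waveN wk) gf).
rewrite (_ : osc (fun th => - k th) f xi = - osc k f xi); first by ring.
rewrite -mulN1r -rintZ; last exact: osc_integrable wk gf.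
by congr rint; apply/funext => x; ring.
Qed.

(** [1 + xi_i^2] is the symbol of [1 - d_i^2]: multiplying by it, one coordinate
    after the other, amounts to differentiating [f] and keeps the integral
    bounded. *)
Lemma osc_decay k k' f : wave k k' -> wave k' (fun th => - k th) -> gsr r1 r2 f ->
  exists2 K, 0 <= K & forall xi, `|osc k f xi| <= K * weight xi.
Proof.
move=> wk wk' gf.
have o0 (y : R) : 0 < oneDsqr y by rewrite (lt_le_trans ltr01)// oneDsqr_ge1.
have : exists2 K, 0 <= K & forall xi, (\prod_(i <- enum 'I_n) oneDsqr (xi 0 i)) * `|osc k f xi| <= K.
  (* [f] is generalised: the step applies the hypothesis to a derivative *)
  elim: (enum 'I_n) f gf => [|i l IH] f gf.
    have [K K0 HK] := osc_bound wk gf; exists K => // xi.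
    by rewrite big_nil mul1r.
  have [K1 K10 HK1] := IH _ gf.
  have [K2 K20 HK2] := IH _ (gsr_pd i r10 r20 (gsr_pd i r10 r20 gf)).
  exists (K1 + K2) => [|xi]; first by rewrite addr_ge0.
  rewrite big_cons -mulrA mulrCA -{1}(ger0_norm (ltW (o0 _))) -normrM.
  apply: le_trans (lerD (HK1 xi) (HK2 xi)); rewrite -mulrDr ler_wpM2l//.
    by apply: prodr_ge0 => j _; exact: ltW.
  rewrite (osc_pd2 i xi wk wk' gf) normrN.
  by apply: le_trans (ler_normD _ _); rewrite /oneDsqr mulrDl mul1r.
move=> [K K0 HK]; exists K => // xi.
rewrite /weight prodfV ler_pdivlMr ?prodr_gt0// mulrC.
by apply: le_trans (HK xi); rewrite big_enum.
Qed.

Lemma osc_lip k k' f : wave k k' -> gsr r1 r2 f ->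
  exists2 K, 0 <= K & forall xi eta, `|osc k f xi - osc k f eta| <= K * `|xi - eta|.
Proof.
move=> wk gf.
have gm i := gsr_mulx i r10 r20 gf.
have /choice[C HC] : forall i, exists C, 0 <= C /\ forall x, `|mulx i f x| <= C * weight x.
  by move=> i; have [C C0 fC] := gsr_weight r20 (gm i); exists C.
exists ((\sum_i C i) * pi ^+ n) => [|xi eta].
  by rewrite mulr_ge0 ?exprn_ge0 ?pi_ge0// sumr_ge0// => i _; have [] := HC i.
rewrite mulrAC -rintB; [|exact: osc_integrable wk gf..].
apply: rint_wle; first by apply: rintegrableB; exact: osc_integrable wk gf.
move=> x; rewrite -mulrBr normrM.
apply: (@le_trans _ _ (`|f x| * ((\sum_(i < n) `|x 0 i|) * `|xi - eta|))).
  rewrite ler_wpM2l//; apply: le_trans (wave_lip _ _ wk) _.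
  apply: le_trans (dotv_le _ _).
  by rewrite -(scaleN1r eta) dotvDr dotvZr mulN1r.
rewrite mulrA [leRHS]mulrAC ler_wpM2r// mulr_sumr mulr_suml; apply: ler_sum => i _.
by have [_] := HC i; move=> /(_ x); rewrite /mulx normrM mulrC.
Qed.

Lemma osc_continuous k k' f : wave k k' -> gsr r1 r2 f -> continuous (osc k f).
Proof.
move=> wk gf xi; have [K K0 HK] := osc_lip wk gf.
have K1 : 0 < K + 1 by rewrite ltr_wpDl.
apply/(@cvgrPdist_le _ _ _ (nbhs xi)) => e e0.
have d0 : 0 < e / (K + 1) by rewrite divr_gt0.
apply: (filterS _ (nbhsx_ballx xi _ d0)) => eta; rewrite -ball_normE/= => h.
apply: le_trans (HK _ _) _; move: (ltW h); rewrite ler_pdivlMr// mulrC.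
by apply: le_trans; rewrite ler_wpM2r// lerDl.
Qed.

End Oscillating.

(** * The Fourier transform of Gelfand-Shilov functions *)

Section RowComplex.
Context {R : realType} {n : nat}.
Local Notation mR := (measurableTypeR R).
Local Notation T n := (n.-tuple mR).
Local Notation lt n := (@lebesgue_tuple R n).
Local Notation rV := 'rV[R]_n.
Implicit Types (f u : rV -> R[i]) (x y xi c : rV) (h : rV -> R).

Definition crmeas f := cmeas (fun t : T n => f (rowt t)).
Definition rcint f := cintegrable (lt n) setT (fun t => f (rowt t)).

Lemma rmeas_real h : rmeas h -> crmeas (fun x => (h x)%:C).
Proof. exact: cmeas_real. Qed.

Lemma crmeas_continuous f : continuous (fun x => cRe (f x)) ->
  continuous (fun x => cIm (f x)) -> crmeas f.
Proof. by move=> f1 f2; split; [exact: (continuous_rmeas f1)|exact: (continuous_rmeas f2)]. Qed.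

Lemma crmeas_expi h : rmeas h -> crmeas (fun x => expi (h x)).
Proof. exact: (@cmeas_expi _ (T n) R (fun t => h (rowt t))). Qed.

Lemma rmeas_dotv xi : rmeas (fun x => dotv x xi).
Proof. by apply: (@continuous_rmeas R n (fun x => dotv x xi)); exact: continuous_dotv. Qed.

Lemma rcint_le f h : crmeas f -> rintegrable h -> (forall x, cmod (f x) <= h x) -> rcint f.
Proof. by move=> mf hi fh; apply: (cintegrable_le mf hi) => t; exact: fh. Qed.

Lemma rcint_wle f (C : R) : crmeas f -> (forall x, cmod (f x) <= C * weight x) -> rcint f.
Proof. by move=> mf; apply: rcint_le mf _; exact/rintegrableZ/rintegrable_weight. Qed.

Lemma rvintZl f (k : R[i]) : rcint f -> rvint (fun x => k * f x) = k * rvint f.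
Proof. exact: cintegralZl. Qed.

Lemma rvintZr f (k : R[i]) : rcint f -> rvint (fun x => f x * k) = rvint f * k.
Proof. exact: cintegralZr. Qed.

Lemma rvint_conj f : rcint f -> rvint (fun x => (f x)^*) = (rvint f)^*.
Proof. exact: cintegral_conj. Qed.

Lemma rvintE f : rvint f = rint (fun x => cRe (f x)) +i* rint (fun x => cIm (f x)).
Proof. by []. Qed.

Lemma crmeas_affine f c (a : R) : crmeas f -> crmeas (fun x => f (c + a *: x)).
Proof. by move=> [f1 f2]; split; [exact: (rmeas_affine (f := fun x => cRe (f x)) c a f1)|exact: (rmeas_affine (f := fun x => cIm (f x)) c a f2)]. Qed.

Lemma rcint_affine f c (a : R) : a != 0 -> rcint f -> rcint (fun x => f (c + a *: x)).
Proof. by move=> a0 [f1 f2]; split; [exact: (rintegrable_affine (f := fun x => cRe (f x)) c a0 f1)|exact: (rintegrable_affine (f := fun x => cIm (f x)) c a0 f2)]. Qed.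

Lemma rvint_affine f c (a : R) : a != 0 -> rcint f ->
  rvint (fun x => f (c + a *: x)) = (`|a|^-1 ^+ n)%:C * rvint f.
Proof.
move=> a0 [f1 f2]; rewrite !rvintE.
rewrite (rint_affine (f := fun x => cRe (f x)) c a0 f1) (rint_affine (f := fun x => cIm (f x)) c a0 f2).
by apply/eqP; rewrite eq_complex /= !mul0r subr0 addr0 !eqxx.
Qed.

Lemma rvintFubini (F : rV -> rV -> R[i]) (h1 h2 : rV -> R) :
  cmeas (fun z : T n * T n => F (rowt z.1) (rowt z.2)) ->
  (forall x, 0 <= h1 x) -> (forall y, 0 <= h2 y) -> rintegrable h1 -> rintegrable h2 ->
  (forall x y, cmod (F x y) <= h1 x * h2 y) ->
  rvint (fun x => rvint (F x)) = rvint (fun y => rvint (fun x => F x y)).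
Proof.
move=> mF h10 h20 i1 i2 Fh.
apply: (@cFubini _ _ (T n) (T n) R (lt n) (lt n) (fun z => F (rowt z.1) (rowt z.2))).
apply: (@cintegrable_prod _ _ (T n) (T n) R (lt n) (lt n) _
  (fun t => h1 (rowt t)) (fun t => h2 (rowt t))) => //.
Qed.

Lemma rint_dominated (f_ : nat -> rV -> R) (f h : rV -> R) :
  (forall k, rmeas (f_ k)) -> rmeas f -> rintegrable h ->
  (forall x, f_ k x @[k --> \oo] --> f x) -> (forall k x, `|f_ k x| <= h x) ->
  rint (f_ k) @[k --> \oo] --> rint f.
Proof.
move=> mf_ mf hi f_f f_h.
have [] // := @dominated_convergence _ (T n) R (lt n) setT measurableT
  (fun k t => (f_ k (rowt t))%:E) (fun t => (f (rowt t))%:E) (fun t => (h (rowt t))%:E).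
- by move=> k; apply/measurable_EFinP; exact: mf_.
- by apply/measurable_EFinP; exact: mf.
- by apply: aeW => t _; apply: cvg_EFin; [exact: nearW|exact: f_f].
- by apply: aeW => t k _; rewrite lee_fin.
move=> fi _ fcvg; apply: fine_cvg.
rewrite /rint /Rintegral fineK; first exact: fcvg.
exact: integrable_fin_num.
Qed.

Lemma rvint_dominated (f_ : nat -> rV -> R[i]) (f : rV -> R[i]) (h : rV -> R) :
  (forall k, crmeas (f_ k)) -> crmeas f -> rintegrable h ->
  (forall x, cRe (f_ k x) @[k --> \oo] --> cRe (f x)) ->
  (forall x, cIm (f_ k x) @[k --> \oo] --> cIm (f x)) ->
  (forall k x, cmod (f_ k x) <= h x) ->
  cRe (rvint (f_ k)) @[k --> \oo] --> cRe (rvint f) /\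
  cIm (rvint (f_ k)) @[k --> \oo] --> cIm (rvint f).
Proof.
move=> mf_ [mf1 mf2] hi f1 f2 fh; split.
  apply: (@rint_dominated (fun k x => cRe (f_ k x)) (fun x => cRe (f x)) h) => //.
    by move=> k; have [] := mf_ k.
  by move=> k x; apply: le_trans (fh k x); exact: cRe_le.
apply: (@rint_dominated (fun k x => cIm (f_ k x)) (fun x => cIm (f x)) h) => //.
  by move=> k; have [] := mf_ k.
by move=> k x; apply: le_trans (fh k x); exact: cIm_le.
Qed.

End RowComplex.

Section Fourier.
Context {R : realType} {n : nat}.
Local Notation mR := (measurableTypeR R).
Local Notation T n := (n.-tuple mR).
Local Notation lt n := (@lebesgue_tuple R n).
Local Notation rV := 'rV[R]_n.
Implicit Types (u phi : rV -> R[i]) (x y xi c : rV).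

Variables (r1 r2 : R).
Hypotheses (r10 : 0 <= r1) (r20 : 0 <= r2).

Lemma gsc_meas u : gsc r1 r2 u -> crmeas u.
Proof. by move=> [u1 u2]; apply: crmeas_continuous; [exact: gsr_continuous u1|exact: gsr_continuous u2]. Qed.

Lemma gsc_weight u : gsc r1 r2 u -> exists2 C, 0 <= C & forall x, cmod (u x) <= C * weight x.
Proof.
move=> [u1 u2]; have [C C0 HC] := gsr_weight r20 u1; have [D D0 HD] := gsr_weight r20 u2.
exists (C + D) => [|x]; first by rewrite addr_ge0.
by rewrite mulrDl (le_trans (cmod_le _))// lerD.
Qed.

Lemma fourier_integrable u xi : gsc r1 r2 u -> rcint (fun x => u x * expi (- dotv x xi)).
Proof.
move=> gu; have [C C0 HC] := gsc_weight gu; apply: (rcint_wle (C := C)).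
  apply: cmeasM; first exact: gsc_meas.
  apply: (@crmeas_expi R n (fun x => - dotv x xi)); apply: measurable_funN.
  exact: rmeas_dotv.
by move=> x; rewrite cmodM cmod_expi mulr1.
Qed.

Lemma fourier_parts u xi : gsc r1 r2 u ->
  fourier u xi = (osc cos (fun x => cRe (u x)) xi + osc sin (fun x => cIm (u x)) xi) +i*
    (osc cos (fun x => cIm (u x)) xi - osc sin (fun x => cRe (u x)) xi).
Proof.
move=> [u1 u2]; rewrite /fourier rvintE.
have ic v : gsr r1 r2 v -> rintegrable (fun x => v x * cos (dotv x xi)).
  exact: osc_integrable wave_cos.
have isn v : gsr r1 r2 v -> rintegrable (fun x => v x * sin (dotv x xi)).
  exact: osc_integrable wave_sin.
rewrite /osc -rintD; [|exact: ic|exact: isn].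
rewrite -rintB; [|exact: ic|exact: isn].
congr (_ +i* _); congr rint; apply/funext => x; rewrite ?cReM ?cImM /= cosN sinN; ring.
Qed.

Lemma fourier_decay u : gsc r1 r2 u ->
  exists2 K, 0 <= K & forall xi, cmod (fourier u xi) <= K * weight xi.
Proof.
move=> gu; have [u1 u2] := gu.
have wsN : wave (fun th : R => - sin th) (fun th => - cos th) := waveN wave_sin.
have [K1 K10 H1] := osc_decay r10 r20 wave_cos wsN u1.
have [K2 K20 H2] := osc_decay r10 r20 wave_sin wave_cos u2.
have [K3 K30 H3] := osc_decay r10 r20 wave_cos wsN u2.
have [K4 K40 H4] := osc_decay r10 r20 wave_sin wave_cos u1.
exists (K1 + K2 + (K3 + K4)) => [|xi]; first by rewrite !addr_ge0.
rewrite (fourier_parts xi gu); apply: le_trans (cmod_le _) _ => /=.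
rewrite mulrDl; apply: lerD; rewrite mulrDl.
  by apply: le_trans (ler_normD _ _) _; exact: lerD.
by apply: le_trans (ler_normB _ _) _; exact: lerD.
Qed.

Lemma fourier_meas u : gsc r1 r2 u -> crmeas (fourier u).
Proof.
move=> gu; have [u1 u2] := gu.
rewrite (_ : fourier u = fun xi => (osc cos (fun x => cRe (u x)) xi + osc sin (fun x => cIm (u x)) xi) +i*
    (osc cos (fun x => cIm (u x)) xi - osc sin (fun x => cRe (u x)) xi)); last first.
  by apply/funext => xi; exact: fourier_parts.
have oc v : gsr r1 r2 v -> continuous (osc cos v) by exact: osc_continuous wave_cos.
have os v : gsr r1 r2 v -> continuous (osc sin v) by exact: osc_continuous wave_sin.
apply: crmeas_continuous => x /=.
  by apply: continuousD; [exact: oc|exact: os].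
by apply: continuousB; [exact: oc|exact: os].
Qed.

(** The transform is Lipschitz and its value at the origin is the integral. *)
Lemma fourier_small u : gsc r1 r2 u -> rvint u = 0 ->
  exists2 K, 0 <= K & forall xi, cmod (fourier u xi) <= K * `|xi|.
Proof.
move=> gu u0; have [u1 u2] := gu.
have [i1 i2] : rint (fun x => cRe (u x)) = 0 /\ rint (fun x => cIm (u x)) = 0.
  by move: u0; rewrite rvintE => /eqP; rewrite eq_complex /= => /andP[/eqP -> /eqP ->].
have d0 x : dotv x (0 : rV) = 0 by rewrite /dotv big1// => i _; rewrite mxE mulr0.
have c0 v : osc cos v (0 : rV) = rint v.
  by congr rint; apply/funext => x; rewrite d0 cos0 mulr1.
have s0 v : osc sin v (0 : rV) = 0.
  by rewrite -[RHS](@rint0 R n); congr rint; apply/funext => x; rewrite d0 sin0 mulr0.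
have [K1 K10 H1] := osc_lip r10 r20 wave_cos u1.
have [K2 K20 H2] := osc_lip r10 r20 wave_sin u2.
have [K3 K30 H3] := osc_lip r10 r20 wave_cos u2.
have [K4 K40 H4] := osc_lip r10 r20 wave_sin u1.
exists (K1 + K2 + (K3 + K4)) => [|xi]; first by rewrite !addr_ge0.
rewrite (fourier_parts xi gu); apply: le_trans (cmod_le _) _ => /=.
have := H1 xi 0; have := H2 xi 0; have := H3 xi 0; have := H4 xi 0.
rewrite !c0 !s0 i1 i2 !subr0 => {}H4 {}H3 {}H2 {}H1.
rewrite mulrDl; apply: lerD; rewrite mulrDl.
  by apply: le_trans (ler_normD _ _) _; exact: lerD.
by apply: le_trans (ler_normB _ _) _; exact: lerD.
Qed.

End Fourier.

(** * Fourier inversion *)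

Section Inversion.
Context {R : realType} {n : nat}.
Local Notation mR := (measurableTypeR R).
Local Notation T n := (n.-tuple mR).
Local Notation lt n := (@lebesgue_tuple R n).
Local Notation rV := 'rV[R]_n.
Implicit Types (u phi : rV -> R[i]) (x y z xi c : rV) (e : R).

Lemma weight_le1 x : weight x <= 1.
Proof.
have -> : 1 = \prod_(i < n) (1 : R) by rewrite prodr_const expr1n.
apply: ler_prod => i _.
have o1 := oneDsqr_ge1 (x 0 i); have o0 := lt_le_trans ltr01 o1.
by rewrite invr_ge0 (ltW o0) invf_le1.
Qed.

Lemma expnormE xi : expnorm xi = expR (- \sum_(i < n) `|xi 0 i|).
Proof.
rewrite /expnorm -sumrN.
by elim/big_rec2: _ => [|i a b _ ->]; rewrite ?expR0 ?expRD.
Qed.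

Lemma expnorm_ge0 xi : 0 <= expnorm xi. Proof. by rewrite expnormE expR_ge0. Qed.

Lemma expnorm_le1 xi : expnorm xi <= 1.
Proof. by rewrite expnormE -expR0 ler_expR oppr_le0 sumr_ge0. Qed.

Lemma cvg_inv_nat : (k.+1%:R^-1 : R) @[k --> \oo] --> (0 : R).
Proof. exact: cvg_harmonic. Qed.

Lemma expnorm_cvg xi : expnorm (k.+1%:R^-1 *: xi) @[k --> \oo] --> (1 : R).
Proof.
have E k : expnorm (k.+1%:R^-1 *: xi) = expR (- (k.+1%:R^-1 * \sum_(i < n) `|xi 0 i|)).
  rewrite expnormE mulr_sumr; congr (expR (- _)); apply: eq_bigr => i _.
  by rewrite mxE normrM ger0_norm.
have H : expR (- (k.+1%:R^-1 * \sum_(i < n) `|xi 0 i|)) @[k --> \oo] -->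
    expR (- (0 * \sum_(i < n) `|xi 0 i|)).
  apply: continuous_cvg; first exact: continuous_expR.
  by apply: cvgN; apply: cvgM; [exact: cvg_inv_nat|exact: cvg_cst].
rewrite mul0r oppr0 expR0 in H.
rewrite (_ : (fun k => _) = fun k => expR (- (k.+1%:R^-1 * \sum_(i < n) `|xi 0 i|))) => [|]; first exact: H.
by apply/funext => k; exact: E.
Qed.

Lemma cvg_scale1 (c : R) (f : nat -> R) : f k @[k --> \oo] --> (1 : R) ->
  c * f k @[k --> \oo] --> c.
Proof.
by move=> f1; rewrite -[X in _ --> X]mulr1; apply: cvgM; [exact: cvg_cst|exact: f1].
Qed.

Lemma mulc_real (w : R[i]) (r : R) : cRe (w * r%:C) = cRe w * r /\ cIm (w * r%:C) = cIm w * r.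
Proof. by rewrite cReM cImM /= !mulr0 subr0 add0r. Qed.

Lemma realcM (a b : R) : (a * b)%:C = a%:C * b%:C.
Proof. by apply/eqP; rewrite eq_complex /= !mul0r !mulr0 subr0 addr0 !eqxx. Qed.

Variables (r1 r2 : R).
Hypotheses (r10 : 0 <= r1) (r20 : 0 <= r2).

(** Fubini's theorem, then [fourier_expnorm] and the substitution [x = y - e z]. *)
Lemma regularized_inversion u y e : gsc r1 r2 u -> 0 < e ->
  rvint (fun xi => fourier u xi * (expi (dotv xi y) * (expnorm (e *: xi))%:C)) =
  rvint (fun z => u (y + (- e) *: z) * (2 ^+ n * weight z)%:C).
Proof.
move=> gu e0; have [C C0 HC] := gsc_weight r20 gu.
have en0 : e != 0 by rewrite gt_eqF.
have mE : rmeas (@expnorm R n) by have /measurable_EFinP := measurable_int _ (@expnorm_rintegrable R n).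
have iEe : rintegrable (fun xi : rV => expnorm (e *: xi)).
  have := rintegrable_affine 0 en0 (@expnorm_rintegrable R n).
  by under eq_fun do rewrite add0r.
have /measurable_EFinP mEe := measurable_int _ iEe.
pose F xi x := u x * expi (- dotv x xi) * (expi (dotv xi y) * (expnorm (e *: xi))%:C).
transitivity (rvint (fun xi => rvint (F xi))).
  congr rvint; apply/funext => xi; rewrite /F /= rvintZr//.
  exact: fourier_integrable gu.
rewrite (rvintFubini (h1 := fun xi => expnorm (e *: xi)) (h2 := fun x => C * weight x)); first last.
- move=> xi x; rewrite /F !cmodM !cmod_expi mulr1 mul1r cmod_real ger0_norm ?expnorm_ge0//.
  by rewrite mulrC ler_wpM2l ?expnorm_ge0.
- exact/rintegrableZ/rintegrable_weight.
- exact: iEe.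
- by move=> x; rewrite mulr_ge0 ?weight_ge0.
- by move=> xi; exact: expnorm_ge0.
- apply: cmeasM; first apply: cmeasM.
  + exact: (cmeas_comp (gsc_meas gu) measurable_snd).
  + apply: cmeas_expi; apply: measurable_funN.
    apply: measurable_sum => i; apply: measurable_funM.
      exact: (measurableT_comp (rmeas_coord i) measurable_snd).
    exact: (measurableT_comp (rmeas_coord i) measurable_fst).
  + apply: cmeasM.
      exact: (cmeas_comp (crmeas_expi (rmeas_dotv y)) measurable_fst).
    apply: cmeas_real; exact: (measurableT_comp mEe measurable_fst).
pose g x := u x * (2 ^+ n * weight (e^-1 *: y + (- e^-1) *: x))%:C.
have gi : rcint g.
  apply: (rcint_wle (C := C * 2 ^+ n)).
    apply: cmeasM; first exact: gsc_meas gu.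
    apply: cmeas_real; apply: measurable_funM; first exact: measurable_cst.
    exact: (rmeas_affine (f := @weight R n) (e^-1 *: y) (- e^-1) (@rmeas_weight R n)).
  move=> x; rewrite cmodM cmod_real ger0_norm ?mulr_ge0 ?exprn_ge0 ?weight_ge0//.
  rewrite mulrAC; apply: ler_pM => //; rewrite ?cmod_ge0 ?mulr_ge0 ?exprn_ge0 ?weight_ge0//.
  by rewrite ler_piMr ?exprn_ge0 ?weight_le1.
transitivity ((`|- e|^-1 ^+ n)%:C * rvint g); last first.
  rewrite -(rvint_affine y _ gi) ?oppr_eq0//; congr rvint; apply/funext => z; rewrite /g.
  congr (_ * (_ * weight _)%:C).
  by rewrite scalerDr scalerA mulrNN mulVf// scale1r addrA -scalerDl subrr scale0r add0r.
rewrite -rvintZl//; congr rvint; apply/funext => x.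
pose w := e^-1 *: y + (- e^-1) *: x.
pose G eta := (expnorm eta)%:C * expi (dotv w eta).
have Gi : rcint G.
  apply: (@rcint_le _ _ _ (@expnorm R n)) => [||eta]; last 2 first.
  - exact: expnorm_rintegrable.
  - by rewrite cmodM cmod_expi mulr1 cmod_real ger0_norm ?expnorm_ge0.
  apply: cmeasM; first exact: cmeas_real.
  apply: (@crmeas_expi R n (fun eta => dotv w eta)).
  rewrite (_ : (fun eta => _) = fun eta => dotv eta w); first exact: rmeas_dotv.
  by apply/funext => eta; exact: dotvC.
transitivity (rvint (fun xi => u x * G (0 + e *: xi))).
  congr rvint; apply/funext => xi; rewrite /F /G add0r -mulrA; congr (_ * _).
  rewrite mulrA -expiD mulrC; congr (_ * expi _).
  rewrite dotvZr /w dotvDl !dotvZl mulrDr !mulrA mulfV// mul1r mulrN mulfV// mulN1r addrC.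
  by rewrite (dotvC y).
rewrite rvintZl; last exact: rcint_affine.
rewrite rvint_affine// /G fourier_expnorm normrN /g -/w.
by rewrite mulrCA.
Qed.

Lemma cmod_bound u : gsc r1 r2 u -> exists2 C, 0 <= C & forall x, cmod (u x) <= C.
Proof.
move=> gu; have [C C0 HC] := gsc_weight r20 gu; exists C => // x.
by apply: le_trans (HC x) _; rewrite ler_piMr// weight_le1.
Qed.

Lemma gsc_continuous u : gsc r1 r2 u ->
  continuous (fun x => cRe (u x)) /\ continuous (fun x => cIm (u x)).
Proof. by move=> [u1 u2]; split; [exact: gsr_continuous u1|exact: gsr_continuous u2]. Qed.

(** Dominated convergence on both sides of [regularized_inversion] as [e] tends
    to 0: the right-hand side is an average of [u] against dilates of [weight],
    which concentrate at [y]. *)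
Lemma fourier_inversion u y : gsc r1 r2 u ->
  rvint (fun xi => fourier u xi * expi (dotv xi y)) = u y * (2 ^+ n * pi ^+ n)%:C.
Proof.
move=> gu; have [K K0 HK] := fourier_decay r10 r20 gu.
have [C C0 HC] := cmod_bound gu; have [c1 c2] := gsc_continuous gu.
have mf : crmeas (fun xi => fourier u xi * expi (dotv xi y)).
  apply: cmeasM; first exact: (fourier_meas r10 r20 gu).
  exact: (crmeas_expi (rmeas_dotv y)).
have mE : rmeas (@expnorm R n) by have /measurable_EFinP := measurable_int _ (@expnorm_rintegrable R n).
pose e k : R := k.+1%:R^-1.
have e0 k : 0 < e k by rewrite invr_gt0.
have mz : crmeas (fun z => (2 ^+ n * weight z)%:C : R[i]).
  by apply: cmeas_real; apply: measurable_funM; [exact: measurable_cst|exact: rmeas_weight].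
have ye z : (y + (- e k) *: z) @[k --> \oo] --> y.
  rewrite -[X in _ --> X]addr0; apply: cvgD; first exact: cvg_cst.
  rewrite -(scale0r z); apply: cvgZ; last exact: cvg_cst.
  by rewrite -oppr0; apply: cvgN; exact: cvg_inv_nat.
have mEe k : rmeas (fun xi => expnorm (e k *: xi)).
  have := rmeas_affine 0 (e k) mE.
  by under [X in rmeas X -> _]eq_fun do rewrite add0r.
have [|||xi|xi|k xi|A1 A2] := @rvint_dominated R n
  (fun k xi => fourier u xi * (expi (dotv xi y) * (expnorm (e k *: xi))%:C))
  (fun xi => fourier u xi * expi (dotv xi y)) (fun xi => K * weight xi).
- move=> k; apply: cmeasM; first exact: (fourier_meas r10 r20 gu).
  apply: cmeasM; first exact: (crmeas_expi (rmeas_dotv y)).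
  exact: (rmeas_real (mEe k)).
- exact: mf.
- exact/rintegrableZ/rintegrable_weight.
- have E k : cRe (fourier u xi * (expi (dotv xi y) * (expnorm (e k *: xi))%:C)) =
      cRe (fourier u xi * expi (dotv xi y)) * expnorm (e k *: xi).
    by rewrite mulrA; case: (mulc_real (fourier u xi * expi (dotv xi y)) (expnorm (e k *: xi))).
  rewrite (_ : (fun k => cRe _) = fun k => cRe (fourier u xi * expi (dotv xi y)) * expnorm (e k *: xi)).
    by apply: cvg_scale1; exact: expnorm_cvg.
  by apply/funext => k; exact: E.
- have E k : cIm (fourier u xi * (expi (dotv xi y) * (expnorm (e k *: xi))%:C)) =
      cIm (fourier u xi * expi (dotv xi y)) * expnorm (e k *: xi).
    by rewrite mulrA; case: (mulc_real (fourier u xi * expi (dotv xi y)) (expnorm (e k *: xi))).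
  rewrite (_ : (fun k => cIm _) = fun k => cIm (fourier u xi * expi (dotv xi y)) * expnorm (e k *: xi)).
    by apply: cvg_scale1; exact: expnorm_cvg.
  by apply/funext => k; exact: E.
- rewrite !cmodM cmod_expi mul1r cmod_real ger0_norm ?expnorm_ge0//.
  by rewrite (le_trans _ (HK xi))// ler_piMr ?cmod_ge0 ?expnorm_le1.
have [|||z|z|k z|B1 B2] := @rvint_dominated R n
  (fun k z => u (y + (- e k) *: z) * (2 ^+ n * weight z)%:C)
  (fun z => u y * (2 ^+ n * weight z)%:C) (fun z => C * 2 ^+ n * weight z).
- move=> k; apply: cmeasM; last exact: mz.
  exact: (crmeas_affine y (- e k) (gsc_meas gu)).
- by apply: cmeasM; [exact: cmeas_cst|exact: mz].
- exact/rintegrableZ/rintegrable_weight.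
- have E w : cRe (w * (2 ^+ n * weight z)%:C) = cRe w * (2 ^+ n * weight z).
    by case: (mulc_real w (2 ^+ n * weight z)).
  rewrite E (_ : (fun k => cRe _) = fun k => cRe (u (y + (- e k) *: z)) * (2 ^+ n * weight z)).
    apply: cvgM; last exact: cvg_cst.
    exact: (cvg_comp (fun k => y + (- e k) *: z) (fun x => cRe (u x)) (ye z) (c1 y)).
  by apply/funext => k; exact: E.
- have E w : cIm (w * (2 ^+ n * weight z)%:C) = cIm w * (2 ^+ n * weight z).
    by case: (mulc_real w (2 ^+ n * weight z)).
  rewrite E (_ : (fun k => cIm _) = fun k => cIm (u (y + (- e k) *: z)) * (2 ^+ n * weight z)).
    apply: cvgM; last exact: cvg_cst.
    exact: (cvg_comp (fun k => y + (- e k) *: z) (fun x => cIm (u x)) (ye z) (c2 y)).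
  by apply/funext => k; exact: E.
- rewrite cmodM cmod_real ger0_norm ?mulr_ge0 ?exprn_ge0 ?weight_ge0// -mulrA.
  by rewrite ler_wpM2r ?mulr_ge0 ?exprn_ge0 ?weight_ge0.
have -> : u y * (2 ^+ n * pi ^+ n)%:C = rvint (fun z => u y * (2 ^+ n * weight z)%:C).
  rewrite rvintZl; last first.
    apply: (rcint_wle (C := 2 ^+ n)) => // z.
    by rewrite cmod_real ger0_norm// mulr_ge0 ?exprn_ge0 ?weight_ge0.
  congr (_ * _); rewrite rvintE /= rint0 rintZ; last exact: rintegrable_weight.
  by rewrite rint_weight.
apply/eqP; rewrite eq_complex; apply/andP; split; apply/eqP.
  apply: (cvg_unique _ A1) => //; apply: cvg_trans B1; apply: near_eq_cvg.
  by apply: nearW => k; rewrite (regularized_inversion y gu (e0 k)).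
apply: (cvg_unique _ A2) => //; apply: cvg_trans B2; apply: near_eq_cvg.
by apply: nearW => k; rewrite (regularized_inversion y gu (e0 k)).
Qed.

End Inversion.

(** * Integrals over the half-line *)

Section HalfLine.
Context {R : realType}.
Local Notation mR := (measurableTypeR R).
Local Notation mu := (@lebesgue_measure R).
Implicit Types (g : R -> R[i]) (a : R).

(** Fubini's theorem is stated on whole spaces, so integrals over the
    half-line are turned into integrals over R with this factor. *)
Definition heaviside a : R := (0 < a)%R%:R.
Definition posinv a : R := heaviside a / a.

Lemma heavisideE a : heaviside a = \1_(`]0%R, +oo[%classic : set R) a.
Proof.
by rewrite indicE mem_setE in_itv /= andbT.
Qed.

Lemma measurable_heaviside : measurable_fun [set: mR] heaviside.
Proof.
rewrite (_ : heaviside = \1_(`]0%R, +oo[%classic : set R)); first exact: measurable_indic.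
by apply/funext => a; exact: heavisideE.
Qed.

Lemma measurable_posinv : measurable_fun [set: mR] posinv.
Proof.
rewrite (_ : posinv = fun a => heaviside a * a `^ (-1)); last first.
  apply/funext => a; rewrite /posinv /heaviside; case: ltP => a0; last by rewrite !mul0r.
  by rewrite powR_inv1// ltW.
apply: measurable_funM; first exact: measurable_heaviside.
exact: measurable_powR.
Qed.

Lemma restrict_heaviside (h : R -> R) : h \_ `]0, +oo[ = fun a => heaviside a * h a.
Proof.
apply/funext => a; rewrite patchE mem_setE in_itv /= andbT /heaviside.
by case: ifP => _; rewrite ?mul1r ?mul0r.
Qed.

Lemma mul_realc (r : R) (w : R[i]) : r%:C * w = (r * cRe w) +i* (r * cIm w).
Proof. by case: w => p q; apply/eqP; rewrite eq_complex /= !mul0r subr0 addr0 !eqxx. Qed.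

Lemma posintE g : posint g = cintegral mu setT (fun a => (heaviside a)%:C * g a).
Proof.
rewrite /posint /cintegral Rintegral_mkcond [X in _ +i* X]Rintegral_mkcond !restrict_heaviside.
by congr (_ +i* _); apply: eq_Rintegral => a _; rewrite mul_realc.
Qed.

Lemma posintegrableE g : posintegrable g ->
  cintegrable mu setT (fun a => (heaviside a)%:C * g a).
Proof.
have aux (h : R -> R) : mu.-integrable `]0, +oo[ (EFin \o h) ->
    mu.-integrable setT (EFin \o (fun a => heaviside a * h a)).
  move=> /integrable_mkcond; rewrite restrict_EFin restrict_heaviside; exact.
move=> [/aux g1 /aux g2]; split.
  by rewrite (_ : _ \o _ = EFin \o (fun a => heaviside a * cRe (g a)))//; apply/funext => a /=; rewrite mul_realc.
by rewrite (_ : _ \o _ = EFin \o (fun a => heaviside a * cIm (g a)))//; apply/funext => a /=; rewrite mul_realc.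
Qed.

Lemma integrable_scale (f : R -> R) e : e != 0 -> mu.-integrable setT (EFin \o f) ->
  mu.-integrable setT (EFin \o (fun a => f (e * a))).
Proof.
move=> e0 /integrableP[/measurable_EFinP mf foo].
have me : measurable_fun [set: mR] (fun a : R => e * a).
  by apply: measurable_funM => //; exact: measurable_cst.
apply/integrableP; split; first by apply/measurable_EFinP; exact: (measurableT_comp mf me).
rewrite [ltLHS](_ : _ = (\int[mu]_x (fun a => `|f a|%:E) (0 + e * x)%R)%E); last first.
  by apply: eq_integral => a _; rewrite /= add0r.
rewrite (ge0_integral_affine 0 (f := fun a => `|f a|%:E) e0).
- by apply: lte_mul_pinfty => //; rewrite lee_fin invr_ge0.
- by apply/measurable_EFinP; exact: measurableT_comp mf.
- by move=> a; rewrite lee_fin.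
Qed.

Lemma Rintegral_scale (f : R -> R) e : 0 < e -> mu.-integrable setT (EFin \o f) ->
  \int[mu]_a f (e * a) = e^-1 * \int[mu]_a f a.
Proof.
move=> e0 fi; have en0 : e != 0 by rewrite gt_eqF.
have fei := integrable_scale en0 fi.
have part (g : R -> R) : mu.-integrable setT (EFin \o g) -> (forall a, 0 <= g a) ->
    \int[mu]_a g (e * a) = e^-1 * \int[mu]_a g a.
  move=> gi g0; have gf := integrable_fin_num measurableT gi.
  have /measurable_EFinP mg := measurable_int _ gi.
  have := @ge0_integral_affine R 0 e (fun a => (g a)%:E) en0.
  under eq_integral do rewrite add0r.
  rewrite /Rintegral => ->.
  - by rewrite fineM// gtr0_norm.
  - by apply/measurable_EFinP; exact: mg.
  - by move=> a; rewrite lee_fin.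
have /measurable_EFinP mf := measurable_int _ fi.
have ifp : mu.-integrable setT (EFin \o (fun a => Num.max (f a) 0)).
  apply: (le_integrable measurableT _ _ fi).
    by apply/measurable_EFinP; apply: measurable_maxr => //; exact: mf.
  move=> a _; rewrite /= lee_fin; case: (leP (f a) 0) => h; last by [].
  by rewrite normr0.
have ifn : mu.-integrable setT (EFin \o (fun a => Num.max (- f a) 0)).
  apply: (le_integrable measurableT _ _ fi).
    by apply/measurable_EFinP; apply: measurable_maxr => //; apply: measurable_funN; exact: mf.
  move=> a _; rewrite /= lee_fin; case: (leP (- f a) 0) => h; last by rewrite normrN.
  by rewrite normr0.
have dec (y : R) : y = Num.max y 0 - Num.max (- y) 0.
  by rewrite oppr_max opprK oppr0; case: (leP y 0) => ?; rewrite ?add0r ?addr0.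
transitivity (\int[mu]_a (Num.max (f (e * a)) 0 - Num.max (- f (e * a)) 0)).
  by apply: eq_Rintegral => a _; exact: dec.
rewrite RintegralB//; [|exact: (integrable_scale en0 ifp)|exact: (integrable_scale en0 ifn)].
rewrite (part (fun a => Num.max (f a) 0)) //; last by move=> a; rewrite le_max lexx orbT.
rewrite (part (fun a => Num.max (- f a) 0)) //; last by move=> a; rewrite le_max lexx orbT.
rewrite -mulrBr; congr (_ * _); rewrite -RintegralB//.
by apply: eq_Rintegral => a _; rewrite -dec.
Qed.

Lemma cintegrable_scale g e : e != 0 -> cintegrable mu setT g ->
  cintegrable mu setT (fun a => g (e * a)).
Proof.
move=> e0 [g1 g2]; split; first exact: (integrable_scale (f := fun a => cRe (g a)) e0 g1).
exact: (integrable_scale (f := fun a => cIm (g a)) e0 g2).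
Qed.

Lemma cintegral_scale g e : 0 < e -> cintegrable mu setT g ->
  cintegral mu setT (fun a => g (e * a)) = (e^-1)%:C * cintegral mu setT g.
Proof.
move=> e0 [g1 g2]; rewrite mul_realc /cintegral.
rewrite (Rintegral_scale (f := fun a => cRe (g a)) e0 g1).
by rewrite (Rintegral_scale (f := fun a => cIm (g a)) e0 g2).
Qed.

Lemma integral_scaled_oneDsqrV e : e != 0 ->
  (\int[mu]_a ((oneDsqr (a * e))^-1)%:E = (`|e|^-1 * pi)%:E)%E.
Proof.
move=> e0; rewrite EFinM -integralT_oneDsqrV.
rewrite -(ge0_integral_affine 0 (f := fun a => ((oneDsqr a)^-1)%:E) e0).
- by apply: eq_integral => a _; rewrite add0r mulrC.
- by apply/measurable_EFinP; exact: measurable_oneDsqrV.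
- by move=> a; rewrite lee_fin invr_ge0 (le_trans ler01)// oneDsqr_ge1.
Qed.

End HalfLine.

(** * Analysis and synthesis on the Fourier side *)

Section TransformFourier.
Context {R : realType} {n : nat}.
Local Notation mR := (measurableTypeR R).
Local Notation T n := (n.-tuple mR).
Local Notation lt n := (@lebesgue_tuple R n).
Local Notation rV := 'rV[R]_n.
Implicit Types (u phi psi : rV -> R[i]) (x y z xi b : rV) (a : R).

Variables (s q r1 r2 : R).
Hypotheses (s0 : 0 <= s) (q0 : 0 <= q) (r10 : 0 <= r1) (r20 : 0 <= r2).

Local Notation kappa := ((2 ^+ n * pi ^+ n)%:C : R[i]).

Lemma transform_integrable u phi b a : gsc s q u -> gsc r1 r2 phi ->
  rcint (fun z => u (b + a *: z) * phi z).
Proof.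
move=> gu gp; have [C C0 HC] := cmod_bound q0 gu; have [D D0 HD] := gsc_weight r20 gp.
apply: (rcint_wle (C := C * D)).
  by apply: cmeasM; [exact: (crmeas_affine b a (gsc_meas gu))|exact: (gsc_meas gp)].
by move=> z; rewrite cmodM -mulrA ler_pM ?cmod_ge0.
Qed.

Lemma transformE u phi b a : 0 < a -> gsc s q u -> gsc r1 r2 phi ->
  wavelet_transform (conjf phi) u (b, a) = rvint (fun z => u (b + a *: z) * phi z).
Proof.
move=> a0 gu gp; have an0 : a != 0 by rewrite gt_eqF.
have ai0 : a^-1 != 0 by rewrite invr_eq0.
have hi := transform_integrable b a gu gp.
rewrite /wavelet_transform.
have := rvint_affine (- (a^-1 *: b)) ai0 hi.
rewrite gtr0_norm ?invr_gt0// invrK => E.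
rewrite (_ : rvint _ = (a ^+ n)%:C * rvint (fun z => u (b + a *: z) * phi z)).
  rewrite mulrA -realcM mulVf ?mul1r ?expf_neq0//.
rewrite -E; congr rvint; apply/funext => x; rewrite conjfK.
congr (u _ * phi _); last by rewrite scalerBr addrC.
by rewrite scalerDr scalerN !scalerA mulfV// !scale1r addrA subrr add0r.
Qed.

Lemma transform_parts u phi b a : gsc s q u -> gsc r1 r2 phi ->
  rvint (fun z => u (b + a *: z) * phi z) =
  (Wf (fun x => cRe (u x)) (fun x => cRe (phi x)) (b, a) -
     Wf (fun x => cIm (u x)) (fun x => cIm (phi x)) (b, a)) +i*
  (Wf (fun x => cRe (u x)) (fun x => cIm (phi x)) (b, a) +
     Wf (fun x => cIm (u x)) (fun x => cRe (phi x)) (b, a)).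
Proof.
move=> [u1 u2] [p1 p2]; rewrite rvintE /Wf /wavI /=.
rewrite -(rintB (Wf_integrable r20 b a u1 p1) (Wf_integrable r20 b a u2 p2)).
rewrite -(rintD (Wf_integrable r20 b a u1 p2) (Wf_integrable r20 b a u2 p1)).
by congr (_ +i* _); congr rint; apply/funext => z; rewrite ?cReM ?cImM.
Qed.

Lemma transform_meas u phi a : gsc s q u -> gsc r1 r2 phi ->
  crmeas (fun b => rvint (fun z => u (b + a *: z) * phi z)).
Proof.
move=> gu gp; have [[u1 u2] [p1 p2]] := (gu, gp).
have cW v g : gsr s q v -> gsr r1 r2 g -> continuous (fun b => Wf v g (b, a)).
  move=> gv gg b; apply: (@continuous_comp _ _ _ (fun b : rV => (b, a)) (Wf v g)).
    apply: (@cvg_pair _ _ _ (nbhs b) (nbhs b) (nbhs a) _ _ _ id (fun=> a)); [exact: cvg_id|exact: cvg_cst].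
  exact: (Wf_continuous s0 q0 r20 gv gg).
apply: crmeas_continuous => b; under eq_fun do rewrite (transform_parts _ _ gu gp) /=.
  exact: (@continuousB _ _ _ (fun b => Wf _ _ (b, a)) _ b (cW _ _ u1 p1 b) (cW _ _ u2 p2 b)).
exact: (@continuousD _ _ _ (fun b => Wf _ _ (b, a)) _ b (cW _ _ u1 p2 b) (cW _ _ u2 p1 b)).
Qed.

Lemma transform_bound u phi : gsc s q u -> gsc r1 r2 phi ->
  exists2 M, 0 <= M & forall b a, cmod (rvint (fun z => u (b + a *: z) * phi z)) <= M.
Proof.
move=> gu gp; have [C C0 HC] := cmod_bound q0 gu; have [D D0 HD] := gsc_weight r20 gp.
exists (2 * (C * D * pi ^+ n)) => [|b a]; first by rewrite !mulr_ge0 ?exprn_ge0 ?pi_ge0.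
have -> : C * D * pi ^+ n = rint (fun z : rV => C * D * weight z).
  by rewrite rintZ ?rint_weight//; exact: rintegrable_weight.
apply: (@cmod_cintegral _ (T n) R (lt n) (fun t => u (b + a *: rowt t) * phi (rowt t))
   (fun t => C * D * weight (rowt t))).
- exact: (transform_integrable b a gu gp).
- exact/rintegrableZ/rintegrable_weight.
- by move=> z; rewrite cmodM -mulrA ler_pM ?cmod_ge0.
Qed.

Lemma expi_dotN x xi a : expi (- dotv x (- a *: xi)) = expi (a * dotv x xi) :> R[i].
Proof. by rewrite dotvZr mulNr opprK. Qed.

(** Fourier inversion writes [u] as a superposition of plane waves, and the
    wavelet transform of a plane wave is that wave times the transform of the
    dilated wavelet. *)
Lemma transform_fourier u phi b a : gsc s q u -> gsc r1 r2 phi ->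
  rvint (fun z => u (b + a *: z) * phi z) * kappa =
  rvint (fun xi => fourier u xi * (expi (dotv xi b) * fourier phi (- a *: xi))).
Proof.
move=> gu gp; have [K K0 HK] := fourier_decay s0 q0 gu; have [D D0 HD] := gsc_weight r20 gp.
rewrite -rvintZr; last exact: transform_integrable.
pose F z xi := fourier u xi * expi (dotv xi (b + a *: z)) * phi z.
transitivity (rvint (fun z => rvint (F z))).
  congr rvint; apply/funext => z; rewrite /F rvintZr.
    by rewrite (fourier_inversion s0 q0 _ gu) mulrAC.
  apply: (rcint_wle (C := K)).
    apply: cmeasM; first exact: (fourier_meas s0 q0 gu).
    exact: (crmeas_expi (rmeas_dotv _)).
  by move=> xi; rewrite cmodM cmod_expi mulr1.
rewrite (rvintFubini (h1 := fun z => D * weight z) (h2 := fun xi => K * weight xi)); first last.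
- by move=> z xi; rewrite /F !cmodM cmod_expi mulr1 mulrC ler_pM ?cmod_ge0.
- exact/rintegrableZ/rintegrable_weight.
- exact/rintegrableZ/rintegrable_weight.
- by move=> x; rewrite mulr_ge0 ?weight_ge0.
- by move=> x; rewrite mulr_ge0 ?weight_ge0.
- apply: cmeasM; first apply: cmeasM.
  + exact: (cmeas_comp (fourier_meas s0 q0 gu) measurable_snd).
  + apply: cmeas_expi; apply: measurable_sum => i; apply: measurable_funM.
      exact: (measurableT_comp (rmeas_coord i) measurable_snd).
    under eq_fun do rewrite !mxE.
    apply: measurable_funD => //; apply: measurable_funM => //.
    exact: (measurableT_comp (measurable_tnth_real i) measurable_fst).
  + exact: (cmeas_comp (gsc_meas gp) measurable_fst).
congr rvint; apply/funext => xi.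
rewrite mulrA -[RHS]rvintZl; last exact: fourier_integrable gp.
congr rvint; apply/funext => z; rewrite /F expi_dotN dotvDr dotvZr expiD (dotvC xi z).
by rewrite -!mulrA; congr (_ * (_ * _)); rewrite mulrC.
Qed.

Lemma synthesis_integrable u phi psi x a : gsc s q u -> gsc r1 r2 phi -> gsc r1 r2 psi ->
  rcint (fun z => rvint (fun z' => u (x - a *: z + a *: z') * phi z') * (psi z)^*).
Proof.
move=> gu gp gs; have [M M0 HM] := transform_bound gu gp; have [D D0 HD] := gsc_weight r20 gs.
apply: (rcint_wle (C := M * D)).
  apply: cmeasM.
    have := crmeas_affine x (- a) (transform_meas a gu gp).
    by under [X in crmeas X -> _]eq_fun do rewrite scaleNr.
  exact: (cmeas_conj (gsc_meas gs)).
by move=> z; rewrite cmodM cmod_conj -mulrA ler_pM ?cmod_ge0.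
Qed.

(** The inner integral of the synthesis acts on plane waves in the same way,
    with the conjugate of the transform of [psi]. *)
Lemma synthesis_fourier u phi psi x a : 0 < a ->
  gsc s q u -> gsc r1 r2 phi -> gsc r1 r2 psi ->
  rvint (fun b => wavelet_transform (conjf phi) u (b, a) * ((a ^+ n)^-1)%:C *
     conjf psi (a^-1 *: (x - b))) * kappa =
  rvint (fun xi => fourier u xi *
    (expi (dotv xi x) * (fourier phi (- a *: xi) * (fourier psi (- a *: xi))^*))).
Proof.
move=> a0 gu gp gs; have an0 : a != 0 by rewrite gt_eqF.
have ai0 : - a^-1 != 0 by rewrite oppr_eq0 invr_eq0.
have [K K0 HK] := fourier_decay s0 q0 gu; have [D D0 HD] := gsc_weight r20 gs.
have [E E0 HE] := fourier_decay r10 r20 gp.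
have hi := synthesis_integrable x a gu gp gs.
set g := (fun z => _ * _) in hi.
have -> : rvint (fun b => wavelet_transform (conjf phi) u (b, a) * ((a ^+ n)^-1)%:C *
     conjf psi (a^-1 *: (x - b))) = rvint g.
  have hi' := rcint_affine (a^-1 *: x) ai0 hi.
  transitivity (((a ^+ n)^-1)%:C * rvint (fun b => g (a^-1 *: x + (- a^-1) *: b))).
    rewrite -rvintZl//; congr rvint; apply/funext => b; rewrite transformE// /g /conjf.
    have -> : a^-1 *: x + - a^-1 *: b = a^-1 *: (x - b) by rewrite scalerBr scaleNr.
    rewrite scalerA mulfV// scale1r subKr.
    by rewrite mulrAC mulrC.
  rewrite (rvint_affine _ ai0 hi) normrN gtr0_norm ?invr_gt0// invrK mulrA -realcM.
  by rewrite mulVf ?mul1r// expf_neq0.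
rewrite -rvintZr//.
pose F z xi := fourier u xi * (expi (dotv xi (x - a *: z)) * fourier phi (- a *: xi)) * (psi z)^*.
transitivity (rvint (fun z => rvint (F z))).
  congr rvint; apply/funext => z; rewrite /F rvintZr.
    by rewrite -transform_fourier// mulrAC.
  apply: (rcint_wle (C := K * E)).
    apply: cmeasM; first exact: (fourier_meas s0 q0 gu).
    apply: cmeasM; first exact: (crmeas_expi (rmeas_dotv _)).
    have := crmeas_affine 0 (- a) (fourier_meas r10 r20 gp).
    by under [X in crmeas X -> _]eq_fun do rewrite add0r.
  move=> xi; rewrite !cmodM cmod_expi mul1r mulrAC ler_pM ?cmod_ge0//.
  by rewrite (le_trans (HE _))// ler_piMr// weight_le1.
rewrite (rvintFubini (h1 := fun z => D * weight z) (h2 := fun xi => K * E * weight xi)); first last.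
- move=> z xi; rewrite /F !cmodM cmod_expi mul1r cmod_conj mulrC ler_pM ?mulr_ge0 ?cmod_ge0//.
  rewrite mulrAC ler_pM ?cmod_ge0//.
  by rewrite (le_trans (HE _))// ler_piMr// weight_le1.
- exact/rintegrableZ/rintegrable_weight.
- exact/rintegrableZ/rintegrable_weight.
- by move=> xi; rewrite !mulr_ge0 ?weight_ge0.
- by move=> z; rewrite mulr_ge0 ?weight_ge0.
- apply: cmeasM; last exact: (cmeas_comp (cmeas_conj (gsc_meas gs)) measurable_fst).
  apply: cmeasM; first exact: (cmeas_comp (fourier_meas s0 q0 gu) measurable_snd).
  apply: cmeasM.
  + apply: cmeas_expi; apply: measurable_sum => i; apply: measurable_funM.
      exact: (measurableT_comp (rmeas_coord i) measurable_snd).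
    under eq_fun do rewrite !mxE.
    apply: measurable_funD => //; apply: measurable_funN; apply: measurable_funM => //.
    exact: (measurableT_comp (measurable_tnth_real i) measurable_fst).
  + have := crmeas_affine 0 (- a) (fourier_meas r10 r20 gp).
    under [X in crmeas X -> _]eq_fun do rewrite add0r.
    by move=> m; exact: (cmeas_comp m measurable_snd).
congr rvint; apply/funext => xi.
have gsi := fourier_integrable r20 (- a *: xi) gs.
have gsi' : rcint (fun z => (psi z * expi (- dotv z (- a *: xi)))^*).
  apply: (rcint_wle (C := D)).
    apply: cmeas_conj; apply: cmeasM; first exact: gsc_meas gs.
    apply: (@crmeas_expi R n (fun z => - dotv z (- a *: xi))).
    by apply: measurable_funN; exact: rmeas_dotv.
  by move=> z; rewrite cmod_conj cmodM cmod_expi mulr1.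
rewrite -(rvint_conj gsi) !mulrA -[RHS]rvintZl//; congr rvint; apply/funext => z.
rewrite /F expi_dotN rmorphM /= expi_conj dotvDr -scaleNr dotvZr expiD mulNr (dotvC xi z).
rewrite -!mulrA; congr (_ * (_ * _)).
by rewrite mulrCA; congr (_ * _); rewrite mulrC.
Qed.

End TransformFourier.

(** * The reproducing formula for functions *)

Section FubiniSections.
Context {R : realType}.

Lemma cintegrable_section d1 d2 (T1 : measurableType d1) (T2 : measurableType d2)
    (m1 : {sigma_finite_measure set T1 -> \bar R}) (m2 : {sigma_finite_measure set T2 -> \bar R})
    (f : T1 * T2 -> R[i]) : cintegrable (m1 \x m2)%E setT f ->
  cintegrable m1 setT (fun x => cintegral m2 setT (fun y => f (x, y))).
Proof.
have aux (g : T1 * T2 -> R) : (m1 \x m2)%E.-integrable setT (EFin \o g) ->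
    m1.-integrable setT (EFin \o (fun x => \int[m2]_y g (x, y))).
  move=> gi; have gF := integrable_fubini_F gi.
  apply: (le_integrable measurableT _ _ gF).
    apply/measurable_EFinP; apply: measurableT_comp; first exact: fine_measurable.
    exact: measurable_int gF.
  move=> x _ /=; rewrite /Rintegral /fubini_F.
  by case: (integral _ _ _) => [r| |] //=; rewrite ?normr0 ?leey// lexx.
by move=> [/aux f1 /aux f2]; split.
Qed.

End FubiniSections.

Section Calderon.
Context {R : realType} {n : nat}.
Local Notation mR := (measurableTypeR R).
Local Notation mu := (@lebesgue_measure R).
Local Notation T n := (n.-tuple mR).
Local Notation lt n := (@lebesgue_tuple R n).
Local Notation rV := 'rV[R]_n.
Implicit Types (u phi psi : rV -> R[i]) (x y xi eta b : rV) (a e : R).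

Hypothesis n0 : (0 < n)%N.

Lemma weight_norm xi : weight xi <= (oneDsqr `|xi|)^-1.
Proof.
have o0 (y : R) : 0 < oneDsqr y by rewrite (lt_le_trans ltr01)// oneDsqr_ge1.
have [i ->] := norm_attained xi n0.
rewrite /oneDsqr real_normK ?num_real// -/(oneDsqr _) /weight (bigD1 i)//=.
have oi0 : 0 <= (oneDsqr (xi 0 i))^-1 by rewrite invr_ge0 ltW.
apply: ler_piMr => //.
rewrite [leRHS](_ : 1 = \prod_(j < n | j != i) (1 : R)); last by rewrite big1.
apply: ler_prod => j _.
by rewrite invr_ge0 (ltW (o0 _)) invf_le1// oneDsqr_ge1.
Qed.

(** Smallness at the origin and at infinity makes [fourier phi (a xi) / a]
    integrable in [a] over the half-line, with a bound uniform in [xi]. *)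
Lemma fourier_wavelet_decay r1 r2 phi : 0 <= r1 -> 0 <= r2 -> gsc r1 r2 phi -> rvint phi = 0 ->
  exists2 D, 0 <= D & forall eta, cmod (fourier phi eta) <= D * (`|eta| * (oneDsqr `|eta|)^-1).
Proof.
move=> r10 r20 gp p0.
have [K K0 HK] := fourier_decay r10 r20 gp; have [L L0 HL] := fourier_small r10 r20 gp p0.
exists (K + L) => [|eta]; first by rewrite addr_ge0.
have o0 : 0 < oneDsqr `|eta| by rewrite (lt_le_trans ltr01)// oneDsqr_ge1.
rewrite mulrA ler_pdivlMr// /oneDsqr.
have h1 : cmod (fourier phi eta) * oneDsqr `|eta| <= K.
  rewrite -ler_pdivlMr//; apply: le_trans (HK eta) _.
  by rewrite ler_wpM2l// weight_norm.
have h2 := HL eta; have e0 := normr_ge0 eta; have c0 := cmod_ge0 (fourier phi eta).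
move: h1 h2 e0 c0; rewrite /oneDsqr; set A := cmod _; set N := `|eta|.
move=> h1 h2 N0 A0; case: (leP N 1) => N1.
  have : A * N ^+ 2 <= K * N.
    rewrite expr2 mulrA.
    have : A * N <= K; last by move=> h; apply: ler_wpM2r.
    by apply: le_trans h1; rewrite ler_wpM2l// (le_trans N1)// lerDl sqr_ge0.
  by rewrite mulrDr mulr1 mulrDl; lra.
apply: (le_trans h1); apply: le_trans (_ : K * N <= _).
  by rewrite ler_peMr// ltW.
by rewrite ler_wpM2r// lerDl.
Qed.

Lemma heaviside_scale e a : 0 < e -> heaviside (e * a) = heaviside a.
Proof. by move=> e0; rewrite /heaviside pmulr_rgt0. Qed.

Lemma posinv_norm a : 0 <= posinv a /\ posinv a * `|a| <= 1.
Proof.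
rewrite /posinv /heaviside; case: ltP => a0; last by rewrite !mul0r.
by rewrite mul1r invr_ge0 (ltW a0) gtr0_norm// mulVf// gt_eqF.
Qed.

Lemma enorm_gt0 xi : xi != 0 -> 0 < enorm xi.
Proof.
move=> xi0; rewrite sqrtr_gt0 lt_def sumr_ge0 ?andbT; last first.
  by move=> i _; rewrite -expr2 sqr_ge0.
apply: contra xi0; rewrite psumr_eq0; last by move=> i _; rewrite -expr2 sqr_ge0.
move=> /allP h; apply/eqP/rowP => i; rewrite mxE.
by have := h i (mem_index_enum i); rewrite /= mulf_eq0 orbb => /eqP.
Qed.

Lemma enormZ e xi : enorm (e *: xi) = `|e| * enorm xi.
Proof.
by rewrite /enorm dotvZl dotvZr mulrA -expr2 sqrtrM ?sqr_ge0// sqrtr_sqr.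
Qed.

Variables (s q r1 r2 : R).
Hypotheses (s0 : 0 <= s) (q0 : 0 <= q) (r10 : 0 <= r1) (r20 : 0 <= r2).

Variables (u phi psi : rV -> R[i]) (c : R[i]) (x : rV).
Hypotheses (gu : gsc s q u) (gp : gsc r1 r2 phi) (gs : gsc r1 r2 psi).
Hypotheses (u0 : rvint u = 0) (p0 : rvint phi = 0).
Hypothesis hc : forall w : rV, unit_sphere w ->
  posintegrable (calderon_integrand psi phi w) /\ calderon psi phi w = c.

Local Notation kappa := ((2 ^+ n * pi ^+ n)%:C : R[i]).

(** The integrand of the reproducing formula on the Fourier side. *)
Let H a xi := fourier u xi *
  (expi (dotv xi x) * (fourier phi (- a *: xi) * (fourier psi (- a *: xi))^*)) * (posinv a)%:C.

Let measurable_dilate : measurable_fun [set: mR * T n]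
  (fun z : mR * T n => [tuple - z.1 * tnth z.2 i | i < n] : T n).
Proof.
apply/measurable_fun_tnthP => i.
rewrite [X in measurable_fun _ X](_ : _ = fun z : mR * T n => - z.1 * tnth z.2 i); last first.
  by apply/funext => t /=; rewrite tnth_mktuple.
apply: measurable_funM; first by apply: measurable_funN; exact: measurable_fst.
exact: (measurableT_comp (measurable_tnth_real i) measurable_snd).
Qed.

Let cmeas_dilate g : crmeas g -> cmeas (fun z : mR * T n => g (- z.1 *: rowt z.2)).
Proof.
move=> mg; rewrite (_ : (fun z => _) = fun z : mR * T n => g (rowt [tuple - z.1 * tnth z.2 i | i < n])).
  exact: (cmeas_comp mg measurable_dilate).
apply/funext => z; congr g; apply/rowP => i; rewrite !mxE tnth_mktuple; congr (_ * _).
Qed.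

Let cintegrable_H : cintegrable (mu \x lt n)%E setT (fun z => H z.1 (rowt z.2)).
Proof.
have [K K0 HK] := fourier_decay s0 q0 gu; have [E E0 HE] := fourier_decay r10 r20 gs.
have [D D0 HD] := fourier_wavelet_decay r10 r20 gp p0.
have o0 (y : R) : 0 < oneDsqr y by rewrite (lt_le_trans ltr01)// oneDsqr_ge1.
(* Its integral over all real [a] is at most [K * E * D * pi * weight xi]. *)
pose B a xi := K * E * D * weight xi * (`|xi| * (oneDsqr (a * `|xi|))^-1).
have B0 a xi : 0 <= B a xi.
  by rewrite !mulr_ge0 ?weight_ge0 ?invr_ge0// ltW.
have mnorm : rmeas (fun xi : rV => `|xi|) by apply: continuous_rmeas; exact: norm_continuous.
have mB : measurable_fun [set: mR * T n] (fun z => B z.1 (rowt z.2)).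
  apply: measurable_funM.
    apply: measurable_funM; first exact: measurable_cst.
    exact: (measurableT_comp (@rmeas_weight R n) measurable_snd).
  apply: measurable_funM; first exact: (measurableT_comp mnorm measurable_snd).
  apply: (measurableT_comp (@measurable_oneDsqrV R)); apply: measurable_funM.
    exact: measurable_fst.
  exact: (measurableT_comp mnorm measurable_snd).
apply: (@cintegrable_le _ (mR * T n)%type R (mu \x lt n)%E _ (fun z => B z.1 (rowt z.2))).
- apply: cmeasM.
    apply: cmeasM; first exact: (cmeas_comp (fourier_meas s0 q0 gu) measurable_snd).
    apply: cmeasM; first exact: (cmeas_comp (crmeas_expi (rmeas_dotv x)) measurable_snd).
    apply: cmeasM; first exact: (cmeas_dilate (fourier_meas r10 r20 gp)).
    exact: (cmeas_conj (cmeas_dilate (fourier_meas r10 r20 gs))).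
  by apply: cmeas_real; exact: (measurableT_comp (@measurable_posinv R) measurable_fst).
- apply/(integrable21ltyP _ _ _).2; first by apply/measurable_EFinP; exact: mB.
  apply: (@le_lt_trans _ _ (\int[lt n]_t (K * E * D * pi * weight (rowt t))%:E)%E); last first.
    have /integrableP[_] := rintegrableZ (K * E * D * pi) (@rintegrable_weight R n).
    apply: le_lt_trans; apply: ge0_le_integral => //.
    + by move=> t _; rewrite lee_fin !mulr_ge0 ?weight_ge0 ?pi_ge0.
    + apply/measurable_EFinP; apply: measurable_funM; first exact: measurable_cst.
      exact: rmeas_weight.
    + apply/measurable_EFinP; apply: measurableT_comp => //.
      apply: measurable_funM; first exact: measurable_cst.
      exact: rmeas_weight.
    + by move=> t _; rewrite lee_fin ler_norm.
  apply: ge0_le_integral => //.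
  + by move=> t _; exact: integral_ge0.
  + apply: (measurable_fun_fubini_tonelli_G (fun z : mR * T n => `|(EFin \o (fun z => B z.1 (rowt z.2))) z|%E)) => //.
    by apply: measurableT_comp => //; apply/measurable_EFinP; exact: mB.
  + apply/measurable_EFinP; apply: measurable_funM; first exact: measurable_cst.
    exact: rmeas_weight.
  move=> t _; under eq_integral do rewrite /= ger0_norm//.
  set xi := rowt t.
  have [xi0|xi0] := eqVneq xi 0.
    under eq_integral do rewrite /B xi0 normr0 mul0r mulr0.
    by rewrite integral0 lee_fin !mulr_ge0 ?weight_ge0 ?pi_ge0.
  under eq_integral do rewrite /B mulrA EFinM.
  rewrite ge0_integralZl//.
  + rewrite integral_scaled_oneDsqrV ?normr_eq0// -EFinM lee_fin normr_id.
    rewrite [leLHS](_ : _ = K * E * D * pi * weight xi) //.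
    by field; rewrite normr_eq0.
  + apply/measurable_EFinP; apply: (measurableT_comp (@measurable_oneDsqrV R)).
    by apply: measurable_funM => //; exact: measurable_cst.
  + rewrite lee_fin; apply: mulr_ge0 => //; apply: mulr_ge0; last exact: weight_ge0.
    exact: mulr_ge0 (mulr_ge0 K0 E0) D0.
- case=> a t; change (cmod (H a (rowt t)) <= B a (rowt t)).
  set xi := rowt t; rewrite /H !cmodM cmod_expi mul1r cmod_conj cmod_real.
  have [pi0 pi1] := posinv_norm a; rewrite ger0_norm//.
  have h1 := HD (- a *: xi); have h2 := HE (- a *: xi); have h3 := HK xi.
  have w1 := weight_le1 (- a *: xi).
  have {}h2 : cmod (fourier psi (- a *: xi)) <= E.
    by apply: le_trans h2 _; rewrite ler_piMr.
  have on : oneDsqr `|- a *: xi| = oneDsqr (a * `|xi|).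
    by rewrite /oneDsqr normrZ normrN !exprMn real_normK ?num_real.
  rewrite on normrZ normrN in h1.
  apply: (@le_trans _ _ (K * weight xi * (D * (`|a| * `|xi| / oneDsqr (a * `|xi|)) * E) * posinv a)).
    rewrite ler_wpM2r//; apply: ler_pM => //; rewrite ?mulr_ge0 ?cmod_ge0//.
    by apply: ler_pM; rewrite ?cmod_ge0.
  rewrite [leLHS](_ : _ = B a xi * (posinv a * `|a|)); last by rewrite /B; ring.
  by rewrite ler_piMr.
Qed.

(** In the variables [r = a * enorm xi] and [w = - xi / enorm xi] this is the
    integral that defines the constant [c]. At [xi = 0], where [w] makes no
    sense, both sides vanish because the integral of [u] does. *)
Let inner xi : cintegral mu setT (fun a => H a xi) = fourier u xi * expi (dotv xi x) * c.
Proof.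
have [xi0|xi0] := eqVneq xi 0.
  have E0 : fourier u xi = 0.
    rewrite -u0 xi0; congr rvint; apply/funext => y.
    by rewrite dotvC /dotv big1 ?oppr0 ?expi0 ?mulr1// => i _; rewrite mxE mul0r.
  rewrite E0 !mul0r -[RHS](_ : cintegral mu setT (fun=> 0) = 0); last first.
    by rewrite /cintegral /= Rintegral_cst// mul0r.
  by congr cintegral; apply/funext => a; rewrite /H E0 !mul0r.
have e0 := enorm_gt0 xi0; set e := enorm xi in e0.
have en0 : e != 0 by rewrite gt_eqF.
pose w := - e^-1 *: xi.
have [ki kE] : posintegrable (calderon_integrand psi phi w) /\ calderon psi phi w = c.
  by apply: hc; rewrite /unit_sphere /= enormZ normrN gtr0_norm ?invr_gt0// mulVf.
have ki' := posintegrableE ki.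
have ke := cintegrable_scale en0 ki'.
have HE : (fun a => H a xi) = fun a => (fourier u xi * expi (dotv xi x) * e%:C) *
    ((heaviside (e * a))%:C * calderon_integrand psi phi w (e * a)).
  apply/funext => a; rewrite /H /calderon_integrand heaviside_scale//.
  have -> : (e * a) *: w = - a *: xi.
    by rewrite /w scalerA mulrN mulrAC mulfV// mul1r.
  rewrite /posinv realcM invfM realcM.
  have E : e%:C * (e^-1)%:C = 1 :> R[i] by rewrite -realcM mulfV.
  by rewrite -[LHS]mulr1 -E; ring.
rewrite HE (cintegralZl _ ke) (cintegral_scale e0 ki') -posintE -/(calderon psi phi w) kE.
by rewrite !mulrA -(mulrA _ e%:C) -realcM mulfV// mulr1.
Qed.

(** Fubini's theorem brings the integral over the scales inside, where it
    equals [c]; what remains is Fourier inversion for [u]. *)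
Lemma calderon_formula :
  wavelet_synthesis (conjf psi) (wavelet_transform (conjf phi) u) x = c * u x.
Proof.
have k0 : kappa != 0.
  by rewrite eq_complex /= eqxx andbT mulf_neq0// expf_neq0// gt_eqF// pi_gt0.
have Hi := cintegrable_H.
rewrite /wavelet_synthesis posintE.
rewrite (_ : (fun a => _) = fun a => rvint (H a) * kappa^-1); last first.
  apply/funext => a; have [a0|a0] := ltP 0 a; last first.
    rewrite (_ : heaviside a = 0) ?mul0r; last by rewrite /heaviside ltNge a0.
    rewrite (_ : rvint (H a) = 0) ?mul0r//.
    rewrite (_ : H a = fun=> 0); first by rewrite rvintE /= !rint0.
    by apply/funext => xi; rewrite /H /posinv /heaviside ltNge a0 /= mul0r mulr0.
  apply: (mulIf k0); rewrite divfK// /H rvintZr; last first.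
    have [K K0 HK] := fourier_decay s0 q0 gu; have [E E0 HE] := fourier_decay r10 r20 gs.
    have [D D0 HD] := fourier_decay r10 r20 gp.
    have dil g : crmeas g -> crmeas (fun xi => g (- a *: xi)).
      by move=> /(crmeas_affine 0 (- a)); under [X in crmeas X -> _]eq_fun do rewrite add0r.
    apply: (rcint_wle (C := K * (D * E))).
      apply: cmeasM; first exact: (fourier_meas s0 q0 gu).
      apply: cmeasM; first exact: (crmeas_expi (rmeas_dotv x)).
      apply: cmeasM; first exact: (dil _ (fourier_meas r10 r20 gp)).
      exact: (cmeas_conj (dil _ (fourier_meas r10 r20 gs))).
    move=> xi; rewrite !cmodM cmod_expi mul1r cmod_conj mulrAC.
    apply: ler_pM; rewrite ?mulr_ge0 ?cmod_ge0//.
    apply: ler_pM; rewrite ?cmod_ge0//.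
      by rewrite (le_trans (HD _))// ler_piMr// weight_le1.
    by rewrite (le_trans (HE _))// ler_piMr// weight_le1.
  rewrite -(synthesis_fourier s0 q0 r10 r20 x a0 gu gp gs) /heaviside /posinv a0 mul1r /heaviside a0 mul1r.
  by rewrite mulrAC.
rewrite cintegralZr; last exact: (cintegrable_section Hi).
apply: (mulIf k0); rewrite divfK//.
transitivity (rvint (fun xi => cintegral mu setT (fun a => H a xi))).
  exact: (cFubini Hi).
under [X in rvint X]eq_fun do rewrite inner.
rewrite rvintZr; last first.
  have [K K0 HK] := fourier_decay s0 q0 gu.
  apply: (rcint_wle (C := K)) => [|xi]; last by rewrite cmodM cmod_expi mulr1.
  apply: cmeasM; first exact: (fourier_meas s0 q0 gu).
  exact: (crmeas_expi (rmeas_dotv x)).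
by rewrite (fourier_inversion s0 q0 _ gu) mulrC mulrA.
Qed.

End Calderon.

(** * Membership in the space on the half-space *)

Section WaveletMembership.
Context {R : realType} {n : nat}.
Local Notation rV := 'rV[R]_n.
Local Notation H := (rV * R)%type.
Implicit Types (f g v : rV -> R) (x b z : rV) (a : R) (p : H).

Lemma decay_mono f (K A A' r : R) : 0 <= K -> 0 <= A -> A <= A' -> decay f K A r ->
  decay f K A' r.
Proof.
move=> K0 A0 AA df p x; apply: le_trans (df p x) _.
by apply: geo_le; rewrite ?Fp_ge0 ?K0 ?lexx ?A0.
Qed.

Lemma regular_mono f (K A A' r : R) : 0 <= K -> 0 <= A -> A <= A' -> regular f K A r ->
  regular f K A' r.
Proof.
move=> K0 A0 AA df l x; apply: le_trans (df l x) _.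
by apply: geo_le; rewrite ?Fp_ge0 ?K0 ?lexx ?A0.
Qed.

Lemma gsbound_decay f (C A r1 r2 : R) : gsbound f C A r1 r2 -> decay f C A r2.
Proof. by move=> bf p x; have := bf [::] p x; rewrite addn0 Fp0 mulr1. Qed.

Lemma gsbound_regular f (C A r1 r2 : R) : gsbound f C A r1 r2 -> regular f C A r1.
Proof. by move=> bf l x; have := bf l 0%N x; rewrite expr0 mul1r add0n Fp0 mul1r. Qed.

Variables (s q r1 r2 : R).
Hypotheses (n0 : (0 < n)%N) (s0 : 0 < s) (q1 : 1 < q) (r10 : 0 < r1) (r21 : 1 < r2).
Let t := q + r1 + r2 - 1.

(** A derivative of the transform is a sum of transforms of derivatives of [v]
    by monomial multiples of [g]. These keep vanishing moments, so that
    [wavI_decay] applies; its constants do not depend on the derivative of [v],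
    and the number of terms only depends on [al]. *)
Lemma Wf_bound v g al : gsr s q v -> moment0 v -> gsr r1 r2 g -> moment0 g ->
  exists D E : R, [/\ 0 <= D, 1 <= E & forall m b a k l1 l2, 0 < a ->
  (a ^+ l1 + a ^- l2) * japanese b ^+ k *
    `|dRl hdir (nseq al None ++ map Some m) (Wf v g) (b, a)| <=
  D * E ^+ (size m + k + l1 + l2) *
   (Fp (size m) s * (Fp k t * Fp l1 (t - r2) * Fp l2 (s + r2 - 1)))].
Proof.
move=> gv v0 gg g0.
have q0 : 0 <= q by apply/ltW/(lt_trans ltr01).
have r20 : 0 <= r2 by apply/ltW/(lt_trans ltr01).
have [sv [Cv [Av [Cv0 Av1 bv]]]] := gv.
have [Cg [Ag [Cg0 Ag1 bg]]] := gsbound_xw al (ltW r10) r20 gg.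
have Av0 := le_trans ler01 Av1; have Ag0 := le_trans ler01 Ag1.
have [P2 P2E] : exists P2, 2 `^ s = P2 :> R by eexists.
have P21 : 1 <= P2 by rewrite -P2E two_powR_ge1// ltW.
have P20 := le_trans ler01 P21.
pose A := P2 * Av + Ag.
have PA : Av <= P2 * Av by rewrite ler_peMl.
have A1 : 1 <= A by rewrite (le_trans Ag1)// lerDr mulr_ge0.
have AvA : Av <= A by rewrite (le_trans PA)// lerDl.
have [D [E [D0 E1 HD]]] := wavI_decay n0 Cg0 A1 q1 r21 r10 s0.
have E0 := le_trans ler01 E1.
pose P := P2 * Av * P2.
have P1 : 1 <= P by rewrite /P -[leLHS]mulr1 ler_pM// -[leLHS]mulr1 ler_pM.
have P0 := le_trans ler01 P1.
pose D' := (n ^ al)%:R * (Cv * P ^+ al * Fp al s * D).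
have D'0 : 0 <= D' by rewrite !mulr_ge0 ?exprn_ge0 ?Fp_ge0 ?ler0n.
exists D', (P * E); split => //; first by rewrite -[leLHS]mulr1 ler_pM.
move=> m b a k l1 l2 a0.
set l := nseq al None ++ map Some m.
set FF := Fp k t * Fp l1 (t - r2) * Fp l2 (s + r2 - 1).
have FF0 : 0 <= FF by rewrite !mulr_ge0 ?Fp_ge0.
set X := (a ^+ l1 + a ^- l2) * japanese b ^+ k.
have X0 : 0 <= X.
  by rewrite mulr_ge0 ?addr_ge0 ?invr_ge0 ?exprn_ge0 ?sqrtr_ge0 ?(ltW a0).
have sl : size l = (al + size m)%N by rewrite size_cat size_nseq size_map.
have cl : count_mem None l = al.
  rewrite count_cat count_nseq /= mul1n count_map.
  by rewrite (_ : count _ m = 0%N) ?addn0//; elim: (m).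
pose N := (size m + k + l1 + l2)%N.
pose B := Cv * P ^+ al * Fp al s * D * ((P * E) ^+ N * (Fp (size m) s * FF)).
have term w : w \in wwords l ->
    X * `|wavI (pds w.1 v) (fun z => xw w.2 z * g z) b a| <= B.
  move=> /size_wwords[]; rewrite sl cl => s1 s2.
  (* what the derivatives already taken cost: the factorial of a sum of orders
     splits at the price of the geometric factor [P2] *)
  pose K := Cv * (P2 * Av) ^+ size w.1 * Fp (size w.1) s.
  have K0 : 0 <= K by rewrite !mulr_ge0 ?exprn_ge0 ?mulr_ge0 ?Fp_ge0.
  have av : admissible (pds w.1 v) K A s q.
    split.
    - exact: smoothr_pds.
    - apply: (decay_mono K0 Av0 AvA) => p x; apply: le_trans (bv w.1 p x) _.
      rewrite exprD /K [leLHS](_ : _ = (Cv * Fp (size w.1) s * Av ^+ p * Fp p q) * Av ^+ size w.1); last by ring.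
      rewrite [leRHS](_ : _ = (Cv * Fp (size w.1) s * Av ^+ p * Fp p q) * (P2 * Av) ^+ size w.1); last by ring.
      by rewrite ler_wpM2l ?mulr_ge0 ?Fp_ge0 ?exprn_ge0// lerXn2r ?nnegrE ?mulr_ge0.
    - have PAA : P2 * Av <= A by rewrite /A lerDl.
      apply: (regular_mono K0 _ PAA); first exact: mulr_ge0.
      move=> l' x; rewrite -pds_cat; apply: le_trans (gsbound_regular bv _ _) _.
      rewrite size_cat.
      apply: (@le_trans _ _ (Cv * Av ^+ (size l' + size w.1) *
        (P2 ^+ (size l' + size w.1) * (Fp (size l') s * Fp (size w.1) s)))).
        by rewrite ler_wpM2l ?mulr_ge0 ?exprn_ge0// -P2E Fp_add// ltW.
      by rewrite /K !exprMn !exprD le_eqVlt; apply/orP; left; apply/eqP; ring.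
    - exact: moment0_pds (ltW s0) q0 gv v0.
  have ag : admissible (fun z => xw w.2 z * g z) Cg A r1 r2.
    have AgA : Ag <= A by rewrite /A lerDr mulr_ge0.
    split.
    - exact: (gsr_xw w.2 (ltW r10) r20 gg).1.
    - exact: (decay_mono Cg0 Ag0 AgA (gsbound_decay (bg _ s2))).
    - exact: (regular_mono Cg0 Ag0 AgA (gsbound_regular (bg _ s2))).
    - exact: moment0_xw.
  apply: le_trans (HD _ _ _ b a k l1 l2 K0 av ag a0) _; rewrite -/t -/FF.
  rewrite /K s1 /B.
  apply: (@le_trans _ _ (Cv * (P2 * Av) ^+ (al + size m) *
     (P2 ^+ (al + size m) * (Fp al s * Fp (size m) s)) * D * E ^+ (k + l1 + l2) * FF)).
    rewrite ler_wpM2r// ler_wpM2r ?exprn_ge0// ler_wpM2r//.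
    by rewrite ler_wpM2l ?mulr_ge0 ?exprn_ge0 ?mulr_ge0// -P2E Fp_add// ltW.
  rewrite [leLHS](_ : _ = Cv * P ^+ al * Fp al s * D * ((P ^+ size m * E ^+ (k + l1 + l2)) * (Fp (size m) s * FF))); last first.
    by rewrite /P !exprMn !exprD; ring.
  rewrite ler_wpM2l ?mulr_ge0 ?exprn_ge0 ?Fp_ge0// ler_wpM2r ?mulr_ge0 ?Fp_ge0//.
  rewrite [leRHS]exprMn ler_pM ?exprn_ge0// ler_weXn2l//.
    by rewrite /N -!addnA leq_addr.
  by rewrite /N -!addnA leq_addl.
rewrite (dRl_Wf (ltW s0) q0 (ltW r10) r20)//.
apply: le_trans (ler_wpM2l X0 (ler_norm_sum _ _ _)) _.
rewrite mulr_sumr; apply: (@le_trans _ _ (\sum_(w <- wwords l) B)).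
  by rewrite big_seq [leRHS]big_seq; apply: ler_sum => w wl; exact: term.
rewrite big_const_seq count_predT iter_addr_0 card_wwords cl -[leLHS]mulr_natl.
by rewrite /B /D' le_eqVlt; apply/orP; left; apply/eqP; rewrite /N; ring.
Qed.

End WaveletMembership.

Section Membership.
Context {R : realType} {n : nat}.
Local Notation rV := 'rV[R]_n.
Local Notation H := (rV * R)%type.
Implicit Types (u phi : rV -> R[i]).

Let Re_ (f : rV -> R[i]) := fun x => cRe (f x).
Let Im_ (f : rV -> R[i]) := fun x => cIm (f x).

Variables (s q r1 r2 : R).
Hypotheses (n0 : (0 < n)%N) (s0 : 0 < s) (q1 : 1 < q) (r10 : 0 < r1) (r21 : 1 < r2).

Let q0 : 0 < q. Proof. exact: lt_trans q1. Qed.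
Let r20 : 0 < r2. Proof. exact: lt_trans r21. Qed.

Lemma half_space_open : open (@half_space R n).
Proof.
rewrite (_ : half_space = snd @^-1` [set x : R | 0 < x]); last by [].
apply: open_comp => [p _|]; first exact: cvg_snd.
exact: open_gt.
Qed.

(** The complex transform consists of four real ones. Passing from factorials
    of [mabs be] to multi-index factorials costs a factor [(2 ^ n) ^ s] per
    derivative, absorbed in [h]. *)
Lemma wavelet_transform_hs u phi : gelfand_shilov0 s q u -> gelfand_shilov0 r1 r2 phi ->
  hs_space s (q + r1 + r2 - 1) (q + r1 + r2 - 1 - r2) (s + r2 - 1)
    (wavelet_transform (conjf phi) u).
Proof.
move=> [gu mu] [gphi mphi].
have gsu := gelfand_shilov_gsc n0 s0 q0 gu; have [gu1 gu2] := gsu.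
have gsphi := gelfand_shilov_gsc n0 r10 r20 gphi; have [gp1 gp2] := gsphi.
have [mu1 mu2] := moments_vanish_parts mu; have [mp1 mp2] := moments_vanish_parts mphi.
have s0' := ltW s0; have q0' := ltW q0; have r10' := ltW r10; have r20' := ltW r20.
have sW v g : gsr s q v -> gsr r1 r2 g -> smoothV (@hdir R n) setT (Wf v g).
  exact: smoothV_Wf.
have tp b a := transform_parts r20' b a gsu gsphi.
have S11 := sW _ _ gu1 gp1; have S12 := sW _ _ gu1 gp2.
have S21 := sW _ _ gu2 gp1; have S22 := sW _ _ gu2 gp2.
pose FR (p : H) := Wf (Re_ u) (Re_ phi) p + -1 * Wf (Im_ u) (Im_ phi) p.
pose FI (p : H) := Wf (Re_ u) (Im_ phi) p + 1 * Wf (Im_ u) (Re_ phi) p.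
have ER p : half_space p -> cRe (wavelet_transform (conjf phi) u p) = FR p.
  by case: p => b a a0; rewrite (transformE q0' r20' b a0 gsu gsphi) tp /FR /= mulN1r.
have EI p : half_space p -> cIm (wavelet_transform (conjf phi) u p) = FI p.
  by case: p => b a a0; rewrite (transformE q0' r20' b a0 gsu gsphi) tp /FI /= mul1r.
split.
  apply/smooth_onP; split.
    apply: (smoothV_local half_space_open ER) => l x _.
    exact: (smoothV_lincomb (-1) S11 S22).
  apply: (smoothV_local half_space_open EI) => l x _.
  exact: (smoothV_lincomb 1 S12 S21).
move=> al.
have [D1 [E1 [D10 E11 H1]]] := Wf_bound n0 s0 q1 r10 r21 al gu1 mu1 gp1 mp1.
have [D2 [E2 [D20 E21 H2]]] := Wf_bound n0 s0 q1 r10 r21 al gu2 mu2 gp2 mp2.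
have [D3 [E3 [D30 E31 H3]]] := Wf_bound n0 s0 q1 r10 r21 al gu1 mu1 gp2 mp2.
have [D4 [E4 [D40 E41 H4]]] := Wf_bound n0 s0 q1 r10 r21 al gu2 mu2 gp1 mp1.
have [E EE] : exists E, E1 + E2 + E3 + E4 = E by eexists.
have E1e := le_trans ler01 E11; have E2e := le_trans ler01 E21.
have E3e := le_trans ler01 E31; have E4e := le_trans ler01 E41.
have E1' : 0 <= E1 <= E by rewrite -EE E1e -!addrA lerDl !addr_ge0.
have E2' : 0 <= E2 <= E by rewrite -EE E2e; move: E1e E3e E4e; lra.
have E3' : 0 <= E3 <= E by rewrite -EE E3e; move: E1e E2e E4e; lra.
have E4' : 0 <= E4 <= E by rewrite -EE E4e; move: E1e E2e E3e; lra.
have Eg1 : 1 <= E by case/andP: E1' => _; exact: le_trans.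
have Eg0 : 0 < E by exact: lt_le_trans Eg1.
pose D := D1 + D2 + D3 + D4.
have D0 : 0 <= D by rewrite !addr_ge0.
pose Q := (2 ^+ n) `^ s : R.
have Q0 : 0 < Q by rewrite powR_gt0// exprn_gt0.
have Q1 : 1 <= Q.
  rewrite -[leLHS](powRr0 (2 ^+ n)); apply: ler_powR; last exact: ltW.
  by rewrite exprn_ege1// ler1n.
exists ((E * Q)^-1); first by rewrite invr_gt0 mulr_gt0.
apply: (@le_lt_trans _ _ D%:E); last exact: ltry.
apply: ge_ereal_sup => _ [b [a [be [k [l1 [l2 [a0 ->]]]]]]]; rewrite lee_fin.
set m := mlist be.
have sm : size m = mabs be by exact: size_mlist.
set N := (mabs be + k + l1 + l2)%N.
set tt := q + r1 + r2 - 1 in H1 H2 H3 H4 *.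
set FF := Fp k tt * Fp l1 (tt - r2) * Fp l2 (s + r2 - 1).
have FF0 : 0 < FF by rewrite !mulr_gt0 ?Fp_gt0.
set X := (a ^+ l1 + a ^- l2) * japanese b ^+ k.
have X0 : 0 <= X.
  by rewrite mulr_ge0 ?addr_ge0 ?invr_ge0 ?exprn_ge0 ?sqrtr_ge0 ?(ltW a0).
set l := nseq al None ++ map Some m.
have bound : X * cmod (hderiv al be (wavelet_transform (conjf phi) u) (b, a)) <=
    D * E ^+ N * (Fp (mabs be) s * FF).
  apply: le_trans (ler_wpM2l X0 (cmod_le _)) _.
  have -> : cRe (hderiv al be (wavelet_transform (conjf phi) u) (b, a)) =
      dRl hdir l (Wf (Re_ u) (Re_ phi)) (b, a) + -1 * dRl hdir l (Wf (Im_ u) (Im_ phi)) (b, a).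
    transitivity (dRl (@hdir R n) l FR (b, a)); last by rewrite /FR (dRl_lincomb l (-1) S11 S22).
    rewrite -(dRl_local (@hdir R n) l half_space_open ER)//.
    by rewrite -(cRe_iterD (@hdir R n) l).
  have -> : cIm (hderiv al be (wavelet_transform (conjf phi) u) (b, a)) =
      dRl hdir l (Wf (Re_ u) (Im_ phi)) (b, a) + 1 * dRl hdir l (Wf (Im_ u) (Re_ phi)) (b, a).
    transitivity (dRl (@hdir R n) l FI (b, a)); last by rewrite /FI (dRl_lincomb l 1 S12 S21).
    rewrite -(dRl_local (@hdir R n) l half_space_open EI)//.
    by rewrite -(cIm_iterD (@hdir R n) l).
  have tri (x y z w : R) : `|x + -1 * y| + `|z + 1 * w| <= `|x| + `|y| + `|z| + `|w|.
    rewrite mulN1r mul1r -addrA lerD//; [exact: ler_normB|exact: ler_normD].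
  apply: le_trans (ler_wpM2l X0 (tri _ _ _ _)) _.
  have G Di Ei y : 0 <= Di -> 0 <= Ei <= E ->
      y <= Di * Ei ^+ (size m + k + l1 + l2) * (Fp (size m) s * FF) ->
      y <= Di * E ^+ N * (Fp (mabs be) s * FF).
    move=> Di0 Eii /le_trans; apply; rewrite sm; apply: geo_le => //.
      by rewrite Di0 lexx.
    by rewrite mulr_ge0 ?Fp_ge0// ltW.
  have G1 := G _ _ _ D10 E1' (H1 m b a k l1 l2 a0).
  have G2 := G _ _ _ D20 E2' (H2 m b a k l1 l2 a0).
  have G3 := G _ _ _ D30 E3' (H3 m b a k l1 l2 a0).
  have G4 := G _ _ _ D40 E4' (H4 m b a k l1 l2 a0).
  rewrite !mulrDr /D !mulrDl; exact: lerD (lerD (lerD G1 G2) G3) G4.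
have hE : (mfact be)%:R `^ s * k`!%:R `^ tt * l1`!%:R `^ (tt - r2) * l2`!%:R `^ (s + r2 - 1) =
   (mfact be)%:R `^ s * FF :> R by rewrite /FF /Fp !mulrA.
rewrite hE -/N -(mulrA _ _ (japanese b ^+ k)) -/X.
set M := (mfact be)%:R `^ s.
have M0 : 0 < M by rewrite powR_gt0// ltr0n prodn_gt0// => i; rewrite fact_gt0.
have FM : Fp (mabs be) s <= Q ^+ mabs be * M.
  rewrite /Q -powR_exprn_comm ?exprn_ge0// -powRM ?exprn_ge0//.
  apply: ge0_ler_powR; rewrite ?nnegrE ?mulr_ge0 ?exprn_ge0 ?ler0n//.
  by rewrite -exprM -natrX -natrM ler_nat mabs_le_mfact.
rewrite exprVn; set Y := cmod _ in bound *; set Z := (E * Q) ^+ N.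
have Z0 : 0 < Z by rewrite exprn_gt0 ?mulr_gt0.
rewrite (_ : _ * Y = X * Y / (Z * (M * FF))); last first.
  by field; rewrite !gt_eqF.
have MF0 : 0 < Z * (M * FF) by rewrite mulr_gt0// mulr_gt0.
rewrite ler_pdivrMr//; apply: le_trans bound _.
apply: (@le_trans _ _ (D * E ^+ N * (Q ^+ N * M * FF))).
  rewrite ler_wpM2l ?mulr_ge0 ?exprn_ge0 ?(ltW Eg0)//.
  rewrite ler_wpM2r ?(ltW FF0)//; apply: le_trans FM _.
  by rewrite ler_wpM2r ?(ltW M0)// ler_weXn2l// /N -!addnA leq_addr.
by rewrite /Z exprMn le_eqVlt; apply/orP; left; apply/eqP; ring.
Qed.

End Membership.

(** * Duality *)

Section Assembly.
Context {R : realType} {n : nat}.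
Local Notation rV := 'rV[R]_n.
Implicit Types (u phi psi : rV -> R[i]).

Lemma moments_vanish_rvint phi : moments_vanish phi -> rvint phi = 0.
Proof.
move=> m0; rewrite -(m0 (fun=> 0%N)); congr rvint; apply/funext => x.
by rewrite /mpow big1 ?mul1r// => i _; rewrite expr0.
Qed.

Lemma gelfand_shilov_le r1 r2 r2' phi : 0 <= r2 <= r2' ->
  gelfand_shilov r1 r2 phi -> gelfand_shilov r1 r2' phi.
Proof.
move=> /andP[r20 r22] [sphi [h h0 hphi]]; split=> //; exists h => //.
apply: le_lt_trans hphi; apply: ge_ereal_sup => _ [x [al [be ->]]].
apply: le_trans (ereal_sup_ubound _); last by exists x, al, be.
rewrite lee_fin ler_wpM2r ?cmod_ge0//.
have f1 (be' : 'I_n -> nat) : 1 <= (mfact be')%:R :> R.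
  by rewrite ler1n prodn_gt0// => i; rewrite fact_gt0.
have p0 (be' : 'I_n -> nat) (r : R) : 0 < (mfact be')%:R `^ r.
  by rewrite powR_gt0// (lt_le_trans ltr01).
rewrite ler_wpM2l ?exprn_ge0 ?(ltW h0)// lef_pV2 ?posrE ?mulr_gt0//.
by rewrite ler_wpM2r ?(ltW (p0 _ _))// ler_powR.
Qed.

Lemma unit_sphere_neq0 : (0 < n)%N -> exists w : rV, unit_sphere w.
Proof.
move=> n0; exists (rvdir (Ordinal n0)).
by rewrite /unit_sphere /= /enorm dotv_rvdir mxE !eqxx sqrtr1.
Qed.

Lemma calderon_constE psi phi (c : R[i]) : (0 < n)%N ->
  (forall w : rV, unit_sphere w -> calderon psi phi w = c) -> calderon_const psi phi = c.
Proof.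
move=> n0 hc; rewrite /calderon_const; case: xgetP => [c' _ /= hc'|h].
  by have [w sw] := unit_sphere_neq0 n0; rewrite -(hc' w sw) hc.
by have := h c; rewrite /= => /(_ hc).
Qed.

(** [c u] is the combination [(c - 1) u + u] of [u] with itself, so that no other
    member of [E0] enters. *)
Lemma dual_scale (E0 : set (rV -> R[i])) nb f (c : R[i]) u : dual E0 nb f ->
  E0 u -> f (fun x => c * u x) = c * f u.
Proof.
move=> [lin _] Eu; have := lin (c - 1) _ _ Eu Eu.
rewrite mulrBl mul1r subrK => <-; congr f; apply/funext => x.
by rewrite mulrBl mul1r subrK.
Qed.

End Assembly.

Theorem theorem3 (R : realType) (n : nat) (rho1 rho2 s t : R)
    (psi phi : 'rV[R]_n -> R[i]) :
  (0 < n)%N -> 0 < rho1 -> 1 < rho2 -> 0 < s -> rho1 + rho2 < t ->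
  gelfand_shilov0 rho1 rho2 psi -> gelfand_shilov0 rho1 rho2 phi ->
  nondegenerate_wavelet psi -> reconstruction_wavelet psi phi ->
  forall f : ('rV[R]_n -> R[i]) -> R[i], gelfand_shilov0_dual s t f ->
  forall u : 'rV[R]_n -> R[i], gelfand_shilov0 s (t + 1 - rho1 - rho2) u ->
    (calderon_const psi phi)^-1
      * wavelet_synthesis_dual rho1 rho2 s t phi
          (wavelet_transform_dual rho2 s t psi f) u
    = f u.
Proof.
move=> n0 r10 r21 s0 tr gpsi gphi _ [_ _ [c c0 hc]] f ff u gu.
have r20 : 0 < rho2 by exact: lt_trans r21.
set q := t + 1 - rho1 - rho2 in gu *.
have q1 : 1 < q by rewrite /q; lra.
have q0 : 0 < q by exact: lt_trans q1.
have [[gsu mu] [gsphi mphi] [gspsi mpsi]] := And3 gu gphi gpsi.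
have hW : hs_space s t (t - rho2) (s + rho2 - 1) (wavelet_transform (conjf phi) u).
  have := wavelet_transform_hs n0 s0 q1 r10 r21 gu gphi.
  by rewrite (_ : q + rho1 + rho2 - 1 = t)//; rewrite /q; ring.
have gu' : gelfand_shilov0 s t u.
  by split=> //; apply: gelfand_shilov_le gsu; rewrite (ltW q0) /q; lra.
rewrite /wavelet_synthesis_dual /functional_on; case: asboolP => // _.
rewrite /wavelet_transform_dual /functional_on; case: asboolP => // _.
have -> : wavelet_synthesis (conjf psi) (wavelet_transform (conjf phi) u) = fun x => c * u x.
  apply/funext => x; apply: (@calderon_formula R n n0 s q rho1 rho2) => //; rewrite ?ltW//.
  - exact: gelfand_shilov_gsc n0 s0 q0 gsu.
  - exact: gelfand_shilov_gsc n0 r10 r20 gsphi.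
  - exact: gelfand_shilov_gsc n0 r10 r20 gspsi.
  - exact: moments_vanish_rvint.
  - exact: moments_vanish_rvint.
rewrite (dual_scale c ff gu') (calderon_constE n0 (fun w sw => (hc w sw).2)).
by rewrite mulrA mulVf// mul1r.
Qed.
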